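(* Let $K$ be a local field of positive characteristic with valuation ring $\mathcal{O}_K$, and let $k$ be the (finite) residue field of $\mathcal{O}_K$. Let $f_{\mathcal{O}_K}:\mathbb{P}^N_{\mathcal{O}_K}\to\mathbb{P}^N_{\mathcal{O}_K}$ be an $\mathcal{O}_K$-morphism satisfying: 1. the natural map $f_{\mathcal{O}_K}^*(\Omega_{\mathbb{P}^N_{\mathcal{O}_K}/\mathcal{O}_K})\to\Omega_{\mathbb{P}^N_{\mathcal{O}_K}/\mathcal{O}_K}$ is the zero map; 2. the special fiber $f_0=f_{\mathcal{O}_K}\times_{\mathcal{O}_K}k:\mathbb{P}^N_k\to\mathbb{P}^N_k$ is equal to $\mathrm{Frob}_q$ for some power $q$ of the prime $\mathrm{char}\,k$. Then the $\overline{K}$-morphism $f_{\overline{K}}:\mathbb{P}^N_{\overline{K}}\to\mathbb{P}^N_{\overline{K}}$ induced by $f_{\mathcal{O}_K}$ satisfies the DML property.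
   Context: $\mathbb{N}=\{0,1,2,\dots\}$. An arithmetic progression is a set of the form $\{mk+l \mid k\in\mathbb{N}\}$ with $m,l\in\mathbb{N}$ (so $m=0$ is allowed). Varieties are integral, but closed subvarieties may be reducible. DML property: let $X$ be a quasi-projective variety over a field $K$ and $f:X\to X$ a $K$-endomorphism. We say that $f$ satisfies the DML property if for every $x\in X(K)$ and every closed subvariety (i.e. reduced closed subscheme) $V$ of $X$, the set $\{n\in\mathbb{N}\mid f^n(x)\in V(K)\}$ is a finite union of arithmetic progressions. $\mathrm{Frob}_q$ on $\mathbb{P}^N_k$ denotes the $k$-endomorphism $[x_0:\cdots:x_N]\mapsto[x_0^q:\cdots:x_N^q]$. $\overline{K}$ is an algebraic closure of $K$. *)

(* Defs.v *)
From HB Require Import structures.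
From mathcomp Require Import all_boot all_order all_algebra.
From mathcomp Require Import boolp freeg mpoly.

Set Implicit Arguments.
Unset Strict Implicit.
Unset Printing Implicit Defensive.

Import Order.TTheory GRing.Theory Num.Theory.
Local Open Scope ring_scope.

Local Notation "x %:F" := (@FracField.tofrac _ x).

(* The value [v 0] is irrelevant: it stands for +oo, hence the side conditions
   [x != 0] here and the disjunctions [_ = 0 \/ _] below. *)
Record discrete_valuation (K : fieldType) := DiscreteValuation {
  dval :> K -> int;
  dvalM : forall x y, x != 0 -> y != 0 -> dval (x * y) = dval x + dval y;
  dvalD : forall x y, x != 0 -> y != 0 -> x + y != 0 ->
    Order.min (dval x) (dval y) <= dval (x + y);
  dval_uniformizer : exists2 t, t != 0 & dval t = 1
}.

Section ValuationRing.
Variables (K : fieldType) (v : discrete_valuation K).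

Lemma dval1 : v 1 = 0.
Proof.
have := dvalM v (oner_neq0 K) (oner_neq0 K).
by rewrite mulr1 => /eqP; rewrite addrC -subr_eq subrr => /eqP.
Qed.

Lemma dvalN x : x != 0 -> v (- x) = v x.
Proof.
move=> x0; have n10 : (-1 : K) != 0 by rewrite oppr_eq0 oner_neq0.
have : v (-1) + v (-1) = 0 by rewrite -(dvalM v n10 n10) mulrNN mulr1 dval1.
move/eqP; rewrite -mulr2n mulrn_eq0 /= => /eqP vn1.
by rewrite -mulN1r (dvalM v n10 x0) vn1 add0r.
Qed.

Lemma dvalV x : x != 0 -> v x^-1 = - v x.
Proof.
move=> x0; apply/eqP; rewrite -addr_eq0 -dvalM ?invr_eq0 //.
by rewrite mulVf // dval1.
Qed.

Definition valring_pred : {pred K} := fun x => (x == 0) || (0 <= v x).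

Lemma valring_subring : subring_closed valring_pred.
Proof.
split=> [|x y|x y]; rewrite !unfold_in /valring_pred ?dval1 ?lexx ?orbT //.
- have [->|x0] /= := eqVneq x 0.
    by move=> _; rewrite sub0r oppr_eq0; have [//|y0 /=] := eqVneq y 0;
      rewrite dvalN.
  have [->|y0] /= := eqVneq y 0; first by rewrite subr0 (negPf x0).
  move=> vx vy; have [//|xy0 /=] := eqVneq (x - y) 0.
  have ny0 : - y != 0 by rewrite oppr_eq0.
  apply: le_trans (@dvalD _ v _ _ x0 ny0 xy0); rewrite le_min vx dvalN //.
- rewrite mulf_eq0; have [//|x0] /= := eqVneq x 0.
  have [//|y0] /= := eqVneq y 0.
  by move=> vx vy; rewrite dvalM // addr_ge0.
Qed.

HB.instance Definition _ :=
  GRing.isSubringClosed.Build K valring_pred valring_subring.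

Definition valring := {x : K | x \in valring_pred}.

HB.instance Definition _ := SubChoice.on valring.
HB.instance Definition _ := [SubChoice_isSubComNzRing of valring by <:].

Definition valring_unit : {pred valring} :=
  fun x => (val x != 0) && (v (val x) == 0).

(* [insubd] leaves non-units fixed, as MathComp requires of inverses. *)
Definition valring_inv (x : valring) : valring := insubd x (val x)^-1.

Lemma valring_mulVx : {in valring_unit, left_inverse 1 valring_inv *%R}.
Proof.
move=> x /andP[x0 /eqP vx]; apply: val_inj; rewrite rmorphM rmorph1 /=.
rewrite /valring_inv val_insubd unfold_in /valring_pred invr_eq0 dvalV // vx.
by rewrite oppr0 lexx orbT mulVf.
Qed.

Lemma valring_unitPl (x y : valring) : y * x = 1 -> valring_unit x.
Proof.
move=> /(congr1 val); rewrite rmorphM rmorph1 /= => yx1.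
have yx0 : val y * val x != 0 by rewrite yx1 oner_neq0.
have [y0 x0] : val y != 0 /\ val x != 0.
  by apply/andP; rewrite -negb_or -mulf_eq0.
rewrite /valring_unit x0 /=.
have := valP y; have := valP x; rewrite !unfold_in /valring_pred.
rewrite (negPf x0) (negPf y0) /= => vx vy.
have /eqP := dvalM v y0 x0; rewrite yx1 dval1 eq_sym.
by rewrite paddr_eq0 // => /andP[].
Qed.

Lemma valring_inv_out : {in [predC valring_unit], valring_inv =1 id}.
Proof.
move=> x; rewrite inE unfold_in /valring_unit negb_and negbK => nux.
apply: val_inj; rewrite /valring_inv val_insubd.
case: ifP => //; have [->|x0] := eqVneq (val x) 0; first by rewrite invr0.
have := valP x; rewrite (negPf x0) in nux *.
rewrite !unfold_in /valring_pred invr_eq0 (negPf x0) /= dvalV // oppr_ge0.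
by move=> ge0 le0; case/negP: nux; rewrite eq_le le0 ge0.
Qed.

HB.instance Definition _ := GRing.ComNzRing_hasMulInverse.Build valring
  valring_mulVx valring_unitPl valring_inv_out.

Lemma valring_integral : GRing.integral_domain_axiom valring.
Proof.
move=> x y /(congr1 val)/eqP; rewrite rmorphM rmorph0 mulf_eq0.
by rewrite -(rmorph0 (val : valring -> K)) !(inj_eq val_inj).
Qed.

HB.instance Definition _ :=
  GRing.ComUnitRing_isIntegral.Build valring valring_integral.

Definition maxideal : {pred valring} :=
  fun x => (val x == 0) || (0 < v (val x)).

Lemma maxideal_closed : idealr_closed maxideal.
Proof.
split=> [||a x y]; rewrite !unfold_in /maxideal ?rmorph0 ?eqxx //.
  by rewrite rmorph1 oner_eq0 dval1 ltxx.
have -> : val (a * x + y) = val a * val x + val y by [].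
have := valP a; rewrite unfold_in /valring_pred.
have [->|a0] /= := eqVneq (val a) 0; first by rewrite mul0r add0r.
have [->|x0] /= := eqVneq (val x) 0; first by rewrite mulr0 add0r.
have ax0 : val a * val x != 0 by rewrite mulf_neq0.
move=> va vx; have vax : 0 < v (val a * val x) by rewrite dvalM // ltr_wpDl.
have [->|y0] /= := eqVneq (val y) 0; first by rewrite addr0 vax orbT.
move=> vy; have [//|s0 /=] := eqVneq (val a * val x + val y) 0.
by apply: lt_le_trans (@dvalD _ v _ _ ax0 y0 s0); rewrite lt_min vax.
Qed.

HB.instance Definition _ := isIdealr.Build valring maxideal maxideal_closed.

Definition residue_field := {ideal_quot maxideal}.

HB.instance Definition _ := GRing.ComNzRing.on residue_field.

Definition reduction : valring -> residue_field := \pi_residue_field%qT.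

HB.instance Definition _ := GRing.RMorphism.on reduction.

Definition close_to (n : int) (x y : K) := x - y = 0 \/ n <= v (x - y).

Definition complete_valuation := forall u : nat -> K,
  (forall n, exists M, forall i j, (M <= i)%N -> (M <= j)%N ->
     close_to n (u i) (u j)) ->
  exists l, forall n, exists M, forall i, (M <= i)%N -> close_to n (u i) l.

(* [K] with the topology of [v] is a nonarchimedean local field; in positive
   characteristic every local field is of this kind. *)
Definition is_local_field :=
  complete_valuation /\ exists s : seq residue_field, forall a, a \in s.

End ValuationRing.

Section ProjectiveEndomorphisms.
Variable N : nat.

(* The endomorphism [x_0 : ... : x_N] |-> [F_0(x) : ... : F_N(x)] of P^N over
   [A], where F_0, ..., F_N are forms of the same degree that generate an ideal
   containing a power of (x_0, ..., x_N), i.e. have no common zero on P^N_A.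
   When [A] is a local ring or a factorial domain every [A]-endomorphism of
   P^N_A arises this way, since the line bundles on P^N_A are the O(d). *)
Record proj_endo (A : comNzRingType) := ProjEndo {
  pe_deg : nat;
  pe_form :> N.+1.-tuple {mpoly A[N.+1]};
  pe_homog : forall i, tnth pe_form i \is pe_deg.-homog;
  pe_generate : forall j, exists (M : nat) (c : 'I_N.+1 -> {mpoly A[N.+1]}),
    'X_j ^+ M = \sum_i c i * tnth pe_form i
}.

(* Equality of the underlying morphisms: the forms may differ by a factor. *)
Definition proj_endo_eq (A : comNzRingType) (f g : proj_endo A) :=
  forall i j, tnth f i * tnth g j = tnth f j * tnth g i.

Section BaseChange.
Variables (A B : comNzRingType) (phi : {rmorphism A -> B}) (f : proj_endo A).

Definition base_change_form : N.+1.-tuple {mpoly B[N.+1]} :=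
  [tuple map_mpoly phi (tnth f i) | i < N.+1].

Lemma base_change_homog i : tnth base_change_form i \is (pe_deg f).-homog.
Proof.
rewrite tnth_mktuple; apply/dhomogP => m; rewrite mcoeff_msupp mcoeff_map_mpoly.
move=> fm; move/dhomogP: (pe_homog f i); apply.
by rewrite mcoeff_msupp; apply: contraNneq fm => /= ->; rewrite rmorph0.
Qed.

Lemma base_change_generate j :
  exists (M : nat) (c : 'I_N.+1 -> {mpoly B[N.+1]}),
    'X_j ^+ M = \sum_i c i * tnth base_change_form i.
Proof.
have [M [c Mc]] := pe_generate f j; exists M, (fun i => map_mpoly phi (c i)).
have := congr1 (map_mpoly phi) Mc.
rewrite rmorphXn /= map_mpolyX rmorph_sum /= => ->.
by apply: eq_bigr => i _; rewrite rmorphM tnth_mktuple.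
Qed.

Definition base_change := ProjEndo base_change_homog base_change_generate.

End BaseChange.

Section Frobenius.
Variables (A : comNzRingType) (q : nat).

Definition frobenius_form : N.+1.-tuple {mpoly A[N.+1]} :=
  [tuple 'X_i ^+ q | i < N.+1].

Lemma frobenius_homog i : tnth frobenius_form i \is q.-homog.
Proof.
rewrite tnth_mktuple -[q in q.-homog]mul1n; apply: dhomogMn.
by rewrite dhomogX /= mdeg1.
Qed.

Lemma frobenius_generate j :
  exists (M : nat) (c : 'I_N.+1 -> {mpoly A[N.+1]}),
    'X_j ^+ M = \sum_i c i * tnth frobenius_form i.
Proof.
exists q, (fun i => (i == j)%:R); rewrite (bigD1 j) //= eqxx mul1r tnth_mktuple.
by rewrite big1 ?addr0 // => i /negPf->; rewrite mul0r.
Qed.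

Definition frobenius := ProjEndo frobenius_homog frobenius_generate.

End Frobenius.

End ProjectiveEndomorphisms.

Section KahlerDifferentials.
Variables (A B : comNzRingType) (s : {rmorphism A -> B}).

(* The submodule of relations in the free [B]-module on symbols <<x>>, x in B *)
Inductive kahler_rel : {freeg B / B} -> Prop :=
| kahler_add x y : kahler_rel (<< x + y >> - << x >> - << y >>)
| kahler_mul x y : kahler_rel (<< x * y >> - x *: << y >> - y *: << x >>)
| kahler_const a : kahler_rel << s a >>
| kahler_rel0 : kahler_rel 0
| kahler_relB u w : kahler_rel u -> kahler_rel w -> kahler_rel (u - w)
| kahler_relZ b u : kahler_rel u -> kahler_rel (b *: u).

Definition kahler_pred : {pred {freeg B / B}} := fun u => `[< kahler_rel u >].

Lemma kahler_zmod_closed : zmod_closed kahler_pred.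
Proof.
split; first by apply/asboolP; apply: kahler_rel0.
by move=> u w /asboolP ru /asboolP rw; apply/asboolP; apply: kahler_relB.
Qed.

HB.instance Definition _ :=
  GRing.isZmodClosed.Build {freeg B / B} kahler_pred kahler_zmod_closed.

(* Omega_(B/A) *)
Definition kahler := Quotient.quot kahler_pred.

HB.instance Definition _ := GRing.Zmodule.on kahler.

Local Notation pi := (\pi_kahler%qT).

Lemma kahler_eqP (u w : {freeg B / B}) :
  reflect (pi u = pi w) (u - w \in kahler_pred).
Proof. by rewrite Quotient.idealrBE; apply: eqP. Qed.

Definition kahler_scale (b : B) (w : kahler) : kahler := pi (b *: repr w).

Lemma pi_scale b u : pi (b *: u) = kahler_scale b (pi u).
Proof.
apply/kahler_eqP; rewrite -scalerBr; apply/asboolP/kahler_relZ/asboolP.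
by apply/kahler_eqP; rewrite reprK.
Qed.

Lemma kahler_scaleA b c w :
  kahler_scale b (kahler_scale c w) = kahler_scale (b * c) w.
Proof. by rewrite [kahler_scale c w]/kahler_scale -pi_scale scalerA. Qed.

Lemma kahler_scale1 : left_id 1 kahler_scale.
Proof. by move=> w; rewrite /kahler_scale scale1r reprK. Qed.

Lemma kahler_scaleDr : right_distributive kahler_scale +%R.
Proof.
move=> b w w'; rewrite -[in LHS](reprK w) -[in LHS](reprK w') -raddfD.
by rewrite -pi_scale scalerDr raddfD.
Qed.

Lemma kahler_scaleDl w : {morph kahler_scale^~ w : b c / b + c}.
Proof. by move=> b c; rewrite /kahler_scale scalerDl raddfD. Qed.

HB.instance Definition _ := GRing.Zmodule_isLmodule.Build B kahler
  kahler_scaleA kahler_scale1 kahler_scaleDr kahler_scaleDl.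

Definition kahler_d (x : B) : kahler := pi << x >>.

End KahlerDifferentials.

Section HomogeneousLocalization.
Variables (A : idomainType) (n : nat) (g : {mpoly A[n]}) (e : nat).
Variable hg : g \is e.-homog.

(* The degree-zero part of the localization of A[x_0, ..., x_(n-1)] at the form
   [g] of degree [e], i.e. the coordinate ring of D_+(g). For g = 0, where
   D_+(g) is empty, the convention 1 / 0 = 0 makes it degenerate to [A]. *)
Definition hloc_pred of g \is e.-homog : {pred {fraction {mpoly A[n]}}} :=
  fun u => `[< exists (k : nat) (a : {mpoly A[n]}),
                 a \is (k * e).-homog /\ u = a%:F / g%:F ^+ k >].

Lemma hloc_subring : subring_closed (hloc_pred hg).
Proof.
split=> [|u w /asboolP[k [a [ha ->]]] /asboolP[l [b [hb ->]]]
        |u w /asboolP[k [a [ha ->]]] /asboolP[l [b [hb ->]]]]; apply/asboolP.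
- by exists 0%N, 1; rewrite mul0n dhomog1 expr0 divr1 rmorph1.
- have hgX m : g ^+ m \is (m * e).-homog by rewrite mulnC; apply: dhomogMn.
  have [g0|g0] := eqVneq g 0.
    have const m (c : {mpoly A[n]}) : c \is (m * e).-homog ->
        exists2 c', c' \is (0 * e).-homog & c%:F / g%:F ^+ m = c'%:F.
      case: m => [|m] hc; first by exists c; rewrite // expr0 divr1.
      by exists 0; rewrite ?dhomog0 // g0 rmorph0 expr0n invr0 mulr0.
    have [a' ha' ->] := const _ _ ha; have [b' hb' ->] := const _ _ hb.
    by exists 0%N, (a' - b'); rewrite expr0 divr1 rmorphB rpredB.
  have gF m : g%:F ^+ m != 0 by rewrite expf_neq0 // tofrac_eq0.
  exists (k + l)%N, (a * g ^+ l - b * g ^+ k); split.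
    rewrite mulnDl; apply: rpredB; first exact: dhomogM.
    by rewrite addnC; apply: dhomogM.
  rewrite rmorphB !rmorphM !rmorphXn /= mulrBl exprD -mulf_div divff ?gF //.
  by rewrite mulr1 [_ ^+ k * _]mulrC -mulf_div divff ?gF // mulr1.
- exists (k + l)%N, (a * b); rewrite mulnDl dhomogM // rmorphM exprD.
  by rewrite invfM mulrACA.
Qed.

HB.instance Definition _ := GRing.isSubringClosed.Build {fraction {mpoly A[n]}}
  (hloc_pred hg) hloc_subring.

Definition hloc := {u : {fraction {mpoly A[n]}} | u \in hloc_pred hg}.

HB.instance Definition _ := SubChoice.on hloc.
HB.instance Definition _ := [SubChoice_isSubComNzRing of hloc by <:].

Lemma hloc_cst_subproof (c : A) : (c%:MP)%:F \in hloc_pred hg.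
Proof.
apply/asboolP; exists 0%N, c%:MP; rewrite expr0 divr1 mul0n.
by split=> //; rewrite -[c%:MP]mulr1 mul_mpolyC rpredZ // dhomog1.
Qed.

Definition hloc_cst (c : A) : hloc := exist _ (c%:MP)%:F (hloc_cst_subproof c).

Lemma hloc_cst_zmod : zmod_morphism hloc_cst.
Proof. by move=> c d; apply: val_inj; rewrite /= !rmorphB. Qed.

Lemma hloc_cst_monoid : monoid_morphism hloc_cst.
Proof. by split=> [|c d]; apply: val_inj; rewrite /= ?rmorph1 // !rmorphM. Qed.

HB.instance Definition _ := GRing.isZmodMorphism.Build A hloc hloc_cst
  hloc_cst_zmod.
HB.instance Definition _ := GRing.isMonoidMorphism.Build A hloc hloc_cst
  hloc_cst_monoid.

End HomogeneousLocalization.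

Section CotangentMap.
Variables (A : idomainType) (N : nat) (f : proj_endo N A).

Lemma chart_homog (m j : 'I_N.+1) :
  'X_m * tnth f j \is (1 + pe_deg f).-homog.
Proof. by rewrite dhomogM ?pe_homog // dhomogX /= mdeg1. Qed.

(* Coordinate ring of the affine open D_+(x_m) :&: f^-1 (D_+(x_j)) *)
Definition chart_ring (m j : 'I_N.+1) := hloc (chart_homog m j).

Lemma target_homog (j : 'I_N.+1) : ('X_j : {mpoly A[N.+1]}) \is 1.-homog.
Proof. by rewrite dhomogX /= mdeg1. Qed.

(* [u] is the image of the regular function [c] = P / x_j ^ k on D_+(x_j) under
   f^#, i.e. [u] = P(F_0, ..., F_N) / F_j ^ k. *)
Definition is_pullback (m j : 'I_N.+1)
    (c : hloc (target_homog j)) (u : chart_ring m j) :=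
  exists (k : nat) (P : {mpoly A[N.+1]}),
    [/\ P \is k.-homog, val c = P%:F / ('X_j)%:F ^+ k
      & val u = (P \mPo f)%:F / (tnth f j)%:F ^+ k].

(* The map f^* Omega -> Omega vanishes. On the affine open
   D_+(x_m) :&: f^-1 (D_+(x_j)), with coordinate ring B, and with C that of
   D_+(x_j), it is the map from B (x)_C Omega_(C/A) to Omega_(B/A) sending
   b (x) dc to b d(f^# c); these opens cover P^N_A. *)
Definition cotangent_map_zero :=
  forall (m j : 'I_N.+1) (b : chart_ring m j) (c : hloc (target_homog j))
    (u : chart_ring m j),
  is_pullback c u ->
  b *: kahler_d (hloc_cst (chart_homog m j)) u = 0.

End CotangentMap.

Section DynamicalMordellLang.

Definition finite_union_of_AP (S : nat -> Prop) :=
  exists s : seq (nat * nat), forall n,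
    S n <-> exists2 ml, ml \in s & exists k, n = (ml.1 * k + ml.2)%N.

Variables (L : fieldType) (N : nat).

(* Points of P^N(L) are represented by nonzero vectors of homogeneous
   coordinates. *)
Definition pe_eval (f : proj_endo N L) (x : 'rV[L]_N.+1) : 'rV[L]_N.+1 :=
  \row_i (tnth f i).@[fun j => x 0 j].

(* The closed subset of P^N cut out by a set [T] of forms *)
Definition zero_locus (T : {mpoly L[N.+1]} -> Prop) (x : 'rV[L]_N.+1) :=
  forall P, T P -> P.@[fun j => x 0 j] = 0.

Definition DML (f : proj_endo N L) :=
  forall x : 'rV[L]_N.+1, x != 0 ->
  forall T : {mpoly L[N.+1]} -> Prop,
    (forall P, T P -> exists d, P \is d.-homog) ->
  finite_union_of_AP (fun n => zero_locus T (iter n (pe_eval f) x)).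

End DynamicalMordellLang.

(* Main.v *)
(* Let y_m be homogeneous coordinates of f^m(x).  Condition 1 says that the forms
   defining f have zero derivatives, hence are forms in the p-th powers of the
   variables.  Given an infinite set S of return times, take a nonprincipal
   ultrafilter containing S and let I_a be the ideal of forms over K vanishing at
   y_(n-a) for almost all n.  If P lies in I_a and has integral coefficients, then
   P o f = sum_l t^l H_l^p for l < p, t a uniformizer, and every H_l lies in
   I_(a+1), since the coordinates of y_m, m large, lie in a finite K-algebra having
   a basis whose p-th powers are independent over K.  Iterating, P o f^m is very
   close t-adically to forms in the radical of the reduction of I_(a+m).  Let f^r
   reduce to a power of the absolute Frobenius; then the radicals of the reductions
   of the I_(ra) increase with a, hence are eventually equal to some Z, and the
   I_(ra) all lie in the ideal of the lift of Z invariant under f^r.  Both ideals have the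
   same reduction up to nilpotents, and a comparison of Hilbert functions shows that
   they agree.  So I_(ra) does not depend on a for a large.

   Over the algebraic closure, the analogues of the I_(ra) are primes lying over one
   and the same prime of K[x_0, ..., x_N].  A K-algebra of dimension d admits at
   most d such primes, so among any d + 1 of these ideals one is contained in a
   later one, as far as forms with coefficients in the algebra are concerned.  Hence
   there is r' = r i, 0 < i <= d, such that every form with such coefficients that
   vanishes at y_n for almost all n also vanishes at y_(n + r' l) for almost all n,
   for every l.  This shows that the return times in a class modulo r d! are finite
   in number or contain a whole tail of the class. *)

Require Import Defs.
From HB Require Import structures.
From mathcomp Require Import all_boot all_order all_algebra.
From mathcomp Require Import freeg mpoly.
From mathcomp Require Import boolp.
From mathcomp Require classical_sets filter.
From mathcomp Require Import zify ring.

Set Implicit Arguments.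
Unset Strict Implicit.
Unset Printing Implicit Defensive.

Import Order.TTheory GRing.Theory Num.Theory.
Local Open Scope ring_scope.

Local Notation "x %:F" := (@FracField.tofrac _ x).

(** * Ideals of polynomial rings *)

(** Membership is an arbitrary proposition, since the ideals below are defined by ultrafilters and
    existential conditions; the unit ideal is allowed. *)
Record ideal_like (R : comNzRingType) (I : R -> Prop) := IdealLike {
  ideal0 : I 0;
  idealD : forall x y, I x -> I y -> I (x + y);
  idealMl : forall a x, I x -> I (a * x)
}.

Section IdealLike.
Variables (R : comNzRingType) (I : R -> Prop) (hI : ideal_like I).

Lemma idealN x : I x -> I (- x).
Proof. by rewrite -mulN1r; apply: idealMl. Qed.

Lemma idealB x y : I x -> I y -> I (x - y).
Proof. by move=> Ix Iy; apply: idealD => //; apply: idealN. Qed.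

Lemma idealMr a x : I x -> I (x * a).
Proof. by rewrite mulrC; apply: idealMl. Qed.

Lemma ideal_sum (T : Type) (r : seq T) (P : pred T) (F : T -> R) :
  (forall i, P i -> I (F i)) -> I (\sum_(i <- r | P i) F i).
Proof. by move=> IF; apply: (big_ind I) => //; [apply: ideal0|apply: idealD]. Qed.

Lemma idealXn n x : (0 < n)%N -> I x -> I (x ^+ n).
Proof. by case: n => // n _ Ix; rewrite exprSr; apply: idealMl. Qed.

End IdealLike.

Definition combination (R : comNzRingType) (P : nat -> R) (m : nat) (Q : R) :=
  exists c : nat -> R, Q = \sum_(i < m) c i * P i.

Section Combination.
Variables (R : comNzRingType) (P : nat -> R).

Lemma combination_ideal m : ideal_like (combination P m).
Proof.
split=> [|x y [c ->] [d ->]|a x [c ->]].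
- by exists (fun=> 0); rewrite big1 // => i _; rewrite mul0r.
- exists (fun i => c i + d i); rewrite -big_split /=.
  by apply: eq_bigr => i _; rewrite mulrDl.
- exists (fun i => a * c i); rewrite mulr_sumr.
  by apply: eq_bigr => i _; rewrite mulrA.
Qed.

Lemma combination_mem m i : (i < m)%N -> combination P m (P i).
Proof.
move=> im; exists (fun j => (j == i)%:R); rewrite (bigD1 (Ordinal im)) //= eqxx.
rewrite mul1r big1 ?addr0 // => j; rewrite -val_eqE /= => /negPf->.
by rewrite mul0r.
Qed.

Lemma combination_sub (I : R -> Prop) m Q : ideal_like I ->
  (forall i, (i < m)%N -> I (P i)) -> combination P m Q -> I Q.
Proof.
by move=> hI IP [c ->]; apply: ideal_sum => // i _; apply: idealMl => //; apply: IP.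
Qed.

End Combination.

(** Beyond any index [a] some [u b] is minimal among all [u c] with [c >= a]; such indices are
    chosen successively. *)
Lemma nondecreasing_subsequence (u : nat -> nat) :
  exists phi : nat -> nat, {homo phi : i j / (i < j)%N} /\
    {homo u \o phi : i j / (i <= j)%N}.
Proof.
have H a : exists b, (a <= b)%N /\ forall c, (a <= c)%N -> (u b <= u c)%N.
  have : exists m, `[< exists2 b, (a <= b)%N & u b = m >].
    by exists (u a); apply/asboolP; exists a.
  case/ex_minnP => m /asboolP[b ab <-] minb; exists b; split=> // c ac.
  by apply: minb; apply/asboolP; exists c.
have [h hP] := choice H.
pose phi := fix phi k := if k is k'.+1 then h (phi k').+1 else h 0%N.
have ltphi k : (phi k < phi k.+1)%N by have [] := hP (phi k).+1.
exists phi; split.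
  by apply: homo_ltn => // x y z; apply: ltn_trans.
apply: homo_leq => [//|x y z|k /=]; first exact: leq_trans.
case: k => [|k]; first by have [_] := hP 0%N; apply.
have [_ ->//] := hP (phi k).+1; apply: leq_trans (ltnW (ltphi k.+1)).
by have [] := hP (phi k).+1.
Qed.

Lemma dickson n (u : nat -> 'X_{1..n}) :
  exists i j, (i < j)%N /\ (u i <= u j)%MM.
Proof.
have [phi [incr mono]] : exists phi : nat -> nat, {homo phi : i j / (i < j)%N} /\
    forall l, l \in enum 'I_n -> {homo (fun k => u (phi k) l) : i j / (i <= j)%N}.
  elim: (enum 'I_n) => [|l s [phi [incr mono]]]; first by exists id; split.
  have [psi [incr' mono']] := nondecreasing_subsequence (fun k => u (phi k) l).
  exists (phi \o psi); split=> [i j ij|l']; first exact/incr/incr'.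
  rewrite inE => /predU1P[->//|ls] i j ij /=; apply: mono => //.
  move: ij; rewrite leq_eqVlt => /predU1P[->//|ij]; exact/ltnW/incr'.
exists (phi 0%N), (phi 1%N); split; first exact: incr.
by apply/mnm_lepP => l; apply: mono; rewrite ?mem_enum.
Qed.

Section Noetherian.
Variables (F : fieldType) (n : nat).
Implicit Types P : {mpoly F[n]}.

Lemma mlead_cancel (P Q : {mpoly F[n]}) : P != 0 -> Q != 0 ->
  (mlead P <= mlead Q)%MM -> exists a, Q - a * P = 0 \/
    (mlead (Q - a * P) < mlead Q)%O.
Proof.
move=> P0 Q0 le_PQ; set a := (mleadc Q / mleadc P) *: 'X_[mlead Q - mlead P].
have lcP : mleadc P != 0 by rewrite mleadc_eq0.
have lcQ : mleadc Q != 0 by rewrite mleadc_eq0.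
exists a; have [->|R0] := eqVneq (Q - a * P) 0; [by left|right].
have c0 : mleadc Q / mleadc P != 0 by rewrite mulf_neq0 ?invr_eq0.
have la : mlead (a * P) = mlead Q.
  by rewrite /a -scalerAl mleadZ // mleadM ?mpolyX_eq0 // ?mleadXm ?submK //;
    rewrite -msupp_eq0 msuppX.
rewrite lt_neqAle (le_trans (mleadB_le _ _)) ?la ?joinxx // andbT.
apply: contraNneq R0 => lR; rewrite -mleadc_eq0 lR mcoeffB.
rewrite /a -scalerAl mcoeffZ -commr_mpolyX.
have -> : (P * 'X_[mlead Q - mlead P])@_(mlead Q) = mleadc P.
  by rewrite -{1}(submK le_PQ) mcoeffMX.
by rewrite divfK // subrr.
Qed.

(** Otherwise each [P m] is reduced modulo its predecessors to a nonzero [Q m] with minimal leading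
    monomial. By Dickson's lemma the leading monomial of some [Q i] divides that of a later [Q j],
    and cancelling contradicts the minimality of [Q j]. *)
Lemma mpoly_noetherian (P : nat -> {mpoly F[n]}) :
  exists m, combination P m (P m).
Proof.
apply: contrapT => /forallNP nP.
have H m : exists Q : {mpoly F[n]}, combination P m (P m - Q) /\ forall Q',
    combination P m (P m - Q') -> ~~ (mlead Q' < mlead Q)%O.
  have : exists Q : {mpoly F[n]}, combination P m (P m - Q).
    by exists (P m); rewrite subrr; apply: ideal0 (combination_ideal P m).
  case=> Q; elim/mleadrect: Q => Q IH hQ.
  have [[Q' hQ' lt]|H] := pselect (exists2 Q',
    combination P m (P m - Q') & (mlead Q' < mlead Q)%O); first exact: IH lt hQ'.
  by exists Q; split=> // Q' hQ'; apply/negP => lt; apply: H; exists Q'.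
have [Q hQ] := choice H.
have Q0 m Q' : combination P m (P m - Q') -> Q' != 0.
  by move=> h; apply/eqP => e; apply: (nP m); rewrite e subr0 in h.
have [i [j [ij le]]] := dickson (fun k => mlead (Q k)).
have [a] := mlead_cancel (Q0 _ _ (hQ i).1) (Q0 _ _ (hQ j).1) le.
have hC := combination_ideal P j.
have h : combination P j (P j - (Q j - a * Q i)).
  have -> : P j - (Q j - a * Q i) = (P j - Q j) + a * (P i - (P i - Q i)).
    by rewrite subKr opprB addrA addrAC.
  apply: idealD => //; first exact: (hQ j).1.
  apply: idealMl => //; apply: idealB => //; first exact: combination_mem.
  apply: combination_sub (hQ i).1 => // l li; apply: combination_mem.
  exact: ltn_trans ij.
by case=> [e|lt]; [have := Q0 _ _ h; rewrite e eqxx|have := (hQ j).2 _ h; rewrite lt].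
Qed.

Lemma mpoly_finite_generators (T : {mpoly F[n]} -> Prop) :
  exists s : seq {mpoly F[n]}, (forall P, P \in s -> T P) /\
    forall P, T P -> combination (nth 0 s) (size s) P.
Proof.
apply: contrapT => /forallNP nT.
have H s : exists P, (forall Q, Q \in s -> T Q) ->
    T P /\ ~ combination (nth 0 s) (size s) P.
  have [hs|hs] := pselect (forall Q, Q \in s -> T Q); last by exists 0.
  apply: contrapT => /forallNP h; apply: (nT s); split=> // P TP.
  by apply: contrapT => nc; apply: (h P).
have [g gP] := choice H.
pose s := fix s k := if k is k'.+1 then rcons (s k') (g (s k')) else [::].
have sT k Q : Q \in s k -> T Q.
  elim: k Q => [|k IH] Q //=; rewrite mem_rcons inE => /predU1P[->|/IH//].
  by have [] := gP (s k) IH.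
have szs k : size (s k) = k by elim: k => //= k IH; rewrite size_rcons IH.
have nths k i : (i < k)%N -> (s k)`_i = g (s i).
  elim: k => // k IH; rewrite ltnS leq_eqVlt /= nth_rcons szs.
  by case/predU1P => [->|ik]; [rewrite ltnn eqxx|rewrite ik IH].
have [m [c gm]] := mpoly_noetherian (fun k => g (s k)).
have [_] := gP (s m) (sT m); apply; exists c; rewrite szs gm.
by apply: eq_bigr => i _; rewrite nths.
Qed.

Lemma mpoly_ideal_chain (A : nat -> {mpoly F[n]} -> Prop) :
  (forall a, ideal_like (A a)) -> (forall a P, A a P -> A a.+1 P) ->
  exists a0, forall a P, A a P -> A a0 P.
Proof.
move=> hA incr.
have mono a b P : (a <= b)%N -> A a P -> A b P.
  by move/subnK=> <-; elim: (b - a)%N => // k IH /IH; apply: incr.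
have [s [sT gen]] := mpoly_finite_generators (fun P => exists a, A a P).
have [a0 Ha0] : exists a0, forall P, P \in s -> A a0 P.
  elim: s {gen} sT => [|Q s IH] sT; first by exists 0%N.
  have [a0 Ha0] := IH (fun P Ps => sT P (mem_behead (s := Q :: s) Ps)).
  have [a1 Ha1] := sT Q (mem_head _ _).
  exists (maxn a0 a1) => P; rewrite inE => /predU1P[->|/Ha0].
    by move: Ha1; apply: mono; apply: leq_maxr.
  by apply: mono; apply: leq_maxl.
exists a0 => a P AP; have /gen := ex_intro (fun a => A a P) a AP.
by apply: combination_sub => // i im; apply/Ha0/mem_nth.
Qed.

End Noetherian.

(** * Hilbert functions and the special fiber *)

(** The recursion takes away a fixed proportion of [alpha] when the argument drops by [h]. Hence
    [alpha] doubles over every interval of length [kappa * h], which a polynomial bound forbids. *)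
Lemma exponential_growth (alpha : nat -> nat) (kappa h n : nat) :
  {homo alpha : u v / (u <= v)%N} -> (0 < alpha 0)%N ->
  (forall u, (alpha u <= u.+1 ^ n)%N) ->
  ~ (forall u, (h <= u)%N -> (alpha u <= kappa * (alpha u - alpha (u - h)))%N).
Proof.
move=> mono a0 ub rec.
have step v j : (kappa * alpha v + j * alpha v <= kappa * alpha (v + j * h))%N.
  elim: j => [|j IH]; first by rewrite !mul0n !addn0.
  have := rec (v + j.+1 * h)%N; rewrite mulSn addnCA leq_addr addKn => /(_ isT).
  have := mono v (h + (v + j * h))%N; rewrite addnCA leq_addr => /(_ isT).
  rewrite mulnBr; nia.
have k0 : (0 < kappa)%N.
  rewrite lt0n; apply/eqP => k0; have := rec h (leqnn h); rewrite k0 mul0n.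
  by have := mono 0%N h (leq0n h); lia.
have double v : (2 * alpha v <= alpha (v + kappa * h))%N.
  by have := step v kappa; rewrite -mulnDr leq_pmul2l // mul2n addnn.
have pow j : (2 ^ j <= alpha (j * (kappa * h)))%N.
  elim: j => [|j IH]; first by rewrite mul0n.
  by rewrite expnS [(j.+1 * _)%N]mulSn addnC; apply: leq_trans (double _); rewrite leq_mul2l.
(* With [l = 2c + 1] one has [2lc + 1 <= l^2 < 2^(2l)], so at the argument [2lc] the lower bound
   [2^(2l(n+1))] exceeds the upper bound [(2lc + 1)^n]. *)
pose c := (n.+1 * (kappa * h))%N; pose l := (2 * c).+1.
have := pow (n.+1 * (2 * l))%N; have := ub (n.+1 * (2 * l) * (kappa * h))%N.
rewrite (_ : n.+1 * (2 * l) * (kappa * h) = 2 * l * c)%N; last by rewrite /c; lia.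
move=> h1 h2; have := leq_trans h2 h1; rewrite mulnC expnM.
have -> : (2 * l = l + l)%N by lia.
rewrite expnD => h3.
have: (((l + l) * c).+1 < 2 ^ l * 2 ^ l)%N by have := ltn_expl l (ltnSn 1); nia.
rewrite -(ltn_exp2r _ _ (ltn0Sn n)).
have : (((l + l) * c).+1 ^ n <= ((l + l) * c).+1 ^ n.+1)%N by rewrite leq_pexp2l.
lia.
Qed.

Section MonomialForm.
Variables (R : nzRingType) (n : nat).

(** The finite index type contains the monomials of degree at most [d]; those of smaller degree are
    sent to 0. *)
Definition monomial_form d (m : 'X_{1..n < d.+1}) : {mpoly R[n]} :=
  if mdeg m == d then 'X_[m] else 0.

Lemma monomial_form_homog d m : @monomial_form d m \is d.-homog.
Proof. by rewrite /monomial_form; case: ifP => e; rewrite ?dhomogX ?dhomog0. Qed.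

Lemma homog_monomialE d (P : {mpoly R[n]}) : P \is d.-homog ->
  P = \sum_(m : 'X_{1..n < d.+1}) P@_m *: monomial_form m.
Proof.
move=> hP; rewrite {1}(mpolywE (k := d.+1) (p := P)).
  apply: eq_bigr => m _; rewrite /monomial_form; case: eqP => // /eqP md.
  by rewrite (dhomog_nemf_coeff hP md) !scale0r.
by rewrite msizeE; apply/bigmax_leqP_seq => m mP _; rewrite (dhomog_mf hP).
Qed.

End MonomialForm.

Arguments monomial_form R {n d} m.

Section Independence.
Variables (F : fieldType) (n : nat) (I : {mpoly F[n]} -> Prop).
Hypothesis hI : ideal_like I.

Lemma ideal_scale c P : I P -> I (c *: P).
Proof. by rewrite -mul_mpolyC; apply: idealMl. Qed.

Definition independent r (s : 'I_r -> {mpoly F[n]}) :=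
  forall c : 'I_r -> F, I (\sum_i c i *: s i) -> forall i, c i = 0.

Definition spanned (T : finType) (g : T -> {mpoly F[n]}) P :=
  exists a : T -> F, I (P - \sum_x a x *: g x).

Lemma spanned_sum (T T' : finType) (g : T -> {mpoly F[n]})
    (s : T' -> {mpoly F[n]}) (c : T' -> F) :
  (forall y, spanned g (s y)) -> spanned g (\sum_y c y *: s y).
Proof.
move=> /choice[a ha]; exists (fun x => \sum_y c y * a y x).
have -> : \sum_y c y *: s y - \sum_x (\sum_y c y * a y x) *: g x =
    \sum_y c y *: (s y - \sum_x a y x *: g x).
  under [in RHS]eq_bigr do rewrite scalerBr.
  rewrite big_split /= sumrN; congr (_ - _).
  under eq_bigr do rewrite scaler_suml.
  rewrite exchange_big /=; apply: eq_bigr => y _.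
  by rewrite scaler_sumr; apply: eq_bigr => x _; rewrite scalerA.
by apply: ideal_sum => // y _; apply: ideal_scale.
Qed.

Lemma spanned_trans (T T' : finType) (g : T -> {mpoly F[n]})
    (s : T' -> {mpoly F[n]}) P :
  (forall y, spanned g (s y)) -> spanned s P -> spanned g P.
Proof.
move=> gs [c Ic]; have [b Ib] := spanned_sum c gs; exists b.
by have := idealD hI Ic Ib; rewrite addrA subrK.
Qed.

Lemma spanned_mem (T : finType) (g : T -> {mpoly F[n]}) x : spanned g (g x).
Proof.
exists (fun y => (y == x)%:R); rewrite (bigD1 x) //= eqxx scale1r big1.
  by rewrite addr0 subrr; apply: ideal0.
by move=> y /negPf->; rewrite scale0r.
Qed.

Lemma independent_le_card (T : finType) (g : T -> {mpoly F[n]}) r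
    (s : 'I_r -> {mpoly F[n]}) :
  independent s -> (forall i, spanned g (s i)) -> (r <= #|T|)%N.
Proof.
move=> ind /choice[a ha]; rewrite leqNgt; apply/negP => lt.
pose A := \matrix_(i < r, x < #|T|) a i (enum_val x).
have : kermx A != 0.
  rewrite kermx_eq0 /row_free neq_ltn (leq_ltn_trans (rank_leq_col A)) //.
case/rowV0Pn=> w /sub_kermxP wA w0.
have : I (\sum_i w 0 i *: s i).
  have -> : \sum_i w 0 i *: s i = \sum_i w 0 i *: (s i - \sum_x a i x *: g x).
    under [in RHS]eq_bigr do rewrite scalerBr.
    rewrite big_split /= -[LHS]addr0; congr (_ + _); rewrite sumrN.
    under eq_bigr do rewrite scaler_sumr.
    rewrite exchange_big big1 ?oppr0 //= => x _.
    under eq_bigr do rewrite scalerA.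
    rewrite -scaler_suml; have /matrixP/(_ 0 (enum_rank x)) := wA.
    rewrite !mxE; under eq_bigr do rewrite mxE enum_rankK.
    by move=> ->; rewrite scale0r.
  by apply: ideal_sum => // i _; apply: ideal_scale.
move=> /ind w_0; case/eqP: w0; apply/rowP => i; rewrite mxE; exact: w_0.
Qed.

Definition form_family d r (s : 'I_r -> {mpoly F[n]}) :=
  independent s /\ forall i, s i \is d.-homog.

Lemma form_family_le d r (s : 'I_r -> {mpoly F[n]}) :
  form_family d s -> (r <= d.+1 ^ n)%N.
Proof.
move=> [ind hom]; have : (r <= #|{: 'X_{1..n < d.+1}}|)%N.
  apply: (independent_le_card (g := monomial_form F) ind) => i.
  exists (fun m : 'X_{1..n < d.+1} => (s i)@_m); rewrite {1}(homog_monomialE (hom i)) subrr.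
  exact: ideal0.
move=> /leq_trans -> //.
have -> : (d.+1 ^ n)%N = #|{ffun 'I_n -> 'I_d.+1}| by rewrite card_ffun !card_ord.
pose h (m : 'X_{1..n < d.+1}) := [ffun i => inord (m i) : 'I_d.+1].
apply: (leq_card h) => m m' /ffunP e; apply/val_inj/mnmP => i.
have lt (m0 : 'X_{1..n < d.+1}) : (m0 i < d.+1)%N.
  apply: leq_ltn_trans (bmdeg m0); rewrite mdegE (bigD1 i) //=; exact: leq_addr.
by have /(congr1 val) := e i; rewrite !ffunE /= !inordK.
Qed.

Lemma max_form_family_spans d r (s : 'I_r -> {mpoly F[n]}) P :
  form_family d s ->
  (forall s' : 'I_r.+1 -> {mpoly F[n]}, ~ form_family d s') ->
  P \is d.-homog -> spanned s P.
Proof.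
move=> [ind hom] max hP.
pose s' (i : 'I_r.+1) := if unlift ord0 i is Some l then s l else P.
have hs' i : s' i \is d.-homog by rewrite /s'; case: unlift.
have /existsNP[c /not_implyP[Ic /existsNP[i ci]]] : ~ independent s'.
  by move=> h; apply: (max s').
have {}Ic : I (c ord0 *: P + \sum_l c (fintype.lift ord0 l) *: s l).
  move: Ic; rewrite big_ord_recl {1}/s' unlift_none.
  by under eq_bigr do rewrite /s' liftK.
have [c0|c0] := eqVneq (c ord0) 0.
  case: ci; case: (unliftP ord0 i) => [l ->|-> //].
  by rewrite c0 scale0r add0r in Ic; apply: (ind (fun l => c (fintype.lift ord0 l))).
exists (fun l => - (c ord0)^-1 * c (fintype.lift ord0 l)).
have -> : P - \sum_l (- (c ord0)^-1 * c (fintype.lift ord0 l)) *: s l =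
    (c ord0)^-1 *: (c ord0 *: P + \sum_l c (fintype.lift ord0 l) *: s l).
  rewrite scalerDr scalerA mulVf // scale1r scaler_sumr -sumrN; congr (_ + _).
  by apply: eq_bigr => l _; rewrite scalerA mulNr scaleNr opprK.
exact: ideal_scale.
Qed.

(** Padding with zeros gives spanning families of different degrees the common index type ['I_B]. *)
Lemma max_form_family_pad d r B (s : 'I_r -> {mpoly F[n]}) : (r <= B)%N ->
  form_family d s ->
  (forall s' : 'I_r.+1 -> {mpoly F[n]}, ~ form_family d s') ->
  exists s' : 'I_B -> {mpoly F[n]}, forall P, P \is d.-homog -> spanned s' P.
Proof.
move=> rB hs max.
exists (fun i => if insub (val i) is Some l then s l else 0) => P hP.
apply: spanned_trans (max_form_family_spans hs max hP) => l.
have := spanned_mem (fun i : 'I_B => if insub (val i) is Some l then s l else 0)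
  (widen_ord rB l).
by rewrite (valK l).
Qed.

(* [alpha] is the Hilbert function of the homogeneous part of [I]. *)
Definition hilbert_function (alpha : nat -> nat) := forall d,
  (exists s : 'I_(alpha d) -> {mpoly F[n]}, form_family d s) /\
  forall r (s : 'I_r -> {mpoly F[n]}), form_family d s -> (r <= alpha d)%N.

Lemma hilbert_function_exists : exists alpha, hilbert_function alpha.
Proof.
suff H d : exists a, (exists s : 'I_a -> {mpoly F[n]}, form_family d s) /\
    forall r (s : 'I_r -> {mpoly F[n]}), form_family d s -> (r <= a)%N.
  by have [alpha ?] := choice H; exists alpha.
pose Q r := `[< exists s : 'I_r -> {mpoly F[n]}, form_family d s >].
have Qex : exists r, Q r.
  exists 0%N; apply/asboolP; exists (fun=> 0).
  by split=> [c _ []|i] //; rewrite dhomog0.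
have Qub r : Q r -> (r <= d.+1 ^ n)%N by move=> /asboolP[s]; apply: form_family_le.
case: (ex_maxnP Qex Qub) => a /asboolP Qa max; exists a; split=> // r s hs.
by apply: max; apply/asboolP; exists s.
Qed.

End Independence.

(** * Homogeneous components, coefficientwise maps and the Frobenius *)

Section MpolyGeneral.

Lemma mcoeff_pihomog n (R : nzRingType) d (P : {mpoly R[n]}) m :
  (pihomog mdeg d P)@_m = if mdeg m == d then P@_m else 0.
Proof.
rewrite pihomogE raddf_sum /= [in RHS](mpolyE P) raddf_sum /=.
case: ifP => md; last first.
  rewrite big1 // => i /eqP di; rewrite mcoeffZ mcoeffX.
  by case: eqP => [e|_]; rewrite ?mulr0 //; rewrite -e di eqxx in md.
rewrite big_mkcond /=; apply: eq_bigr => i _; case: ifP => // di.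
rewrite mcoeffZ mcoeffX; case: eqP => [e|_]; rewrite ?mulr0 //.
by rewrite e md in di.
Qed.

Lemma map_pihomog n (R S : nzRingType) (f : {rmorphism R -> S}) d
    (P : {mpoly R[n]}) :
  map_mpoly f (pihomog mdeg d P) = pihomog mdeg d (map_mpoly f P).
Proof.
apply/mpolyP => m; rewrite mcoeff_pihomog !mcoeff_map_mpoly /= mcoeff_pihomog.
by case: ifP => // _; rewrite rmorph0.
Qed.

Lemma pchar_mpoly (R : nzRingType) n p : p \in [pchar R] -> p \in [pchar {mpoly R[n]}].
Proof.
case/andP=> pp /eqP p0; rewrite inE pp /= -mpolyC_nat p0 mpolyC0 //.
Qed.

Lemma exprD_pchar (R : comNzRingType) p a (x y : R) : p \in [pchar R] ->
  (x + y) ^+ (p ^ a) = x ^+ (p ^ a) + y ^+ (p ^ a).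
Proof. by move=> hp; rewrite exprDn_pchar // pnatX pnatE ?(pcharf_prime hp) ?hp. Qed.

Lemma expr_sum_pchar (R : comNzRingType) p a (T : Type) (r : seq T)
    (P : pred T) (F : T -> R) : p \in [pchar R] ->
  (\sum_(i <- r | P i) F i) ^+ (p ^ a) = \sum_(i <- r | P i) F i ^+ (p ^ a).
Proof.
move=> hp; apply: (big_morph (fun x => x ^+ (p ^ a))) => [x y|].
  exact: exprD_pchar.
by rewrite expr0n expn_eq0; case: eqP (pcharf_prime hp) => // ->.
Qed.

(** Here [f] is a mere map of sets, such as a choice of lifts or of quotients by [t], and need not
    be additive. *)
Definition mpoly_map_coeff n (R : nzRingType) (S : nzRingType) (f : R -> S)
    (P : {mpoly R[n]}) : {mpoly S[n]} :=
  \sum_(m <- msupp P) f P@_m *: 'X_[m].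

Lemma mcoeff_map_coeff n (R S : nzRingType) (f : R -> S) (P : {mpoly R[n]}) m :
  f 0 = 0 -> (mpoly_map_coeff f P)@_m = f P@_m.
Proof.
move=> f0; rewrite /mpoly_map_coeff raddf_sum /=.
have [mP|mP] := boolP (m \in msupp P).
  rewrite (bigD1_seq m) ?msupp_uniq //= mcoeffZ mcoeffX eqxx mulr1 big1 ?addr0 //.
  by move=> m' /negPf m'm; rewrite mcoeffZ mcoeffX m'm mulr0.
rewrite (memN_msupp_eq0 mP) f0 big_seq big1 // => m' m'P.
rewrite mcoeffZ mcoeffX; case: eqP => [e|_]; rewrite ?mulr0 //.
by rewrite -e m'P in mP.
Qed.

End MpolyGeneral.

Section FrobeniusDecomposition.
Variables (k : fieldType) (n p a : nat).
Hypothesis hp : p \in [pchar k].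
Hypothesis perfect : forall x : k, exists y, y ^+ (p ^ a) = x.
Local Notation M := (p ^ a)%N.

Definition exponent (mu : {ffun 'I_n -> 'I_M}) : 'X_{1..n} :=
  [multinom (mu i : nat) | i < n].

(** Exponents are divided by [M] with remainder: the remainders form [mu], the quotients give the
    monomials of [Q mu], and the coefficients have [M]-th roots by [perfect]. *)
Lemma frobenius_decomposition d (P : {mpoly k[n]}) : P \is d.-homog ->
  exists Q : {ffun 'I_n -> 'I_M} -> {mpoly k[n]},
    (forall mu, Q mu \is ((d - mdeg (exponent mu)) %/ M).-homog) /\
    P = \sum_mu 'X_[exponent mu] * Q mu ^+ M.
Proof.
have M0 : (0 < M)%N by rewrite expn_gt0 prime_gt0 ?(pcharf_prime hp).
pose D P := exists Q : {ffun 'I_n -> 'I_M} -> {mpoly k[n]},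
    (forall mu, Q mu \is ((d - mdeg (exponent mu)) %/ M).-homog) /\
    P = \sum_mu 'X_[exponent mu] * Q mu ^+ M.
move=> hP; rewrite [P]mpolyE big_seq; apply: (big_ind D).
- exists (fun=> 0); split=> [mu|]; first exact: dhomog0.
  by rewrite big1 // => mu _; rewrite expr0n gtn_eqF ?mulr0.
- move=> _ _ [Q [hQ ->]] [Q' [hQ' ->]]; exists (fun mu => Q mu + Q' mu).
  split=> [mu|]; first exact: dhomogD.
  rewrite -big_split; apply: eq_bigr => mu _ /=.
  by rewrite (exprD_pchar _ _ _ (pchar_mpoly n hp)) mulrDr.
move=> m mP; have [c hc] := perfect P@_m.
pose mu0 : {ffun 'I_n -> 'I_M} := [ffun i => Ordinal (ltn_pmod (m i) M0)].
pose m' : 'X_{1..n} := [multinom (m i %/ M)%N | i < n].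
have hm : m = (exponent mu0 + m' *+ M)%MM.
  by apply/mnmP => i; rewrite mnmDE mulmnE !mnmE ffunE /= addnC -divn_eq.
have hd : ((d - mdeg (exponent mu0)) %/ M = mdeg m')%N.
  have -> : d = (mdeg (exponent mu0) + mdeg m' * M)%N.
    by rewrite -mdegMn -mdegD -hm; have /= := dhomog_mf hP mP.
  by rewrite addKn mulnK.
exists (fun mu => if mu == mu0 then c *: 'X_[m'] else 0); split.
  move=> mu; case: eqP => [->|_]; rewrite ?dhomog0 //.
  by rewrite dhomogZ // dhomogX /= hd.
rewrite (bigD1 mu0) //= eqxx exprZn hc mpolyXn -scalerAr -mpolyXD -hm.
by rewrite big1 ?addr0 // => mu /negPf->; rewrite expr0n gtn_eqF ?mulr0.
Qed.

End FrobeniusDecomposition.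

Section SpecialFiber.
Variables (K k : fieldType) (O : comNzRingType) (j : {rmorphism O -> K}).
Variables (red : {rmorphism O -> k}) (t : O) (n : nat).
Hypothesis j_inj : injective j.
Hypothesis red_surj : forall x, exists y, red y = x.
Hypothesis red_ker : forall x, red x = 0 -> exists y, x = t * y.
Hypothesis red_t : red t = 0.
Hypothesis primitive : forall r (c : 'I_r -> K), (exists i, c i != 0) ->
  exists s (b : 'I_r -> O),
    [/\ s != 0, forall i, s * c i = j (b i) & exists i, red (b i) != 0].
Implicit Types I : {mpoly K[n]} -> Prop.

(** The reduction of the contraction of [I] to polynomials over [O]: the ideal of the special fiber
    of the closure over [O] of the scheme cut out by [I]. *)
Definition special_fiber I (Q : {mpoly k[n]}) :=
  exists H : {mpoly O[n]}, I (map_mpoly j H) /\ map_mpoly red H = Q.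

Lemma lift_mpoly (Q : {mpoly k[n]}) :
  exists H : {mpoly O[n]}, map_mpoly red H = Q.
Proof.
have [r hr] := choice red_surj.
pose r' x := if x == 0 then 0 else r x.
exists (mpoly_map_coeff r' Q); apply/mpolyP => m.
rewrite mcoeff_map_mpoly /= mcoeff_map_coeff /r' ?eqxx //.
by case: eqP => [->|_]; rewrite ?rmorph0 ?hr.
Qed.

Lemma map_red_eq0 (H : {mpoly O[n]}) : map_mpoly red H = 0 ->
  exists A : {mpoly O[n]}, H = t *: A.
Proof.
move=> h0; have /choice[g hg] : forall x, exists y, red x = 0 -> x = t * y.
  move=> x; have [/red_ker[y ->]|/eqP e] := eqVneq (red x) 0; first by exists y.
  by exists 0.
pose g' x := if x == 0 then 0 else g x.
exists (mpoly_map_coeff g' H); apply/mpolyP => m.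
rewrite mcoeffZ mcoeff_map_coeff /g' ?eqxx //.
case: eqP => [->|_]; first by rewrite mulr0.
by apply: hg; have /mpolyP/(_ m) := h0; rewrite mcoeff_map_mpoly mcoeff0.
Qed.

Lemma special_fiber_ideal I : ideal_like I -> ideal_like (special_fiber I).
Proof.
move=> hI; split=> [|_ _ [x [Ix <-]] [y [Iy <-]]|a _ [x [Ix <-]]].
- by exists 0; rewrite !rmorph0; split=> //; apply: ideal0.
- by exists (x + y); rewrite !rmorphD; split=> //; apply: idealD.
- have [b <-] := lift_mpoly a; exists (b * x); rewrite !rmorphM; split=> //.
  exact: idealMl.
Qed.

(** A relation over [K] between the lifts can be scaled to integral coefficients that do not all
    reduce to 0; it then gives a nontrivial relation in the special fiber. *)
Lemma lift_form_family I d r (s : 'I_r -> {mpoly k[n]}) : ideal_like I ->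
  form_family (special_fiber I) d s -> exists S : 'I_r -> {mpoly O[n]},
    (forall i, map_mpoly red (S i) = s i) /\
    form_family I d (fun i => map_mpoly j (S i)).
Proof.
move=> hI [ind hom]; have /choice[S0 hS0] := fun i => lift_mpoly (s i).
exists (fun i => pihomog mdeg d (S0 i)).
have hS i : map_mpoly red (pihomog mdeg d (S0 i)) = s i.
  by rewrite map_pihomog hS0 pihomog_dE.
split=> //; split=> [c Ic i|i]; last by rewrite map_pihomog pihomogP.
apply/eqP; apply: contraT => ci.
have [x [b [x0 hb [l /eqP[]]]]] := primitive (ex_intro (fun i => c i != 0) i ci).
apply: (ind (fun i => red (b i))).
exists (\sum_i b i *: pihomog mdeg d (S0 i)); split.
  have := ideal_scale hI x Ic; rewrite scaler_sumr rmorph_sum /=; congr I.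
  by apply: eq_bigr => m _; rewrite map_mpolyZ -hb scalerA.
rewrite rmorph_sum; apply: eq_bigr => m _ /=.
by rewrite map_mpolyZ hS.
Qed.

Variables (I I' : {mpoly K[n]} -> Prop).
Hypothesis hI : ideal_like I.
Hypothesis hI' : ideal_like I'.
Hypothesis homI : forall d P, I P -> I (pihomog mdeg d P).
Hypothesis homI' : forall d P, I' P -> I' (pihomog mdeg d P).
Hypothesis primeI : forall P Q, I (P * Q) -> I P \/ I Q.
Hypothesis I1 : ~ I 1.
Variable i0 : 'I_n.
Hypothesis IX : ~ I 'X_i0.
Hypothesis subI : forall P, I P -> I' P.
Variables (p a : nat).
Hypothesis hp : p \in [pchar k].
Hypothesis perfect : forall x : k, exists y, y ^+ (p ^ a) = x.
Hypothesis power : forall Q, special_fiber I' Q -> special_fiber I (Q ^+ (p ^ a)).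
Local Notation M := (p ^ a)%N.

Section HilbertComparison.
Variables (alpha beta betabar : nat -> nat).
Hypothesis halpha : hilbert_function I alpha.
Hypothesis hbeta : hilbert_function I' beta.
Hypothesis hbetabar : hilbert_function (special_fiber I') betabar.

Lemma betabar_le_beta d : (betabar d <= beta d)%N.
Proof.
have [s hs] := (hbetabar d).1; have [S [_ hS]] := lift_form_family hI' hs.
exact: (hbeta d).2 hS.
Qed.

(** Forms of degree [d + e] independent modulo [I'], together with the products of [u] with forms of
    degree [d] independent modulo [I], are independent modulo [I]: modulo [I'] the products
    disappear, and then [u] is cancelled because [I] is prime. *)
Lemma hilbert_mul u e d : ~ I u -> I' u -> u \is e.-homog ->
  (beta (d + e) + alpha d <= alpha (d + e))%N.
Proof.
move=> Iu I'u hu; have [s [ind hom]] := (hbeta (d + e)%N).1.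
have [s' [ind' hom']] := (halpha d).1.
pose S i := match fintype.split i with inl x => s x | inr y => u * s' y end.
apply: ((halpha (d + e)%N).2 _ S); split; last first.
  move=> i; rewrite /S; case: fintype.split => x; first exact: hom.
  by rewrite addnC dhomogM.
move=> c; rewrite big_split_ord /=.
under eq_bigr do rewrite /S (unsplitK (inl _)).
under [X in _ + X]eq_bigr do rewrite /S (unsplitK (inr _)) scalerAr.
rewrite -mulr_sumr => Ic.
have c1 : forall x, c (lshift _ x) = 0.
  apply: ind; have := idealB hI' (subI Ic)
    (idealMr hI' (\sum_i c (rshift (beta (d + e)%N) i) *: s' i) I'u).
  by rewrite addrK.
move: Ic; rewrite big1 ?add0r => [|i _]; last by rewrite c1 scale0r.
case/primeI => // /ind' c2 i.
by rewrite -(splitK i); case: fintype.split => x /=; [apply: c1|apply: c2].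
Qed.

Lemma hilbert_mono : {homo alpha : d e / (d <= e)%N}.
Proof.
apply: homo_leq => [//|x y z|d]; first exact: leq_trans.
have [s [ind hom]] := (halpha d).1.
apply: ((halpha d.+1).2 _ (fun i => 'X_i0 * s i)); split=> [c|i].
  under eq_bigr do rewrite scalerAr.
  by rewrite -mulr_sumr => /primeI[/IX//|]; apply: ind.
by rewrite -[d.+1]add1n dhomogM // dhomogX /= mdeg1.
Qed.

Lemma hilbert0_gt0 : (0 < alpha 0)%N.
Proof.
apply: ((halpha 0%N).2 1%N (fun=> 1)); split=> [c|i]; last exact: dhomog1.
rewrite big_ord1 => Ic i; rewrite ord1; apply/eqP; apply: contraT => c0.
by case: I1; have := ideal_scale hI (c ord0)^-1 Ic; rewrite scalerA mulVf // scale1r.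
Qed.

(** The reduction of [P] is a sum of terms [x^mu Q_mu^M]. Replacing [Q_mu] by a combination of
    generators modulo the special fiber of [I'] makes an error whose [M]-th power lies in the
    special fiber of [I]. So the products of [x^mu] with [M]-th powers of generators suffice modulo
    [I] and [t]. *)
Lemma spanned_modulo_t d B :
  (forall mu : {ffun 'I_n -> 'I_M},
     (betabar ((d - mdeg (exponent mu)) %/ M) <= B)%N) ->
  exists g : {ffun 'I_n -> 'I_M} * 'I_B -> {mpoly O[n]},
    forall P : {mpoly O[n]}, P \is d.-homog ->
    exists (b : {ffun 'I_n -> 'I_M} * 'I_B -> O) (A : {mpoly O[n]}),
      A \is d.-homog /\
      I (map_mpoly j (P - \sum_x b x *: g x - t *: A)).
Proof.
move=> hB; pose v mu := ((d - mdeg (@exponent n p a mu)) %/ M)%N.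
have hk := special_fiber_ideal hI.
have hk' := special_fiber_ideal hI'.
have /choice[s hs] : forall mu, exists s : 'I_B -> {mpoly k[n]},
    forall Q, Q \is (v mu).-homog -> spanned (special_fiber I') s Q.
  move=> mu; have [[s hs] max] := hbetabar (v mu).
  apply: (max_form_family_pad hk' (hB mu) hs) => s' /max.
  by rewrite ltnn.
have /choice[S hS] : forall x : {ffun 'I_n -> 'I_M} * 'I_B,
    exists H : {mpoly O[n]}, map_mpoly red H = s x.1 x.2.
  by move=> x; apply: lift_mpoly.
pose G (x : {ffun 'I_n -> 'I_M} * 'I_B) := 'X_[exponent x.1] * S x ^+ M.
exists (fun x => pihomog mdeg d (G x)) => P hP.
have hPbar : map_mpoly red P \is d.-homog.
  by rewrite homog_piE -map_pihomog pihomog_dE.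
have [Q [homQ PQ]] := frobenius_decomposition hp perfect hPbar.
have /choice[c hc] := fun mu => hs mu (Q mu) (homQ mu).
have /choice[b hb] : forall x : {ffun 'I_n -> 'I_M} * 'I_B,
    exists y, red y = c x.1 x.2 ^+ M by move=> x; apply: red_surj.
have hred : map_mpoly red (P - \sum_x b x *: G x) =
    \sum_mu 'X_[exponent mu] * (Q mu - \sum_i c mu i *: s mu i) ^+ M.
  have hpm := pchar_mpoly n hp.
  rewrite rmorphB /= PQ rmorph_sum /=.
  under [in RHS]eq_bigr => mu _.
    have /eqP := exprD_pchar a (Q mu - \sum_i c mu i *: s mu i) (\sum_i c mu i *: s mu i) hpm.
    rewrite subrK -subr_eq => /eqP <-; rewrite mulrBr expr_sum_pchar // mulr_sumr.
    over.
  rewrite big_split sumrN; congr (_ - _); rewrite pair_big /=.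
  apply: eq_bigr => x _; rewrite map_mpolyZ hb rmorphM rmorphXn /= map_mpolyX hS.
  by rewrite exprZn scalerAr.
have : special_fiber I (map_mpoly red (P - \sum_x b x *: G x)).
  rewrite hred; apply: (ideal_sum (special_fiber_ideal hI)) => mu _.
  by apply: (idealMl (special_fiber_ideal hI)); apply/power/hc.
case=> H [IH redH].
have [|A hA] := @map_red_eq0 (P - \sum_x b x *: G x - H).
  by rewrite rmorphB /= redH subrr.
exists b, (pihomog mdeg d A); split; first exact: pihomogP.
suff -> : P - \sum_x b x *: pihomog mdeg d (G x) - t *: pihomog mdeg d A
    = pihomog mdeg d H by rewrite map_pihomog; apply: homI.
have pihomogZ c0 (B0 : {mpoly O[n]}) :
  pihomog mdeg d (c0 *: B0) = c0 *: pihomog mdeg d B0 by exact: linearZ.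
have pihomogG : pihomog mdeg d (\sum_x b x *: G x) = \sum_x b x *: pihomog mdeg d (G x).
  by rewrite raddf_sum; apply: eq_bigr => x _; apply: pihomogZ.
have := congr1 (pihomog mdeg d) hA.
by rewrite !pihomogB pihomogZ pihomogG pihomog_dE // => <-; rewrite subKr.
Qed.

(** Applied to all monomials of degree [d], the hypothesis is a linear system with matrix [1 - tB].
    Its determinant reduces to 1, so the system can be solved over [K]. *)
Lemma nakayama d (T : finType) (g : T -> {mpoly O[n]}) :
  (forall P : {mpoly O[n]}, P \is d.-homog -> exists (b : T -> O) (A : {mpoly O[n]}),
      A \is d.-homog /\ I (map_mpoly j (P - \sum_x b x *: g x - t *: A))) ->
  forall P : {mpoly K[n]}, P \is d.-homog ->
    spanned I (fun x => map_mpoly j (g x)) P.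
Proof.
move=> hg P /homog_monomialE->; apply: spanned_sum => //.
pose mon (i : 'I_#|{: 'X_{1..n < d.+1}}|) := monomial_form O (enum_val i).
have hmon y : monomial_form K y = map_mpoly j (mon (enum_rank y)).
  rewrite /mon enum_rankK /monomial_form; case: ifP => _; rewrite ?rmorph0 //.
  by rewrite map_mpolyX.
have /choice[b /choice[A hA]] := fun i => hg (mon i)
  (monomial_form_homog O (enum_val i)).
pose B : 'M[O]_#|{: 'X_{1..n < d.+1}}| :=
  \matrix_(i, l) (A i)@_(enum_val l : 'X_{1..n < d.+1}).
pose D := 1%:M - t *: B.
have redD : red (\det D) = 1.
  rewrite -det_map_mx /D map_mxB map_mxZ red_t scale0r subr0 map_mx1 det1 //.
have uD : map_mx j D \in unitmx.
  rewrite unitmxE unitfE det_map_mx; apply/eqP => e.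
  have d0 : \det D = 0 by apply: j_inj; rewrite rmorph0.
  by move: redD; rewrite d0 rmorph0 => /esym/eqP; rewrite oner_eq0.
have hrow i : I (\sum_l map_mx j D i l *: map_mpoly j (mon l) -
    \sum_x j (b i x) *: map_mpoly j (g x)).
  have [homA] := hA i; congr I.
  rewrite {1}(homog_monomialE homA) (reindex (fun l : 'I_#|{: 'X_{1..n < d.+1}}| =>
    enum_val l)) /=; last first.
    by apply: onW_bij; apply: enum_val_bij.
  rewrite !rmorphB rmorph_sum /= addrAC; congr (_ - _); last first.
    by apply: eq_bigr => x _; rewrite map_mpolyZ.
  under [in RHS]eq_bigr => l _.
    rewrite !mxE scalerBl; over.
  rewrite big_split sumrN /=; congr (_ - _).
    rewrite (bigD1 i) //= eqxx rmorph1 scale1r big1 ?addr0 // => l /negPf il.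
    by rewrite eq_sym il rmorph0 scale0r.
  rewrite map_mpolyZ rmorph_sum scaler_sumr.
  by apply: eq_bigr => l _ /=; rewrite map_mpolyZ scalerA rmorphM.
move=> y; rewrite hmon; set z := enum_rank y.
exists (fun x => \sum_i invmx (map_mx j D) z i * j (b i x)).
have -> : map_mpoly j (mon z) - \sum_x (\sum_i invmx (map_mx j D) z i * j (b i x))
      *: map_mpoly j (g x) =
    \sum_i invmx (map_mx j D) z i *: (\sum_l map_mx j D i l *: map_mpoly j (mon l)
      - \sum_x j (b i x) *: map_mpoly j (g x)).
  under [in RHS]eq_bigr do rewrite scalerBr.
  rewrite big_split sumrN /=; congr (_ - _).
    under eq_bigr do rewrite scaler_sumr.
    rewrite exchange_big /=.
    under eq_bigr do under eq_bigr do rewrite scalerA.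
    under eq_bigr do rewrite -scaler_suml.
    have hinv l : \sum_i invmx (map_mx j D) z i * map_mx j D i l = (z == l)%:R.
      by have /matrixP/(_ z l) := mulVmx uD; rewrite !mxE => <-.
    rewrite (bigD1 z) //= hinv eqxx scale1r big1 ?addr0 // => l /negPf lz.
    by rewrite hinv eq_sym lz scale0r.
  under [in LHS]eq_bigr do rewrite scaler_suml.
  rewrite exchange_big; apply: eq_bigr => i _.
  by rewrite scaler_sumr; apply: eq_bigr => x _; rewrite scalerA.
by apply: ideal_sum => // i _; apply: ideal_scale.
Qed.

(** The entries of [mu] are smaller than [M], so [(M u - |mu|) / M] lies between [u - n] and [u].
    There are [M^n] choices of [mu], each with at most [B] generators. *)
Lemma hilbert_frobenius u B :
  (forall w, (w <= u)%N -> (u <= w + n)%N -> (betabar w <= B)%N) ->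
  (n <= u)%N -> (alpha (M * u) <= M ^ n * B)%N.
Proof.
have M0 : (0 < M)%N by rewrite expn_gt0 prime_gt0 ?(pcharf_prime hp).
move=> hB nu.
have [mu|g hg] := @spanned_modulo_t (M * u) B.
  have hmu : (mdeg (exponent mu) <= M * n)%N.
    rewrite mdegE mulnC -[n in (_ <= n * _)%N]card_ord -sum_nat_const.
    by apply: leq_sum => i _; rewrite mnmE ltnW.
  apply: hB; first by rewrite -[leqRHS](mulKn u M0) leq_div2r ?leq_subr.
  by rewrite addnC -leq_subLR leq_divRL // mulnBl; lia.
have [s [ind hom]] := (halpha (M * u)%N).1.
have := independent_le_card hI ind (fun i => nakayama hg (hom i)).
by rewrite card_prod card_ffun !card_ord.
Qed.

End HilbertComparison.

(* If [I'] were strictly larger than the prime [I], its Hilbert function would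
   grow strictly slower than that of [I]; but the special fibers of [I] and [I']
   agree up to nilpotents, and the Frobenius on the special fiber bounds the
   Hilbert function of [I] by that of [I']. *)
Lemma special_fiber_rigidity P : I' P -> I P.
Proof.
have [alpha halpha] := hilbert_function_exists hI.
have [beta hbeta] := hilbert_function_exists hI'.
have [betabar hbetabar] := hilbert_function_exists (special_fiber_ideal hI').
move=> I'P; apply: contrapT => nIP.
have [e [I'u nIu]] : exists e, I' (pihomog mdeg e P) /\ ~ I (pihomog mdeg e P).
  apply: contrapT => /forallNP h; apply: nIP.
  rewrite [P](pihomog_partitionE (mf := mdeg) (leqnn _)).
  apply: ideal_sum => // d _; have := h d.
  by move/not_andP => [/(_ (homI' _ I'P))//|/contrapT].
have M0 : (0 < M)%N by rewrite expn_gt0 prime_gt0 ?(pcharf_prime hp).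
have mono := hilbert_mono halpha.
(* The recursion comes from [alpha u <= alpha (M u) <= M^n * B] for any bound [B] of the [betabar w]
   with [u - n <= w <= u], and from [betabar w <= beta w <= alpha w - alpha (w - e) <= alpha u -
   alpha (u - n - e)]. *)
apply: (@exponential_growth alpha (M ^ n) (n + e) n) => [//||u|u hu].
- exact: hilbert0_gt0 halpha.
- by have [s hs] := (halpha u).1; apply: form_family_le hI _ _ _ hs.
apply: (@leq_trans (alpha (M * u))); first by apply: mono; rewrite leq_pmull.
apply: (hilbert_frobenius halpha hbetabar) => [w wu uw|]; last first.
  exact: leq_trans (leq_addr _ _) hu.
apply: leq_trans (betabar_le_beta hbeta hbetabar w) _.
have := hilbert_mul halpha hbeta (w - e) nIu I'u (pihomogP _ _ _).
rewrite subnK; last by lia.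
have := mono w u wu; have := mono (u - (n + e))%N (w - e)%N.
lia.
Qed.

End SpecialFiber.

(** * Ultrafilters and substitutions *)

(** [ultra_tail] makes the ultrafilter nonprincipal; [ultra_or] is what makes ideals of almost
    everywhere vanishing prime. *)
Record ultrafilter (U : (nat -> Prop) -> Prop) := Ultrafilter {
  ultra_and : forall A B, U A -> U B -> U (fun i => A i /\ B i);
  ultra_sub : forall A B : nat -> Prop, (forall i, A i -> B i) -> U A -> U B;
  ultra_tail : forall m, U (fun i => (m <= i)%N);
  ultra_or : forall A B, U (fun i => A i \/ B i) -> U A \/ U B;
  ultra_proper : ~ U (fun=> False)
}.

Lemma ultra_exists U (n : nat) (A : 'I_n -> nat -> Prop) : ultrafilter U ->
  U (fun m => exists i, A i m) -> exists i, U (A i).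
Proof.
move=> hU; elim: n A => [|n IH] A.
  by move=> h; case: (ultra_proper hU); apply: ultra_sub h => // m [[]].
move=> h; have [h0|/IH[i hi]] : U (A ord0) \/
    U (fun m => exists i, A (fintype.lift ord0 i) m); last 2 first.
- by exists ord0.
- by exists (fintype.lift ord0 i).
apply: (ultra_or hU); apply: ultra_sub h => // m [i].
by case: (unliftP ord0 i) => [l ->|->]; [right; exists l|left].
Qed.

Lemma ultra_all U (n : nat) (A : nat -> nat -> Prop) : ultrafilter U ->
  (forall i, (i < n)%N -> U (A i)) ->
  U (fun m => forall i, (i < n)%N -> A i m).
Proof.
move=> hU; elim: n => [|n IH] h.
  by apply: ultra_sub (ultra_tail hU 0%N).
apply: ultra_sub (ultra_and hU (IH (fun i hi => h i (ltnW hi))) (h n (ltnSn n))) => //.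
by move=> m [h1 h2] i; rewrite ltnS leq_eqVlt => /predU1P[->//|/h1].
Qed.

Section MpolyMorphisms.

Lemma mpoly_rmorph_eq n (R S : comNzRingType) (f g : {rmorphism {mpoly R[n]} -> S}) :
  (forall c, f c%:MP = g c%:MP) -> (forall i, f 'X_i = g 'X_i) -> f =1 g.
Proof.
move=> eqC eqX P; rewrite [P]mpolyE !rmorph_sum; apply: eq_bigr => m _ /=.
rewrite -mul_mpolyC !rmorphM eqC mpolyXE_id; congr (_ * _).
by rewrite !rmorph_prod; apply: eq_bigr => i _ /=; rewrite !rmorphXn /= eqX.
Qed.

Lemma mmap_comp_mpoly n l (R S : comNzRingType) (f : {rmorphism R -> S})
    (h : 'I_l -> S) (T : n.-tuple {mpoly R[l]}) (P : {mpoly R[n]}) :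
  mmap f h (P \mPo T) = mmap f (fun i => mmap f h (tnth T i)) P.
Proof.
apply: (mpoly_rmorph_eq (f := mmap f h \o comp_mpoly T)
  (g := mmap f (fun i => mmap f h (tnth T i)))) => [c|i] /=.
  by rewrite comp_mpolyC !mmapC.
by rewrite comp_mpolyXU -tnth_nth mmapX mmap1U.
Qed.

Lemma mmap_map_mpoly n (R S S' : comNzRingType) (f : {rmorphism R -> S})
    (g : {rmorphism S -> S'}) (h : 'I_n -> S') (P : {mpoly R[n]}) :
  mmap g h (map_mpoly f P) = mmap (g \o f) h P.
Proof.
apply: (mpoly_rmorph_eq (f := mmap g h \o map_mpoly f)
  (g := mmap (g \o f) h)) => [c|i] /=.
  by rewrite map_mpolyC !mmapC.
by rewrite map_mpolyX !mmapX.
Qed.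

Lemma comp_mpolyA n l l' (R : comNzRingType) (T : n.-tuple {mpoly R[l]})
    (T' : l.-tuple {mpoly R[l']}) (P : {mpoly R[n]}) :
  (P \mPo T) \mPo T' = P \mPo [tuple tnth T i \mPo T' | i < n].
Proof.
rewrite [LHS]mmap_comp_mpoly /comp_mpoly; apply: eq_bigr => m _; congr (_ * _).
by apply: mmap1_eq => i; rewrite tnth_mktuple.
Qed.

Lemma map_comp_mpoly n l (R S : comNzRingType) (f : {rmorphism R -> S})
    (T : n.-tuple {mpoly R[l]}) (P : {mpoly R[n]}) :
  map_mpoly f (P \mPo T) =
  map_mpoly f P \mPo [tuple map_mpoly f (tnth T i) | i < n].
Proof.
apply: (mpoly_rmorph_eq (f := map_mpoly f \o comp_mpoly T)
  (g := comp_mpoly [tuple map_mpoly f (tnth T i) | i < n] \o map_mpoly f)).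
  by move=> c /=; rewrite map_mpolyC !comp_mpolyC map_mpolyC.
move=> i /=; rewrite map_mpolyX !comp_mpolyXU -tnth_nth.
by rewrite -[RHS]tnth_nth tnth_mktuple.
Qed.

Definition tuple_iter n (R : comNzRingType) (F : n.-tuple {mpoly R[n]}) (m : nat) :=
  iter m (fun T : n.-tuple {mpoly R[n]} => [tuple tnth F i \mPo T | i < n])
    [tuple 'X_i | i < n].

Lemma comp_tuple_iterS n (R : comNzRingType) (F : n.-tuple {mpoly R[n]}) m P :
  P \mPo tuple_iter F m.+1 = (P \mPo F) \mPo tuple_iter F m.
Proof. by rewrite comp_mpolyA. Qed.

Lemma comp_tuple_iterD n (R : comNzRingType) (F : n.-tuple {mpoly R[n]}) a b P :
  P \mPo tuple_iter F (a + b) = (P \mPo tuple_iter F a) \mPo tuple_iter F b.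
Proof.
elim: a P => [|a IH] P.
  by have -> : P \mPo tuple_iter F 0 = P by apply: comp_mpoly_id.
by rewrite addSn !comp_tuple_iterS IH.
Qed.

Lemma map_tuple_iter n (R S : comNzRingType) (f : {rmorphism R -> S})
    (F : n.-tuple {mpoly R[n]}) m :
  [tuple map_mpoly f (tnth (tuple_iter F m) i) | i < n] =
  tuple_iter [tuple map_mpoly f (tnth F i) | i < n] m.
Proof.
elim: m => [|m IH]; apply: eq_from_tnth => i; rewrite !tnth_mktuple.
  by rewrite map_mpolyX.
by rewrite map_comp_mpoly IH.
Qed.

Lemma mmap_homog n (R S : comNzRingType) (f : {rmorphism R -> S}) (y : 'I_n -> S)
    e d (P : {mpoly R[n]}) : P \is d.-homog ->
  mmap (polyC \o f) (fun i => y i *: 'X^e) P = mmap f y P *: 'X^(d * e).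
Proof.
move=> hP; rewrite /mmap scaler_suml !big_seq; apply: eq_bigr => m mP /=.
rewrite mul_polyC -scalerA; congr (_ *: _); rewrite /mmap1.
rewrite -(dhomog_mf hP mP) /= mdegE big_distrl /= -prodrXr -scaler_prod.
by apply: eq_bigr => i _; rewrite exprZn -exprM mulnC.
Qed.

Lemma comp_homog n l (R : comNzRingType) (T : n.-tuple {mpoly R[l]}) D d P :
  (forall i, tnth T i \is D.-homog) -> P \is d.-homog -> P \mPo T \is (d * D).-homog.
Proof.
move=> hT hP; rewrite comp_mpolyE big_seq; apply: rpred_sum => m mP.
apply: rpredZ; rewrite -(dhomog_mf hP mP) /= mdegE big_distrl /=.
apply: (big_ind2 (fun P d => P \is d.-homog)) => [|P1 d1 P2 d2|i _].
- exact: dhomog1.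
- by move=> *; apply: dhomogM.
- by rewrite mulnC; apply: dhomogMn.
Qed.

Lemma pihomog_sum n (R : nzRingType) (g : nat -> nat) N
    (P : nat -> {mpoly R[n]}) d : injective g ->
  (forall i, P i \is (g i).-homog) -> (d < N)%N ->
  pihomog mdeg (g d) (\sum_(i < N) P i) = P d.
Proof.
move=> inj hP dN; rewrite raddf_sum (bigD1 (Ordinal dN)) //= pihomog_dE //.
rewrite big1 ?addr0 // => i; rewrite -val_eqE /= => /negPf id.
by rewrite (pihomog_ne0 (d := g i)) // (inj_eq inj) id.
Qed.

End MpolyMorphisms.

(** * t-adic expansions *)

Section TadicExpansion.
Variables (k : fieldType) (O : comNzRingType) (red : {rmorphism O -> k}).
Variables (tau : {rmorphism k -> O}) (t : O) (n p : nat).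
Hypothesis tauK : cancel tau red.
Hypothesis red_ker : forall x, red x = 0 -> exists y, x = t * y.
Hypothesis red_t : red t = 0.
Hypothesis t_reg : forall x, t * x = 0 -> x = 0.
Hypothesis hpO : p \in [pchar O].
Variable Z : {mpoly k[n]} -> Prop.
Hypothesis hZ : ideal_like Z.
Implicit Types P : {mpoly O[n]}.

(* The first [M] coefficients of the [t]-adic expansion of [P], with respect to
   the coefficient field [tau k], lie in [Z]. *)
Fixpoint expansion_in M P : Prop :=
  if M is M'.+1 then
    exists (Q : {mpoly k[n]}) (P' : {mpoly O[n]}),
      [/\ Z Q, P = map_mpoly tau Q + t *: P' & expansion_in M' P']
  else True.

Lemma map_tauK (Q : {mpoly k[n]}) : map_mpoly red (map_mpoly tau Q) = Q.
Proof. by apply/mpolyP => m; rewrite !mcoeff_map_mpoly /= tauK. Qed.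

Lemma tau_expansion P : exists P', P = map_mpoly tau (map_mpoly red P) + t *: P'.
Proof.
have [|P' hP'] := @map_red_eq0 k O red t n red_ker (P - map_mpoly tau (map_mpoly red P)).
  by rewrite rmorphB /= map_tauK subrr.
by exists P'; rewrite -hP' addrC subrK.
Qed.

Lemma mpoly_t_inj : injective (fun P : {mpoly O[n]} => t *: P).
Proof.
move=> P Q /mpolyP h; apply/mpolyP => m; apply/eqP; rewrite -subr_eq0; apply/eqP.
by apply: t_reg; have := h m; rewrite !mcoeffZ mulrBr => ->; rewrite subrr.
Qed.

Lemma expansion_in0 M : expansion_in M 0.
Proof.
elim: M => //= M IH; exists 0, 0; split=> //; first exact: ideal0.
by rewrite rmorph0 scaler0 addr0.
Qed.

Lemma expansion_inD M P P' : expansion_in M P -> expansion_in M P' ->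
  expansion_in M (P + P').
Proof.
elim: M P P' => //= M IH _ _ [Q [P [ZQ -> hP]]] [Q' [P' [ZQ' -> hP']]].
exists (Q + Q'), (P + P'); split; [exact: idealD| |exact: IH].
by rewrite rmorphD scalerDr addrACA.
Qed.

Lemma expansion_inMtau M A Q : Z Q -> expansion_in M (A * map_mpoly tau Q).
Proof.
move=> ZQ; elim: M A => //= M IH A; have [A' hA'] := tau_expansion A.
exists (map_mpoly red A * Q), (A' * map_mpoly tau Q); split=> //.
  exact: idealMl.
by rewrite {1}hA' mulrDl -scalerAl rmorphM.
Qed.

(** No carries occur because [tau] is a ring morphism, so [A] can be expanded digit by digit as
    well. *)
Lemma expansion_inMl M A P : expansion_in M P -> expansion_in M (A * P).
Proof.
elim: M A P => //= M IH A _ [Q [P [ZQ -> hP]]].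
have [A' hA'] := tau_expansion A.
exists (map_mpoly red A * Q), (A' * map_mpoly tau Q + A * P); split.
- exact: idealMl.
- rewrite mulrDr {1}hA' mulrDl rmorphM -addrA; congr (_ + _).
  by rewrite scalerDr -scalerAl -scalerAr.
- by apply: expansion_inD; [apply: expansion_inMtau|apply: IH].
Qed.

Lemma expansion_in_t M P : expansion_in M P -> expansion_in M.+1 (t *: P).
Proof.
by move=> hP; exists 0, P; split; rewrite ?rmorph0 ?add0r //; apply: ideal0.
Qed.

Lemma expansion_in_tX M e P :
  expansion_in M P -> expansion_in (e + M) (t ^+ e *: P).
Proof.
move=> hP; elim: e => [|e IH]; first by rewrite expr0 scale1r.
by rewrite exprS -scalerA; apply: expansion_in_t.
Qed.

Lemma expansion_in_t_inv M P : expansion_in M.+1 (t *: P) -> expansion_in M P.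
Proof.
move=> [Q [P' [ZQ e hP']]]; suff -> : P = P' by [].
apply: mpoly_t_inj => /=; rewrite e.
have := congr1 (map_mpoly red) e; rewrite rmorphD /= !map_mpolyZ map_tauK red_t.
by rewrite !scale0r addr0 => <-; rewrite rmorph0 add0r.
Qed.

Lemma expansion_in_tX_inv M e P :
  expansion_in (e + M) (t ^+ e *: P) -> expansion_in M P.
Proof.
elim: e => [|e IH]; first by rewrite expr0 scale1r.
by rewrite exprS -scalerA => /expansion_in_t_inv.
Qed.

Lemma expansion_in_pred M P : expansion_in M.+1 P -> expansion_in M P.
Proof.
elim: M P => // M IH _ [Q [P [ZQ -> /IH hP]]].
by exists Q, P.
Qed.

Lemma expansion_in_le M M' P : (M <= M')%N -> expansion_in M' P -> expansion_in M P.
Proof.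
by move/subnK=> <-; elim: (M' - M)%N => // e IH /expansion_in_pred.
Qed.

Lemma expansion_in1 P : Z (map_mpoly red P) -> expansion_in 1 P.
Proof.
by have [P' hP'] := tau_expansion P; exists (map_mpoly red P), P'.
Qed.

Lemma expansion_in_red M P : expansion_in M.+1 P -> Z (map_mpoly red P).
Proof.
move=> [Q [P' [ZQ -> _]]].
by rewrite rmorphD /= map_mpolyZ red_t scale0r addr0 map_tauK.
Qed.

(** In characteristic [p], [(Q + t P')^p = Q^p + t^p P'^p]: each digit of the expansion is stretched
    over [p] digits. *)
Lemma expansion_inXp M P : expansion_in M P -> expansion_in (p * M) (P ^+ p).
Proof.
elim: M P => [|M IH] P; first by rewrite muln0.
move=> [Q [P' [ZQ -> hP']]];
have := exprD_pchar 1 (map_mpoly tau Q) (t *: P') (pchar_mpoly n hpO).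
rewrite expn1 => ->; apply: expansion_inD.
  have := @expansion_inMtau (p * M.+1) 1 (Q ^+ p); rewrite mul1r rmorphXn; apply.
  by apply: (idealXn hZ) => //; rewrite prime_gt0 ?(pcharf_prime hpO).
by rewrite exprZn mulnS; apply: expansion_in_tX; apply: IH.
Qed.

Lemma expansion_in_pihomog M d P : (forall Q, Z Q -> Z (pihomog mdeg d Q)) ->
  expansion_in M P -> expansion_in M (pihomog mdeg d P).
Proof.
move=> homZ; elim: M P => //= M IH _ [Q [P [ZQ -> hP]]].
exists (pihomog mdeg d Q), (pihomog mdeg d P); split; rewrite ?map_pihomog.
- exact: homZ.
- by rewrite pihomogD; congr (_ + _); apply: linearZ.
- exact: IH.
Qed.

Lemma expansion_in_sum (T : Type) (s : seq T) (F : T -> {mpoly O[n]}) M :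
  (forall i, expansion_in M (F i)) -> expansion_in M (\sum_(i <- s) F i).
Proof.
move=> h; apply: (big_ind (expansion_in M)) => //; first exact: expansion_in0.
exact: expansion_inD.
Qed.

End TadicExpansion.

(** * Radicals in characteristic [p] *)

Section Radical.
Variables (k : fieldType) (n p : nat).
Hypothesis hp : p \in [pchar k].
Variable I : {mpoly k[n]} -> Prop.
Hypothesis hI : ideal_like I.

(** This is the usual radical: powers of [p] suffice as exponents, and they make additivity a
    consequence of the Frobenius. *)
Definition p_radical Q := exists i, I (Q ^+ (p ^ i)).

Lemma pX_gt0 i : (0 < p ^ i)%N.
Proof. by rewrite expn_gt0 prime_gt0 ?(pcharf_prime hp). Qed.

Lemma p_power_mono i i' Q : (i <= i')%N -> I (Q ^+ (p ^ i)) -> I (Q ^+ (p ^ i')).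
Proof.
move/subnK=> <-; rewrite expnD mulnC exprM; apply: idealXn => //; exact: pX_gt0.
Qed.

Lemma p_radical_ideal : ideal_like p_radical.
Proof.
split=> [|x y [i Ix] [i' Iy]|a x [i Ix]].
- by exists 0%N; rewrite expn0 expr1; apply: ideal0.
- exists (i + i')%N; rewrite (exprD_pchar _ _ _ (pchar_mpoly n hp)).
  by apply: idealD => //; [move: Ix|move: Iy]; apply: p_power_mono;
    [apply: leq_addr|apply: leq_addl].
- by exists i; rewrite exprMn; apply: idealMl.
Qed.

Lemma p_radicalX i Q : p_radical (Q ^+ (p ^ i)) -> p_radical Q.
Proof. by move=> [l]; rewrite -exprM -expnD; exists (i + l)%N. Qed.

Lemma p_radical_pihomog d Q : (forall e Q, I Q -> I (pihomog mdeg e Q)) ->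
  p_radical Q -> p_radical (pihomog mdeg d Q).
Proof.
move=> homI [i IQ]; exists i; have hpm := pchar_mpoly n hp.
suff -> : pihomog mdeg d Q ^+ (p ^ i) = pihomog mdeg (d * p ^ i) (Q ^+ (p ^ i)).
  exact: homI.
pose N := (maxn (msize Q) d.+1).
rewrite [in RHS](pihomog_partitionE (mf := mdeg) (leq_maxl (msize Q) d.+1)).
rewrite [in RHS]expr_sum_pchar //.
symmetry; apply: (@pihomog_sum n k (fun e => e * p ^ i)%N N
  (fun e => pihomog mdeg e Q ^+ (p ^ i)) d).
- by move=> a b /eqP; rewrite eqn_pmul2r ?pX_gt0 // => /eqP.
- by move=> e; apply: dhomogMn; apply: pihomogP.
- exact: leq_maxr.
Qed.

Lemma p_radical_uniform : exists i, forall Q, p_radical Q -> I (Q ^+ (p ^ i)).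
Proof.
have [s [hs gen]] := mpoly_finite_generators p_radical.
have [i hi] : exists i, forall Q, Q \in s -> I (Q ^+ (p ^ i)).
  elim: s {gen} hs => [|Q s IH] hs; first by exists 0%N.
  have [i hi] := IH (fun P Ps => hs P (mem_behead (s := Q :: s) Ps)).
  have [l hl] := hs Q (mem_head _ _).
  exists (i + l)%N => P; rewrite inE => /predU1P[->|/hi].
    by move: hl; apply: p_power_mono; apply: leq_addl.
  by apply: p_power_mono; apply: leq_addr.
exists i => Q /gen[c ->]; rewrite expr_sum_pchar ?(pchar_mpoly n hp) //.
by apply: ideal_sum => // l _; rewrite exprMn; apply: idealMl => //; apply/hi/mem_nth.
Qed.

End Radical.

(** * Vanishing ideals along an orbit *)

(** What is used of a discrete valuation ring [O] of characteristic [p] with fraction field [K],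
    perfect residue field [k], coefficient field [tau k] and uniformizer [t]. [dvr_primitive] and
    [dvr_denominator] replace the valuation; by [dvr_pbasis] the powers [1, t, ..., t^(p-1)] span
    [O] over its [p]-th powers. *)
Record equal_char_dvr (K k : fieldType) (O : comNzRingType)
    (j : {rmorphism O -> K}) (red : {rmorphism O -> k}) (tau : {rmorphism k -> O})
    (t : O) (p : nat) := EqualCharDvr {
  dvr_inj : injective j;
  dvr_tauK : cancel tau red;
  dvr_ker : forall x, red x = 0 -> exists y, x = t * y;
  dvr_t : red t = 0;
  dvr_reg : forall x, t * x = 0 -> x = 0;
  dvr_pcharO : p \in [pchar O];
  dvr_pchark : p \in [pchar k];
  dvr_perfect : forall x : k, exists y, y ^+ p = x;
  dvr_primitive : forall r (c : 'I_r -> K), (exists i, c i != 0) ->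
    exists s (b : 'I_r -> O),
      [/\ s != 0, forall i, s * c i = j (b i) & exists i, red (b i) != 0];
  dvr_denominator : forall x : K, exists e b, j t ^+ e * x = j b;
  dvr_pbasis : forall a : O, exists b : 'I_p -> O, a = \sum_(l < p) t ^+ l * b l ^+ p
}.

Section PthPowerForms.
Variables (O : comNzRingType) (p n : nat) (t : O).
Hypothesis hpO : p \in [pchar O].
Hypothesis pbasis : forall a : O, exists b : 'I_p -> O, a = \sum_(l < p) t ^+ l * b l ^+ p.

Definition power_vars : n.-tuple {mpoly O[n]} := [tuple 'X_i ^+ p | i < n].

Lemma pth_power_decomposition (P : {mpoly O[n]}) :
  exists H : 'I_p -> {mpoly O[n]}, P \mPo power_vars = \sum_(l < p) t ^+ l *: H l ^+ p.
Proof.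
have /choice[b hb] : forall a : O, exists b : 'I_p -> O, (a = \sum_(l < p) t ^+ l * b l ^+ p)
    by exact: pbasis.
have hpm := pchar_mpoly n hpO.
exists (fun l => \sum_(m <- msupp P) b P@_m l *: 'X_[m]).
rewrite comp_mpolyEX.
under [in RHS]eq_bigr => l _.
  have := expr_sum_pchar 1 (msupp P) xpredT (fun m => b P@_m l *: 'X_[m]) hpm.
  rewrite expn1 => ->; rewrite scaler_sumr; over.
rewrite exchange_big; apply: eq_bigr => m _ /=.
have -> : 'X_[m] \mPo power_vars = 'X_[m] ^+ p.
  rewrite comp_mpolyX [in RHS]mpolyXE_id -prodrXl; apply: eq_bigr => i _.
  by rewrite tnth_mktuple exprAC.
rewrite {1}(hb P@_m) scaler_suml; apply: eq_bigr => l _.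
by rewrite exprZn scalerA.
Qed.

End PthPowerForms.

Lemma coef_exprp (R : comNzRingType) p (P : {poly R}) i : p \in [pchar R] ->
  (P ^+ p)`_(p * i) = P`_i ^+ p.
Proof.
move=> hp; have hpp : p \in [pchar {poly R}].
  case/andP: hp => pp /eqP p0; rewrite inE pp /=.
  by rewrite -polyC_natr p0 polyC0.
have p0 : (0 < p)%N by rewrite prime_gt0 ?(pcharf_prime hp).
have := expr_sum_pchar 1 (index_enum 'I_(size P)) xpredT
  (fun l : 'I_(size P) => P`_l *: 'X^l) hpp.
rewrite expn1 -poly_def coefK => ->.
rewrite coef_sum; under eq_bigr do rewrite exprZn -exprM coefZ coefXn mulnC eqn_pmul2r //.
have [iP|Pi] := ltnP i (size P).
  rewrite (bigD1 (Ordinal iP)) //= eqxx mulr1 big1 ?addr0 // => l.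
  by rewrite -val_eqE /= eq_sym => /negPf->; rewrite mulr0.
rewrite big1 => [|l _]; first by rewrite nth_default // expr0n gtn_eqF.
by rewrite gtn_eqF ?mulr0 //; apply: leq_trans Pi.
Qed.

Section VanishingIdeals.
Variables (K k : fieldType) (O : comNzRingType).
Variables (j : {rmorphism O -> K}) (red : {rmorphism O -> k}).
Variables (tau : {rmorphism k -> O}) (t : O) (p : nat).
Hypothesis dvr : equal_char_dvr j red tau t p.

Variables (n : nat) (F G : n.-tuple {mpoly O[n]}) (D : nat).
Hypothesis D0 : (0 < D)%N.
Hypothesis homF : forall i, tnth F i \is D.-homog.
Hypothesis FG : forall i, tnth F i = tnth G i \mPo power_vars O p n.
Variables (r : nat).
Hypothesis r0 : (0 < r)%N.
Hypothesis redF : exists s, forall P : {mpoly O[n]},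
  map_mpoly red (P \mPo tuple_iter F r) = map_mpoly red P ^+ (p ^ s).

Variables (E : fieldType) (iota : {rmorphism K -> E}).
Variable y : nat -> 'I_n -> E.
Hypothesis yS : forall m i, y m.+1 i = mmap (iota \o j) (y m) (tnth F i).
Hypothesis y_neq0 : forall m, exists i, y m i != 0.
Variable L : E -> Prop.
Hypothesis L_iota : forall a, L (iota a).
Hypothesis LD : forall a b, L a -> L b -> L (a + b).
Hypothesis LM : forall a b, L a -> L b -> L (a * b).
Hypothesis Ly : exists u, forall m, (u <= m)%N -> forall i, L (y m i).
Hypothesis L_pindep : forall a : 'I_p -> E, (forall l, L (a l)) ->
  \sum_(l < p) iota (j t) ^+ l * a l ^+ p = 0 -> forall l, a l = 0.
Variable U : (nat -> Prop) -> Prop.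
Hypothesis hU : ultrafilter U.

(* Scaling the orbit by a variable makes vanishing ideals homogeneous. *)
Definition cone m (i : 'I_n) : {poly E} := y m i *: 'X^(D ^ m).
Local Notation ev m := (mmap (polyC \o iota) (cone m)).
Definition FK : n.-tuple {mpoly K[n]} := [tuple map_mpoly j (tnth F i) | i < n].

Lemma ev_comp m P : ev m (P \mPo FK) = ev m.+1 P.
Proof.
rewrite mmap_comp_mpoly; apply: eq_bigr => e _; congr (_ * _); apply: mmap1_eq => i.
rewrite tnth_mktuple mmap_map_mpoly; have := mmap_homog (iota \o j) (y m) (D ^ m) (homF i).
by rewrite /cone yS expnS.
Qed.

Lemma map_comp_F P : map_mpoly j (P \mPo F) = map_mpoly j P \mPo FK.
Proof. exact: map_comp_mpoly. Qed.

Lemma ev_homog m d P : P \is d.-homog -> ev m P = mmap iota (y m) P *: 'X^(d * D ^ m).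
Proof. by move=> hP; apply: mmap_homog. Qed.

(** The component of degree [d] contributes only to the coefficient of [X^(d D^m)], and these
    exponents are distinct because [D > 0]. *)
Lemma ev_pihomog m d P : ev m P = 0 -> ev m (pihomog mdeg d P) = 0.
Proof.
move=> eP; pose N := maxn (msize P) d.+1.
have dN : (d < N)%N by apply: leq_maxr.
have : (ev m P)`_(d * D ^ m) = mmap iota (y m) (pihomog mdeg d P).
  rewrite [P in LHS](pihomog_partitionE (mf := mdeg) (leq_maxl (msize P) d.+1)).
  rewrite rmorph_sum coef_sum (bigD1 (Ordinal dN)) //=.
  rewrite (ev_homog _ (pihomogP _ _ _)) coefZ coefXn eqxx mulr1 big1 ?addr0 // => i.
  rewrite -val_eqE /= eq_sym => /negPf id.
  rewrite (ev_homog _ (pihomogP _ _ _)) coefZ coefXn eqn_pmul2r ?expn_gt0 ?D0 //.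
  by rewrite id mulr0.
rewrite eP coef0 => e0.
by rewrite (ev_homog _ (pihomogP _ _ _)) -e0 scale0r.
Qed.

(* The ideal of the "generic" point of the orbit shifted backwards by [a]. *)
Definition vanishing a (P : {mpoly K[n]}) := U (fun i => ev (i - a) P = 0).

Lemma vanishing_ideal a : ideal_like (vanishing a).
Proof.
split=> [|P Q hP hQ|A P].
- by apply: (ultra_sub hU _ (ultra_tail hU 0)) => i _; rewrite rmorph0.
- by apply: (ultra_sub hU _ (ultra_and hU hP hQ)) => i [eP eQ]; rewrite rmorphD /= eP eQ addr0.
- by apply: (ultra_sub hU) => i e; rewrite rmorphM /= e mulr0.
Qed.

Lemma vanishing_prime a P Q : vanishing a (P * Q) -> vanishing a P \/ vanishing a Q.
Proof.
move=> h; apply: (ultra_or hU); apply: (ultra_sub hU _ h) => i.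
by rewrite rmorphM /= => /eqP; rewrite mulf_eq0 => /orP[] /eqP; [left|right].
Qed.

Lemma vanishing_pihomog a d P : vanishing a P -> vanishing a (pihomog mdeg d P).
Proof. by apply: (ultra_sub hU) => i; apply: ev_pihomog. Qed.

Lemma vanishing1 a : ~ vanishing a 1.
Proof.
move=> h; apply: (ultra_proper hU); apply: (ultra_sub hU _ h) => i /eqP.
by rewrite rmorph1 oner_eq0.
Qed.

Lemma vanishingX a : exists i, ~ vanishing a 'X_i.
Proof.
have /(ultra_exists hU)[i hi] : U (fun m => exists i, y (m - a)%N i != 0).
  by apply: (ultra_sub hU _ (ultra_tail hU 0)) => m _; apply: y_neq0.
exists i => hv; apply: (ultra_proper hU); apply: (ultra_sub hU _ (ultra_and hU hi hv)).
move=> m [/negP nz]; rewrite mmapX mmap1U /cone => /eqP.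
by rewrite scaler_eq0 expf_eq0 polyX_eq0 andbF orbF.
Qed.

(** The subtraction is truncated, but for [i > a], hence almost everywhere, [i - a] is the successor
    of [i - a.+1]. *)
Lemma vanishing_comp a P : vanishing a P <-> vanishing a.+1 (P \mPo FK).
Proof.
have e i : (a < i)%N -> ev (i - a.+1) (P \mPo FK) = ev (i - a) P.
  by move=> ai; rewrite ev_comp -subSn.
split=> h; apply: (ultra_sub hU _ (ultra_and hU h (ultra_tail hU a.+1))) => i [h0 hi].
  by rewrite e.
by rewrite -e.
Qed.

Lemma ev_coef_L : exists u, forall m, (u <= m)%N -> forall P l, L (ev m P)`_l.
Proof.
have L0 : L 0 by rewrite -(rmorph0 iota).
have L1 : L 1 by rewrite -(rmorph1 iota).
pose LP (P : {poly E}) := forall l, L P`_l.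
have LPD P Q : LP P -> LP Q -> LP (P + Q) by move=> hP hQ l; rewrite coefD; apply: LD.
have Lsum (T : Type) (s : seq T) (A : T -> E) : (forall l, L (A l)) -> L (\sum_(l <- s) A l).
  by move=> h; apply: (big_ind L).
have LPM P Q : LP P -> LP Q -> LP (P * Q).
  by move=> hP hQ l; rewrite coefM; apply: Lsum => e; apply: LM.
have LP1 : LP 1 by move=> l; rewrite coef1; case: (l == _).
have [u hu] := Ly; exists u => m um P.
rewrite /mmap; apply: (big_ind LP) => // [l|e _]; first by rewrite coef0.
apply: (LPM); first by move=> l; rewrite coefC; case: ifP.
apply: (big_ind LP LP1 LPM) => i _; elim: (e i) => [|d IH]; first by rewrite expr0.
rewrite exprS; apply: (LPM) => // l; rewrite coefZ coefXn; apply: LM; first exact: hu.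
by case: eqP.
Qed.

(** At a late orbit point the vanishing of [P o F] reads [sum_l t^l H_l^p = 0]. Coefficientwise in
    the cone variable the values of the [H_l] lie in [L], and [L_pindep] makes them 0. *)
Lemma vanishing_descent a (P : {mpoly O[n]}) (H : 'I_p -> {mpoly O[n]}) :
  vanishing a (map_mpoly j P) -> P \mPo F = \sum_(l < p) t ^+ l *: H l ^+ p ->
  forall l, vanishing a.+1 (map_mpoly j (H l)).
Proof.
move=> hP eP l; have [u hu] := ev_coef_L; have hPF := (vanishing_comp a _).1 hP.
have hpE : p \in [pchar E] by rewrite (rmorph_pchar (iota \o j)) // (dvr_pcharO dvr).
apply: (ultra_sub hU _ (ultra_and hU hPF (ultra_tail hU (u + a.+1)%N))) => i [e0 hi].
have : (u <= i - a.+1)%N by rewrite -(leq_add2r a.+1) subnK // (leq_trans _ hi) ?leq_addl.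
move: (i - a.+1)%N e0 => m e0 um {hi}.
have {}e0 : \sum_(l < p) (iota (j t) ^+ l)%:P * ev m (map_mpoly j (H l)) ^+ p = 0.
  pose ev_j : {rmorphism _ -> _} := ev m \o map_mpoly j.
  have e1 : ev_j (\sum_(l < p) t ^+ l *: H l ^+ p) = 0 by rewrite -eP /ev_j /= map_comp_F.
  rewrite -[RHS]e1 [RHS]rmorph_sum.
  apply: eq_bigr => x _; rewrite /ev_j /= map_mpolyZ mmapZ !rmorphXn /=.
  by congr (_ * _); rewrite !rmorphXn.
apply/polyP => s; rewrite coef0.
apply: (L_pindep (a := fun x => (ev m (map_mpoly j (H x)))`_s)) => [x|]; first exact: hu.
have := congr1 (fun Q : {poly E} => Q`_(p * s)) e0; rewrite coef0 coef_sum => e2.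
by rewrite -[RHS]e2; apply: eq_bigr => x _; rewrite coefCM coef_exprp.
Qed.

Lemma tuple_iter_homog m i : tnth (tuple_iter F m) i \is (D ^ m).-homog.
Proof.
elim: m i => [|m IH] i; rewrite tnth_mktuple; first by rewrite dhomogX /= mdeg1.
by rewrite expnS; apply: comp_homog.
Qed.

Lemma pihomog_comp_iter m d (P : {mpoly O[n]}) :
  pihomog mdeg (d * D ^ m) (P \mPo tuple_iter F m) = pihomog mdeg d P \mPo tuple_iter F m.
Proof.
have -> : P \mPo tuple_iter F m =
    \sum_(e < maxn (msize P) d.+1) (pihomog mdeg e P \mPo tuple_iter F m).
  rewrite {1}(pihomog_partitionE (mf := mdeg) (leq_maxl (msize P) d.+1)).
  exact: (raddf_sum (comp_mpoly (tuple_iter F m))).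
apply: (@pihomog_sum n O (fun d => d * D ^ m)%N (maxn (msize P) d.+1)
  (fun e => pihomog mdeg e P \mPo tuple_iter F m) d).
- by move=> a b /eqP; rewrite eqn_pmul2r ?expn_gt0 ?D0 // => /eqP.
- by move=> e; apply: comp_homog; [apply: tuple_iter_homog|apply: pihomogP].
- exact: leq_maxr.
Qed.

Lemma red_comp_iter m : exists s, forall P : {mpoly O[n]},
  map_mpoly red (P \mPo tuple_iter F (r * m)) = map_mpoly red P ^+ (p ^ s).
Proof.
elim: m => [|m [s IH]].
  by exists 0%N => P; rewrite muln0 expn0 expr1; congr map_mpoly; apply: comp_mpoly_id.
have [s' hs'] := redF; exists (s + s')%N => P.
by rewrite mulnS comp_tuple_iterD IH hs' -exprM -expnD addnC.
Qed.

Lemma vanishing_iter a m (P : {mpoly O[n]}) : vanishing a (map_mpoly j P) ->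
  vanishing (a + m) (map_mpoly j (P \mPo tuple_iter F m)).
Proof.
elim: m a P => [|m IH] a P hP.
  by rewrite addn0; have -> : P \mPo tuple_iter F 0 = P by apply: comp_mpoly_id.
rewrite comp_tuple_iterS addnS -addSn; apply: IH; rewrite map_comp_F.
exact: (vanishing_comp a _).1 hP.
Qed.

Definition reduced_ideal a := p_radical p (special_fiber j red (vanishing a)).

Lemma red_surj x : exists b, red b = x.
Proof. by exists (tau x); rewrite (dvr_tauK dvr). Qed.

Lemma special_vanishing_ideal a : ideal_like (special_fiber j red (vanishing a)).
Proof. exact: special_fiber_ideal red_surj _ (vanishing_ideal a). Qed.

Lemma reduced_ideal_ideal a : ideal_like (reduced_ideal a).
Proof. exact: (p_radical_ideal (dvr_pchark dvr) (special_vanishing_ideal a)). Qed.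

Lemma reduced_ideal_pihomog a d Q : reduced_ideal a Q -> reduced_ideal a (pihomog mdeg d Q).
Proof.
apply: (p_radical_pihomog (dvr_pchark dvr)) => e _ [H [hH <-]].
by exists (pihomog mdeg e H); rewrite !map_pihomog; split=> //; apply: vanishing_pihomog.
Qed.

(** One substitution of [F] turns [P] into [sum_l t^l H_l^p] with every [H_l] in the next ideal, and
    the [p]-th powers multiply the number of controlled digits by [p]. *)
Lemma vanishing_expansion a m (P : {mpoly O[n]}) : vanishing a (map_mpoly j P) ->
  expansion_in tau t (reduced_ideal (a + m)) (p ^ m) (P \mPo tuple_iter F m).
Proof.
have [[tauK ker] ht] := (dvr_tauK dvr, dvr_ker dvr, dvr_t dvr).
elim: m a P => [|m IH] a P hP.
  rewrite expn0 addn0; have -> : P \mPo tuple_iter F 0 = P by apply: comp_mpoly_id.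
  by apply: (expansion_in1 tauK ker); exists 0%N; rewrite expn0 expr1; exists P.
have [H hH] := pth_power_decomposition (dvr_pcharO dvr) (dvr_pbasis dvr) (P \mPo G).
have {}hH : P \mPo F = \sum_(l < p) t ^+ l *: H l ^+ p.
  rewrite -hH comp_mpolyA; congr (P \mPo _); apply: eq_from_tnth => i.
  by rewrite tnth_mktuple.
rewrite comp_tuple_iterS hH rmorph_sum expnS addnS -addSn.
have hZ := reduced_ideal_ideal (a.+1 + m).
apply: (expansion_in_sum hZ) => l /=; rewrite comp_mpolyZ rmorphXn /= -mul_mpolyC.
apply: (expansion_inMl tauK ker hZ); apply: (expansion_inXp tauK ker (dvr_pcharO dvr) hZ).
by apply: IH; apply: vanishing_descent hP hH l.
Qed.

(** Composition with [F^r] moves a form from one ideal to the next and only raises its reduction to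
    the power [p^s]. *)
Lemma reduced_ideal_step a Q : reduced_ideal (r * a) Q -> reduced_ideal (r * a.+1) Q.
Proof.
move=> [i [H [hH redH]]]; have [s hs] := redF.
exists (i + s)%N, (H \mPo tuple_iter F r); rewrite hs redH -exprM -expnD; split=> //.
by rewrite mulnS addnC; apply: vanishing_iter.
Qed.

Lemma mpoly_denominator (P : {mpoly K[n]}) :
  exists e (P' : {mpoly O[n]}), j t ^+ e *: P = map_mpoly j P'.
Proof.
pose A (P : {mpoly K[n]}) := exists e (P' : {mpoly O[n]}), j t ^+ e *: P = map_mpoly j P'.
rewrite [P]mpolyE; apply: (big_ind A).
- by exists 0%N, 0; rewrite scaler0 rmorph0.
- move=> P1 P2 [e1 [P1' h1]] [e2 [P2' h2]].
  exists (e1 + e2)%N, (t ^+ e2 *: P1' + t ^+ e1 *: P2').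
  rewrite rmorphD /= !map_mpolyZ -h1 -h2 !rmorphXn !scalerA -!exprD scalerDr.
  by rewrite [(e2 + e1)%N]addnC.
- move=> m _; have [e [b hb]] := dvr_denominator dvr P@_m.
  by exists e, (b *: 'X_[m]); rewrite map_mpolyZ map_mpolyX scalerA hb.
Qed.

Section Limit.
Variable Z : {mpoly k[n]} -> Prop.
Hypothesis hZ : ideal_like Z.
Hypothesis homZ : forall d Q, Z Q -> Z (pihomog mdeg d Q).

(* The equations of the [F^r]-periodic lift of the subvariety defined by [Z]. *)
Definition lifted_ideal (P : {mpoly K[n]}) := exists e (P' : {mpoly O[n]}),
  j t ^+ e *: P = map_mpoly j P' /\
  forall M, exists m0, forall m, (m0 <= m)%N ->
    expansion_in tau t Z M (P' \mPo tuple_iter F (r * m)).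

Lemma lifted_ideal_ideal : ideal_like lifted_ideal.
Proof.
have [[tauK ker] ht] := (dvr_tauK dvr, dvr_ker dvr, dvr_t dvr).
split=> [|P1 P2 [e1 [P1' [h1 H1]]] [e2 [P2' [h2 H2]]]|A P [e [P' [h H]]]].
- exists 0%N, 0; rewrite scaler0 rmorph0; split=> // M; exists 0%N => m _.
  by rewrite rmorph0; apply: expansion_in0.
- exists (e1 + e2)%N, (t ^+ e2 *: P1' + t ^+ e1 *: P2'); split.
    rewrite rmorphD /= !map_mpolyZ -h1 -h2 !rmorphXn !scalerA -!exprD scalerDr.
    by rewrite [(e2 + e1)%N]addnC.
  move=> M; have [m1 hm1] := H1 M; have [m2 hm2] := H2 M.
  exists (maxn m1 m2) => m; rewrite geq_max => /andP[/hm1 x1 /hm2 x2].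
  rewrite rmorphD /= !comp_mpolyZ -!mul_mpolyC.
  by apply: expansion_inD => //; apply: (expansion_inMl tauK ker hZ).
- have [e' [A' hA']] := mpoly_denominator A; exists (e' + e)%N, (A' * P'); split.
    by rewrite rmorphM /= -hA' -h -scalerAl -scalerAr scalerA exprD.
  move=> M; have [m0 hm0] := H M; exists m0 => m /hm0 x.
  by rewrite rmorphM; apply: (expansion_inMl tauK ker hZ).
Qed.

Lemma lifted_ideal_pihomog d P : lifted_ideal P -> lifted_ideal (pihomog mdeg d P).
Proof.
move=> [e [P' [h H]]]; exists e, (pihomog mdeg d P'); split.
  by rewrite map_pihomog -h; apply/esym/linearZ.
move=> M; have [m0 hm0] := H M; exists m0 => m /hm0 x.
by rewrite -pihomog_comp_iter; apply: expansion_in_pihomog x => Q; apply: homZ.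
Qed.

Lemma lifted_ideal_red Q : (forall i Q, Z (Q ^+ (p ^ i)) -> Z Q) ->
  special_fiber j red lifted_ideal Q -> Z Q.
Proof.
have [[tauK ker] ht] := (dvr_tauK dvr, dvr_ker dvr, dvr_t dvr).
move=> radZ [H [[e [P' [h hP']]] <-]].
have {h} eP' : P' = t ^+ e *: H.
  apply/mpolyP => m; apply: (dvr_inj dvr).
  have /mpolyP/(_ m) := h; rewrite mcoeffZ !mcoeff_map_mpoly /= => <-.
  by rewrite mcoeffZ rmorphM rmorphXn.
(* Precision [e + 1] leaves one digit after division by [t^e]: the reduction of [H o F^(r m0)],
   which is a [p]-power of the reduction of [H]. *)
have [m0 /(_ m0 (leqnn _))] := hP' (e + 1)%N; rewrite eP' comp_mpolyZ.
move/(expansion_in_tX_inv tauK ht (dvr_reg dvr)) => /(expansion_in_red tauK ht).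
by have [s ->] := red_comp_iter m0; apply: radZ.
Qed.

End Limit.

(** The increasing chain of reduced ideals stops at some [Z]. From there on every
    [vanishing (r * a)] lies in [lifted_ideal Z], which does not depend on [a], and
    [special_fiber_rigidity] turns the inclusion into an equality. *)
Lemma vanishing_eventually_constant : exists a0, forall a, (a0 <= a)%N ->
  forall P, vanishing (r * a) P <-> vanishing (r * a0) P.
Proof.
have hp := dvr_pchark dvr.
have mono a b Q : (a <= b)%N -> reduced_ideal (r * a) Q -> reduced_ideal (r * b) Q.
  by move/subnK=> <-; elim: (b - a)%N => // i IH /IH; apply: reduced_ideal_step.
have [a0 ha0] := mpoly_ideal_chain (fun a => reduced_ideal_ideal (r * a)) reduced_ideal_step.
pose Z := reduced_ideal (r * a0); have hZ : ideal_like Z := reduced_ideal_ideal _.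
have homZ d Q : Z Q -> Z (pihomog mdeg d Q) by apply: reduced_ideal_pihomog.
suff main a : (a0 <= a)%N -> forall P, vanishing (r * a) P <-> lifted_ideal Z P.
  exists a0 => a ha P; have h1 := main a ha P; have h2 := main a0 (leqnn a0) P.
  by split=> h; [apply/h2/h1|apply/h1/h2].
move=> ha P.
have sub Q : vanishing (r * a) Q -> lifted_ideal Z Q.
  move=> hQ; have [e [Q' hQ']] := mpoly_denominator Q; exists e, Q'; split=> // M.
  exists M => m hm.
  have : vanishing (r * a) (map_mpoly j Q')
    by rewrite -hQ'; apply: (ideal_scale (vanishing_ideal _)).
  move/(@vanishing_expansion _ (r * m)); rewrite -mulnDr.
  have : (M <= p ^ (r * m))%N.
    apply: leq_trans hm (leq_trans (leq_pmull m r0) (ltnW (ltn_expl _ _))).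
    exact/prime_gt1/(pcharf_prime hp).
  move=> hM /(expansion_in_le hM).
  have : forall Q, reduced_ideal (r * (a + m)) Q <-> Z Q.
    by move=> Q0; split=> [/ha0//|]; apply: mono; apply: leq_trans ha (leq_addr _ _).
  by move=> /(fun h => funext (fun Q => propext (h Q))) ->.
split; first exact: sub.
have [i0 hi0] := vanishingX (r * a).
(* A single exponent [p^s] brings the whole radical back into the special fiber, as the hypothesis
   [power] of the rigidity lemma requires. *)
have [s hs] := p_radical_uniform hp (special_vanishing_ideal (r * a)).
apply: (@special_fiber_rigidity K k O j red t n (dvr_inj dvr) red_surj (dvr_ker dvr)
  (dvr_t dvr) (dvr_primitive dvr) _ _ (vanishing_ideal _) (lifted_ideal_ideal hZ)
  (@vanishing_pihomog _) (lifted_ideal_pihomog homZ) (@vanishing_prime _)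
  (@vanishing1 _) i0 hi0 sub p s hp).
- elim: s {hs} => [|s IH] x; first by exists x; rewrite expn0 expr1.
  have [z <-] := IH x; have [w <-] := dvr_perfect dvr z.
  by exists w; rewrite expnS exprM.
- move=> Q hQ; apply: hs; apply: (mono a0) => //.
  by apply: lifted_ideal_red hQ => i R; apply: p_radicalX.
Qed.

End VanishingIdeals.

(** * Local fields of positive characteristic *)

(** Every orbit is a cycle of length at most [size s], and the factorial is a multiple of all these
    lengths. *)
Lemma injective_iter_id (T : choiceType) (s : seq T) (f : T -> T) :
  (forall x, x \in s) -> injective f ->
  exists2 r, (0 < r)%N & forall x, iter r f x = x.
Proof.
move=> sT inj; exists (size s)`!; first exact: fact_gt0.
have fiter m x y : iter m f x = iter m f y -> x = y.
  by elim: m => //= m IH /inj.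
move=> x; have : ~~ uniq (traject f x (size s).+1).
  apply/negP => /uniq_leq_size /(_ (fun y _ => sT y)).
  by rewrite size_traject ltnn.
case/(uniqPn x) => a [b [ab]]; rewrite size_traject => bs.
rewrite !nth_traject //; last exact: ltn_trans bs.
rewrite -(subnK (ltnW ab)) addnC iterD => /fiter /esym e.
have /dvdnP[q ->] : (b - a %| (size s)`!)%N.
  by apply: dvdn_fact; rewrite subn_gt0 ab /= (leq_trans (leq_subr _ _)).
by elim: q => // q IH; rewrite mulSn iterD IH.
Qed.

(** The nonzero terms have valuations distinct modulo [p]. Concretely, the [a l] are scaled to
    integral elements with some nonzero reduction, and their reductions are shown to vanish one
    after the other by comparison modulo [t^(m+1)]. *)
Lemma pth_powers_independent (K k : fieldType) (O : comNzRingType)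
    (j : {rmorphism O -> K}) (red : {rmorphism O -> k}) (tau : {rmorphism k -> O})
    (t : O) (p : nat) (a : 'I_p -> K) :
  equal_char_dvr j red tau t p ->
  \sum_(l < p) j t ^+ l * a l ^+ p = 0 -> forall l, a l = 0.
Proof.
move=> dvr e0 l0; apply/eqP; apply: contraT => al0.
have [s [b [s0 hb [l1 /eqP[]]]]] := dvr_primitive dvr (ex_intro (fun l => a l != 0) l0 al0).
have {}e0 : \sum_(l < p) t ^+ l * b l ^+ p = 0.
  apply: (dvr_inj dvr); rewrite rmorph0 rmorph_sum /= -[RHS](mulr0 (s ^+ p)) -[in RHS]e0.
  rewrite mulr_sumr; apply: eq_bigr => l _.
  by rewrite rmorphM !rmorphXn /= -hb exprMn mulrCA.
have treg i x : t ^+ i * x = 0 -> x = 0.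
  by elim: i x => [|i IH] x; rewrite ?expr0 ?mul1r // exprSr -mulrA => /IH/(dvr_reg dvr).
suff H m : (m <= p)%N -> forall l : 'I_p, (l < m)%N -> red (b l) = 0.
  exact: (H p).
elim: m => // m IH mp l; rewrite ltnS leq_eqVlt => /predU1P[lm|]; last first.
  by apply: IH; apply: ltnW.
have /choice[d hd] : forall i : 'I_p, exists d, (i != l) -> t ^+ i * b i ^+ p = t ^+ m.+1 * d.
  move=> i; have [im|mi] := ltnP i m.
    have [d hd] := dvr_ker dvr (IH (ltnW mp) i im).
    exists (t ^+ (i + p - m.+1) * d ^+ p) => _; rewrite hd exprMn !mulrA -!exprD.
    by rewrite subnKC // (leq_trans mp) ?leq_addl.
  exists (t ^+ (i - m.+1) * b i ^+ p) => il; rewrite mulrA -exprD subnKC //.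
  by rewrite ltn_neqAle mi andbT -lm eq_sym.
move: e0; rewrite (bigD1 l) //= (eq_bigr (fun i => t ^+ m.+1 * d i)) => [|i /hd//].
rewrite -mulr_sumr exprSr lm -mulrA -mulrDr => /treg /(congr1 red).
rewrite rmorphD rmorphM (dvr_t dvr) mul0r addr0 rmorphXn rmorph0 => /eqP.
by rewrite expf_eq0 => /andP[_ /eqP].
Qed.

Section ResidueField.
Variables (K : fieldType) (v : discrete_valuation K).
Local Notation O := (valring v).
Local Notation k := (residue_field v).
Local Notation red := (reduction (v := v)).

Lemma reduction_eq0P (x : O) : red x = 0 <-> (val x = 0 \/ 0 < v (val x)).
Proof.
have e : red x = 0 <-> x \in maxideal (v := v).
  have := Quotient.idealrBE (maxideal (v := v)) x 0.
  rewrite subr0 => ->; split=> [h|/eqP h].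
    by apply/eqP; apply: etrans h (esym (rmorph0 red)).
  exact: etrans h (rmorph0 red).
rewrite e unfold_in /maxideal; split; first by case/orP=> [/eqP|]; [left|right].
by case=> [->|->]; rewrite ?eqxx ?orbT.
Qed.

Lemma valring_ge0 (x : O) : val x != 0 -> 0 <= v (val x).
Proof. by have := valP x; rewrite unfold_in /valring_pred; case/orP=> [/eqP->|//]; rewrite eqxx. Qed.

Lemma val_valring_eq0 (x : O) : (val x == 0) = (x == 0).
Proof. by rewrite -(inj_eq val_inj) rmorph0. Qed.

Lemma valring_lift (x : K) : x = 0 \/ 0 <= v x -> exists y : O, val y = x.
Proof.
move=> h; have hx : x \in valring_pred v.
  by rewrite unfold_in /valring_pred; case: h => [->|->]; rewrite ?eqxx ?orbT.
by exists (exist _ x hx).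
Qed.

Definition residue_inv (x : k) : k :=
  if x == 0 then 0 else red (repr x)^-1.

Lemma reduction_repr (x : k) : red (repr x) = x.
Proof. exact: reprK. Qed.

Lemma residue_mulVf (x : k) : x != 0 -> residue_inv x * x = 1.
Proof.
move=> x0; rewrite /residue_inv (negPf x0) -{2}(reduction_repr x) -rmorphM.
suff u : repr x \is a GRing.unit by rewrite mulVr // rmorph1.
have h : ~ (val (repr x) = 0 \/ 0 < v (val (repr x))).
  by move/reduction_eq0P; rewrite reduction_repr => /eqP; rewrite (negPf x0).
have y0 : val (repr x) != 0 by apply/eqP => e; apply: h; left.
change (valring_unit (repr x)); rewrite /valring_unit y0 /=.
have := valring_ge0 y0; rewrite le_eqVlt => /predU1P[<- //|lt].
by case: h; right.
Qed.

Lemma residue_inv0 : residue_inv 0 = 0.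
Proof. by rewrite /residue_inv eqxx. Qed.

HB.instance Definition _ :=
  GRing.ComNzRing_isField.Build k residue_mulVf residue_inv0.

End ResidueField.

Section Uniformizer.
Variables (K : fieldType) (v : discrete_valuation K).
Local Notation O := (valring v).
Local Notation k := (residue_field v).
Local Notation red := (reduction (v := v)).
Variable t : O.
Hypothesis t_neq0 : val t != 0.
Hypothesis vt : v (val t) = 1.

Definition tdvd i (x : O) := exists y, x = t ^+ i * y.

Lemma dval_tX i : v (val t ^+ i) = i%:Z.
Proof.
elim: i => [|i IH]; first by rewrite expr0 dval1.
by rewrite exprS dvalM ?expf_neq0 // IH vt -intS.
Qed.

Lemma tdvdP i (x : O) : tdvd i x <-> (val x = 0 \/ i%:Z <= v (val x)).
Proof.
have ti0 : val t ^+ i != 0 by rewrite expf_neq0.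
split=> [[y ->]|h].
  rewrite rmorphM rmorphXn /=; have [->|y0] := eqVneq (val y) 0; first by rewrite mulr0; left.
  by right; rewrite dvalM // dval_tX lerDl valring_ge0.
have [|y hy] := @valring_lift K v (val x / val t ^+ i).
  have [->|x0] := eqVneq (val x) 0; first by rewrite mul0r; left.
  right; case: h => [/eqP|h]; first by rewrite (negPf x0).
  by rewrite dvalM ?invr_eq0 // dvalV // dval_tX subr_ge0.
by exists y; apply: val_inj; rewrite rmorphM rmorphXn /= hy mulrC divfK.
Qed.

Lemma tdvd_ideal i : ideal_like (tdvd i).
Proof.
split=> [|x y [a ->] [b ->]|a x [b ->]]; first by exists 0; rewrite mulr0.
- by exists (a + b); rewrite mulrDr.
- by exists (a * b); rewrite mulrCA.
Qed.

Lemma tdvd_le i l x : (i <= l)%N -> tdvd l x -> tdvd i x.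
Proof.
by move=> il [y ->]; exists (t ^+ (l - i) * y); rewrite mulrA -exprD subnKC.
Qed.

Lemma tdvd_separated (x : O) : (forall i, tdvd i x) -> x = 0.
Proof.
move=> h; apply/eqP; rewrite -val_valring_eq0; apply: contraT => x0.
have /tdvdP[/eqP|] := h `|v (val x)|.+1; first by rewrite (negPf x0).
rewrite intS gez0_abs ?valring_ge0 // => /le_lt_trans/(_ (ltr_pwDl ltr01 (lexx _))).
by rewrite ltxx.
Qed.

(** The limit exists in [K] by completeness, and it is integral because it differs from a term of
    the sequence by an integral element. *)
Lemma tadic_limit (u : nat -> O) : complete_valuation v ->
  (forall i, tdvd i (u i.+1 - u i)) -> exists l, forall i, tdvd i (l - u i).
Proof.
move=> compl hu.
have hul i l : (i <= l)%N -> tdvd i (u l - u i).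
  move/subnK=> <-; elim: (l - i)%N => [|m IH].
    by rewrite subrr; apply: ideal0 (tdvd_ideal i).
  rewrite addSn -(subrK (u (m + i)%N) (u _.+1)) -addrA; apply: idealD => //.
    exact: tdvd_ideal.
  by apply: tdvd_le (hu _); apply: leq_addl.
have [|l hl] := compl (fun i => val (u i)).
  move=> z; exists `|z|%N => a b ha hb.
  have /tdvdP : tdvd `|z| (u a - u b).
    rewrite -(subrK (u `|z|%N) (u a)) -addrA; apply: idealD; [exact: tdvd_ideal|exact: hul|].
    by rewrite -opprB; apply: idealN; [exact: tdvd_ideal|exact: hul].
  rewrite /close_to rmorphB /=; case=> [->|h]; [by left|right].
  by apply: le_trans h; rewrite abszE ler_norm.
have [M hM] := hl 0; have [|l' hl'] := @valring_lift K v l.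
  have hd : l - val (u M) = 0 \/ 0 <= v (l - val (u M)).
    case: (hM M (leqnn _)) => [e|h]; first by left; rewrite -opprB e oppr0.
    have [e|ne] := eqVneq (l - val (u M)) 0; [by left|right].
    by rewrite -(dvalN v ne) opprB.
  have [w hw] := valring_lift hd; have := valP (w + u M).
  rewrite rmorphD /= hw subrK unfold_in /valring_pred => /orP[/eqP|]; [by left|by right].
exists l' => i; have [M' hM'] := hl i%:Z.
set m := maxn M' i.
rewrite -(subrK (u m) l') -addrA; apply: idealD; first exact: tdvd_ideal.
  rewrite -opprB; apply: idealN; first exact: tdvd_ideal.
  apply/tdvdP; rewrite rmorphB /= hl'; exact/hM'/leq_maxl.
exact/hul/leq_maxr.
Qed.

Lemma reduction_ker (x : O) : red x = 0 <-> tdvd 1 x.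
Proof.
by rewrite tdvdP reduction_eq0P gtz0_ge1.
Qed.

Lemma valring_primitive r (c : 'I_r -> K) : (exists i, c i != 0) ->
  exists s (b : 'I_r -> O),
    [/\ s != 0, forall i, s * c i = val (b i) & exists i, red (b i) != 0].
Proof.
case=> i0 ci0; case: (@arg_minP _ _ _ i0 (fun i => c i != 0) (fun i => v (c i)) ci0).
move=> i ci min.
have /choice[b hb] l : exists b : O, val b = (c i)^-1 * c l.
  apply: valring_lift; have [->|cl] := eqVneq (c l) 0; first by left; rewrite mulr0.
  by right; rewrite dvalM ?invr_eq0 // dvalV // addrC subr_ge0 min.
exists (c i)^-1, b; split; rewrite ?invr_eq0 //; exists i.
apply/eqP => /reduction_eq0P; rewrite hb mulVf //.
by case=> [/eqP|]; rewrite ?oner_eq0 // dval1 ltxx.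
Qed.

Lemma valring_denominator (x : K) : exists e (b : O), val t ^+ e * x = val b.
Proof.
have [->|x0] := eqVneq x 0; first by exists 0%N, 0; rewrite mulr0 rmorph0.
exists `|v x|%N; have [|b hb] := @valring_lift K v (val t ^+ `|v x| * x); last by exists b.
right; rewrite dvalM ?expf_neq0 // dval_tX abszE -lerBlDr sub0r.
by rewrite (le_trans (ler_norm _)) // normrN.
Qed.

End Uniformizer.

Section LocalField.
Variables (K : fieldType) (v : discrete_valuation K).
Local Notation O := (valring v).
Local Notation k := (residue_field v).
Local Notation red := (reduction (v := v)).
Hypothesis compl : complete_valuation v.
Variables (s : seq k) (p : nat).
Hypothesis hs : forall a, a \in s.
Hypothesis hp : p \in [pchar k].
Hypothesis hpO : p \in [pchar O].
Variable t : O.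
Hypothesis t_neq0 : val t != 0.
Hypothesis vt : v (val t) = 1.

Let td i := tdvd_ideal t i.
Local Notation tdvd := (tdvd t).

Lemma residue_frobenius_order : exists2 nu, (0 < nu)%N & forall x : k, x ^+ (p ^ nu) = x.
Proof.
have inj : injective (fun x : k => x ^+ p).
  move=> x y /= e; apply/eqP; rewrite -subr_eq0.
  have := exprD_pchar 1 (x - y) y hp; rewrite subrK expn1 e => /eqP.
  by rewrite -subr_eq subrr eq_sym expf_eq0 => /andP[].
have [nu nu0 h] := injective_iter_id hs inj; exists nu => // x.
rewrite -[RHS]h; elim: {nu0 h} nu x => [|nu IH] x; first by rewrite expn0 expr1.
by rewrite iterSr -IH -exprM -expnS.
Qed.

Lemma tdvd_pth i m (x y : O) : tdvd i (x - y) -> tdvd (i * p ^ m) (x ^+ (p ^ m) - y ^+ (p ^ m)).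
Proof.
move=> [d hd]; exists (d ^+ (p ^ m)).
have := exprD_pchar m (x - y) y hpO; rewrite subrK => ->.
by rewrite addrK hd exprMn -exprM.
Qed.

(** The lift is the limit of [a^(q^i)] for a representative [a]: since [a^q = a] modulo [t],
    consecutive terms agree modulo [t^(q^i)]. *)
Lemma teichmuller_lift (x : k) nu : (0 < nu)%N -> (forall x : k, x ^+ (p ^ nu) = x) ->
  exists y : O, red y = x /\ y ^+ (p ^ nu) = y.
Proof.
move=> nu0 hnu; set q := (p ^ nu)%N.
have p1 : (1 < p)%N := prime_gt1 (pcharf_prime hp).
have q1 : (1 < q)%N by rewrite -(expn0 p) ltn_exp2l.
pose a := repr x; have ra : red a = x := reduction_repr x.
pose u i := a ^+ (q ^ i).
have hu i : tdvd i (u i.+1 - u i).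
  have d1 : tdvd 1 (a ^+ q - a).
    by apply/(reduction_ker t_neq0 vt); rewrite rmorphB rmorphXn /= ra hnu subrr.
  have := tdvd_pth (nu * i) d1; rewrite mul1n expnM -!exprM -expnS.
  apply: tdvd_le; exact/ltnW/ltn_expl.
have [l hl] := tadic_limit t_neq0 vt compl hu.
have rl : red l = x.
  have /(reduction_ker t_neq0 vt) := hl 1%N.
  by rewrite rmorphB rmorphXn /= ra hnu => /eqP; rewrite subr_eq0 => /eqP.
exists l; split=> //; apply/eqP; rewrite -subr_eq0; apply/eqP.
apply: (tdvd_separated t_neq0 vt) => i.
rewrite -(subrK (u i.+1) (l ^+ q)) -addrA; apply: idealD; first exact: td.
  have := tdvd_pth nu (hl i); rewrite -exprM -expnSr.
  by apply: tdvd_le; rewrite leq_pmulr // (ltn_trans _ q1).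
rewrite -opprB; apply: idealN; first exact: td.
exact: tdvd_le (leqnSn i) (hl i.+1).
Qed.

(** The difference [x - y] equals its own [p^(nu m)]-th power for every [m]; being divisible by [t],
    it is divisible by all powers of [t]. *)
Lemma teichmuller_unique nu (x y : O) : (0 < nu)%N ->
  x ^+ (p ^ nu) = x -> y ^+ (p ^ nu) = y -> red x = red y -> x = y.
Proof.
move=> nu0 hx hy e; apply/eqP; rewrite -subr_eq0; apply/eqP.
have p1 : (1 < p)%N := prime_gt1 (pcharf_prime hp).
apply: (tdvd_separated t_neq0 vt) => i.
have d1 : tdvd 1 (x - y).
  by apply/(reduction_ker t_neq0 vt); rewrite rmorphB /= e subrr.
have hX m z : z ^+ (p ^ nu) = z -> z ^+ (p ^ (nu * m)) = z.
  move=> hz; elim: m => [|m IH]; first by rewrite muln0 expn0 expr1.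
  by rewrite mulnS expnD exprM hz.
have := tdvd_pth (nu * i) d1; rewrite mul1n !hX //; apply: tdvd_le.
by apply: leq_trans (ltnW (ltn_expl i p1)) _; rewrite leq_pexp2l ?leq_pmull // ltnW.
Qed.

(** In characteristic [p] the elements fixed by [x |-> x^(p^nu)] form a subring, so uniqueness makes
    the lift additive as well as multiplicative. *)
Lemma teichmuller_morphism : exists tau : {rmorphism k -> O}, cancel tau red.
Proof.
have [nu nu0 hnu] := residue_frobenius_order.
have /choice[f hf] := fun x => teichmuller_lift x nu0 hnu.
have fE x y : y ^+ (p ^ nu) = y -> red y = x -> f x = y.
  have [h1 h2] := hf x => h3 h4.
  by apply: (teichmuller_unique nu0) => //; rewrite h1 h4.
have hpn := pX_gt0 hp nu.
have fB : zmod_morphism f.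
  move=> x y; have [x1 x2] := hf x; have [y1 y2] := hf y; apply: fE.
    have := exprD_pchar nu (f x - f y) (f y) hpO; rewrite subrK x2 y2 => /eqP.
    by rewrite -subr_eq => /eqP.
  by rewrite rmorphB /= x1 y1.
have fM : monoid_morphism f.
  split=> [|x y]; first by apply: fE; rewrite ?expr1n ?rmorph1.
  have [x1 x2] := hf x; have [y1 y2] := hf y.
  by apply: fE; rewrite ?exprMn ?x2 ?y2 // rmorphM /= x1 y1.
pose fA := GRing.isZmodMorphism.Build k O f fB.
pose fMM := GRing.isMonoidMorphism.Build k O f fM.
exists (HB.pack f fA fMM : {rmorphism k -> O}) => x /=.
by have [] := hf x.
Qed.

(** Extracting [p]-th roots of residues successively gives [a = sum_i t^i d_i^p]. With
    [i = p q + l], the terms of a given [l] add up to [t^l (sum_q t^q d_(pq+l))^p]. *)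
Lemma valring_pbasis (a : O) : exists b : 'I_p -> O, a = \sum_(l < p) t ^+ l * b l ^+ p.
Proof.
have p0 : (0 < p)%N := prime_gt0 (pcharf_prime hp).
have [nu nu0 hnu] := residue_frobenius_order.
have /choice[g hg] : forall c : O, exists d : O * O, c = d.1 ^+ p + t * d.2.
  move=> c; pose x := (red c) ^+ (p ^ nu.-1).
  have : tdvd 1 (c - repr x ^+ p).
    apply/(reduction_ker t_neq0 vt); rewrite rmorphB rmorphXn /= reduction_repr.
    by rewrite -exprM -expnSr prednK // hnu subrr.
  by case=> y hy; exists (repr x, y) => /=; rewrite -(expr1 t) -hy addrC subrK.
pose c i := iter i (fun c => (g c).2) a; pose d i := (g (c i)).1.
have cS i : c i = d i ^+ p + t * c i.+1 by apply: hg.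
have cD i m : c i = \sum_(l < m) t ^+ l * d (i + l)%N ^+ p + t ^+ m * c (i + m)%N.
  elim: m => [|m IH]; first by rewrite big_ord0 add0r mul1r addn0.
  by rewrite big_ord_recr /= {1}IH cS mulrDr addnS exprSr mulrA addrA.
pose b l m := \sum_(q < m) t ^+ q * d (p * q + l)%N.
have bS (l : 'I_p) i : b l i.+1 = b l i + t ^+ i * d (p * i + l)%N.
  by rewrite /b big_ord_recr.
have /choice[B hB] : forall l : 'I_p, exists y, forall i, tdvd i (y - b l i).
  move=> l; apply: (tadic_limit t_neq0 vt compl) => i.
  rewrite bS [X in X - _]addrC addrK; exists (d (p * i + l)%N) => //.
exists B; apply/eqP; rewrite -subr_eq0; apply/eqP.
apply: (tdvd_separated t_neq0 vt) => i.
have part : a - \sum_(l < p) t ^+ l * b l i ^+ p = t ^+ (p * i) * c (p * i)%N.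
  elim: i => [|i IH].
    rewrite muln0 mul1r big1 ?subr0 // => l _.
    by rewrite /b big_ord0 expr0n gtn_eqF // mulr0.
  have -> : \sum_(l < p) t ^+ l * b l i.+1 ^+ p = \sum_(l < p) t ^+ l * b l i ^+ p
      + t ^+ (p * i) * \sum_(l < p) t ^+ l * d (p * i + l)%N ^+ p.
    rewrite mulr_sumr -big_split; apply: eq_bigr => l _ /=.
    rewrite bS; have := exprD_pchar 1 (b l i) (t ^+ i * d (p * i + l)%N) hpO.
    rewrite expn1 => ->; rewrite mulrDr; congr (_ + _).
    by rewrite exprMn -exprM [(i * p)%N]mulnC mulrCA.
  rewrite opprD addrA IH (cD (p * i)%N p) mulrDr addrAC subrr add0r mulrA -exprD.
  by rewrite mulnS addnC.
rewrite -(subrK (\sum_(l < p) t ^+ l * b l i ^+ p) a) -addrA; apply: idealD.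
- exact: td.
- rewrite part; apply: tdvd_le (_ : tdvd (p * i) _); first by rewrite leq_pmull.
  by exists (c (p * i)%N).
rewrite -sumrB; apply: ideal_sum; first exact: td.
move=> l _; rewrite -mulrBr; apply: idealMl; first exact: td.
rewrite -opprB; apply: idealN; first exact: td.
have := tdvd_pth 1 (hB l i); rewrite expn1.
by apply: tdvd_le; rewrite leq_pmulr.
Qed.

Lemma valring_equal_char_dvr (tau : {rmorphism k -> O}) : cancel tau red ->
  equal_char_dvr (val : O -> K) red tau t p.
Proof.
move=> tauK; split=> //.
- exact: val_inj.
- by move=> x /(reduction_ker t_neq0 vt).
- by apply/(reduction_ker t_neq0 vt); exists 1; rewrite mulr1.
- move=> x /(congr1 val); rewrite rmorphM rmorph0 => /eqP.
  by rewrite mulf_eq0 (negPf t_neq0) val_valring_eq0 => /eqP.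
- have [nu nu0 hnu] := residue_frobenius_order => x.
  by exists (x ^+ (p ^ nu.-1)); rewrite -exprM -expnSr prednK.
- exact: valring_primitive.
- exact: valring_denominator.
- exact: valring_pbasis.
Qed.

End LocalField.

(** * Forms with zero cotangent map *)

HB.instance Definition _ (R : nzRingType) (T : choiceType) (M : lmodType R)
    (f : T -> M) :=
  GRing.isZmodMorphism.Build {freeg T / R} M (fglift f) (lift_is_additive f).

Lemma fglift_scale (R : nzRingType) (T : choiceType) (M : lmodType R) (f : T -> M)
    (c : R) (D : {freeg T / R}) : fglift f (c *: D) = c *: fglift f D.
Proof.
rewrite -[D in RHS]freeg_sumE -[c *: D]/(fgscale c D) /fgscale.
rewrite !raddf_sum; apply: eq_bigr => x _ /=.
by rewrite !liftU scalerA.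
Qed.

Section QuotientRuleIdentities.
Variables (F : fieldType) (a b da db a' b' da' db' : F).
Hypotheses (b0 : b != 0) (b'0 : b' != 0).

Lemma quotient_rule_add :
  ((da * b' + a * db' + (da' * b + a' * db)) * (b * b') -
    (a * b' + a' * b) * (db * b' + b * db')) / (b * b') ^+ 2 =
  (da * b - a * db) / b ^+ 2 + (da' * b' - a' * db') / b' ^+ 2.
Proof. by field; rewrite b0 b'0. Qed.

Lemma quotient_rule_mul :
  ((da * a' + a * da') * (b * b') - a * a' * (db * b' + b * db')) / (b * b') ^+ 2 =
  a / b * ((da' * b' - a' * db') / b' ^+ 2) + a' / b' * ((da * b - a * db) / b ^+ 2).
Proof. by field; rewrite b0 b'0. Qed.

Lemma add_fractions : (a * b' + a' * b) / (b * b') = a / b + a' / b'.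
Proof. by field; rewrite b0 b'0. Qed.

Lemma mul_fractions : a * a' / (b * b') = a / b * (a' / b').
Proof. by field; rewrite b0 b'0. Qed.

End QuotientRuleIdentities.

Section FractionDerivation.
Variables (R : idomainType) (d : R -> R).
Hypothesis dD : forall a b, d (a + b) = d a + d b.
Hypothesis dM : forall a b, d (a * b) = d a * b + a * d b.

Definition quotient_rule (a b : R) : {fraction R} :=
  (d a * b - a * d b)%:F / b%:F ^+ 2.

Lemma quotient_rule_eq a b a' b' : b != 0 -> b' != 0 ->
  a%:F / b%:F = a'%:F / b'%:F -> quotient_rule a b = quotient_rule a' b'.
Proof.
move=> b0 b'0; have [B0 B'0] : b%:F != 0 /\ b'%:F != 0 by rewrite !tofrac_eq0.
move/eqP; rewrite eqr_div // -!tofracM tofrac_eq => /eqP e1.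
have e2 : d a * b' + a * d b' = d a' * b + a' * d b by rewrite -!dM e1.
apply/eqP; rewrite eqr_div ?expf_neq0 // -!tofracXn -!tofracM tofrac_eq -subr_eq0.
(* The difference of the cross products is a combination of the equation [a b' = a' b] and its
   derivative. *)
apply/eqP; transitivity (b * b' * ((d a * b' + a * d b') - (d a' * b + a' * d b)) -
  (b' * d b + b * d b') * (a * b' - a' * b)); first by ring.
by rewrite e1 e2 !subrr !mulr0 subrr.
Qed.

Lemma quotient_ruleD a b a' b' : b != 0 -> b' != 0 ->
  quotient_rule (a * b' + a' * b) (b * b') = quotient_rule a b + quotient_rule a' b'.
Proof.
move=> b0 b'0; have [B0 B'0] : b%:F != 0 /\ b'%:F != 0 by rewrite !tofrac_eq0.
rewrite /quotient_rule !(dD, dM) !(tofracB, tofracM, tofracD).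
exact: quotient_rule_add.
Qed.

Lemma quotient_ruleM a b a' b' : b != 0 -> b' != 0 ->
  quotient_rule (a * a') (b * b') =
  a%:F / b%:F * quotient_rule a' b' + a'%:F / b'%:F * quotient_rule a b.
Proof.
move=> b0 b'0; have [B0 B'0] : b%:F != 0 /\ b'%:F != 0 by rewrite !tofrac_eq0.
rewrite /quotient_rule !(dD, dM) !(tofracB, tofracM, tofracD).
exact: quotient_rule_mul.
Qed.

End FractionDerivation.

Section ChartDerivation.
Variables (A : idomainType) (n : nat) (g : {mpoly A[n]}) (e : nat).
Variable hg : g \is e.-homog.
Hypothesis g0 : g != 0.
Variable l : 'I_n.
Local Notation B := (hloc hg).

(* The fraction field as a module over [B], not over itself *)
Definition fraction_module (g : {mpoly A[n]}) (e : nat) (hg : g \is e.-homog) :=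
  {fraction {mpoly A[n]}}.

HB.instance Definition _ := GRing.Zmodule.on (fraction_module hg).

Definition fraction_scale (b : B) (u : fraction_module hg) : fraction_module hg :=
  val b * u.

Lemma fraction_scaleA b c w :
  fraction_scale b (fraction_scale c w) = fraction_scale (b * c) w.
Proof. by rewrite /fraction_scale mulrA. Qed.

Lemma fraction_scale1 : left_id 1 fraction_scale.
Proof. by move=> w; rewrite /fraction_scale rmorph1 mul1r. Qed.

Lemma fraction_scaleDr : right_distributive fraction_scale +%R.
Proof. by move=> b w w'; apply: mulrDr. Qed.

Lemma fraction_scaleDl w : {morph fraction_scale^~ w : b c / b + c}.
Proof. by move=> b c; rewrite /fraction_scale rmorphD; apply: mulrDl. Qed.

HB.instance Definition _ := GRing.Zmodule_isLmodule.Build B (fraction_module hg)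
  fraction_scaleA fraction_scale1 fraction_scaleDr fraction_scaleDl.

Lemma hloc_fraction (u : B) : exists ab : {mpoly A[n]} * {mpoly A[n]},
  ab.2 != 0 /\ val u = ab.1%:F / ab.2%:F.
Proof.
have := valP u; rewrite unfold_in => /asboolP[m [a [_ ->]]].
by exists (a, g ^+ m); rewrite expf_neq0 // tofracXn.
Qed.

(* The quotient rule makes the partial derivative d/dx_l a derivation of [B] into
   the fractions, hence it factors through the Kaehler differentials. *)
Lemma kahler_d_eq0 (u : B) (a b : {mpoly A[n]}) : b != 0 -> val u = a%:F / b%:F ->
  kahler_d (hloc_cst hg) u = 0 -> a^`M(l) * b = a * b^`M(l).
Proof.
move=> b0 uab du.
have /choice[fr hfr] := hloc_fraction.
pose D (x : B) : fraction_module hg := quotient_rule (mderiv l) (fr x).1 (fr x).2.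
have hD := mderivD (R := A) l; have hM := mderivM (R := A) l.
have DE (x : B) c d : d != 0 -> val x = c%:F / d%:F -> D x = quotient_rule (mderiv l) c d.
  by move=> d0 xcd; have [f0 f1] := hfr x; apply: quotient_rule_eq => //; rewrite -f1.
have frF (x : B) : (fr x).2%:F != 0 by have [f0 _] := hfr x; rewrite tofrac_eq0.
have rel0 w : kahler_rel (hloc_cst hg) w -> fglift D w = 0.
  elim=> [x y|x y|c||w1 w2 _ h1 _ h2|c w1 _ h1].
  - have [x0 x1] := hfr x; have [y0 y1] := hfr y.
    rewrite !raddfB /= !liftU !scale1r (DE (x + y) ((fr x).1 * (fr y).2 + (fr y).1 * (fr x).2)
      ((fr x).2 * (fr y).2)) ?mulf_neq0 //.
      by rewrite quotient_ruleD // -addrA -opprD; apply: subrr.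
    by rewrite rmorphD /= x1 y1 tofracD !tofracM add_fractions.
  - have [x0 x1] := hfr x; have [y0 y1] := hfr y.
    rewrite !raddfB /= !fglift_scale !liftU !scale1r (DE (x * y) ((fr x).1 * (fr y).1)
      ((fr x).2 * (fr y).2)) ?mulf_neq0 //.
      rewrite quotient_ruleM // -[x *: _]/(val x * _) -[y *: _]/(val y * _) x1 y1.
      by rewrite -addrA -opprD; apply: subrr.
    by rewrite rmorphM /= x1 y1 !tofracM mul_fractions.
  - rewrite liftU scale1r (DE _ c%:MP 1) ?oner_neq0 ?tofrac1 ?divr1 //.
    by rewrite /quotient_rule -mpolyC1 !mderivC mul0r mulr0 subrr tofrac0 mul0r.
  - by rewrite raddf0.
  - by rewrite raddfB /= h1 h2 subrr.
  - by rewrite fglift_scale h1 scaler0.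
have : (<< u >> : {freeg B / B}) \in kahler_pred (hloc_cst hg).
  rewrite -[X in X \in _]subr0; apply/kahler_eqP.
  by apply: etrans du (esym _); apply: raddf0.
move=> /asboolP/rel0; rewrite liftU scale1r (DE _ a b) // /quotient_rule => /eqP.
rewrite mulf_eq0 invr_eq0 expf_eq0 /= !tofrac_eq0 (negPf b0) orbF subr_eq0.
by move/eqP.
Qed.

End ChartDerivation.

(** The function [x_i / x_j] pulls back to [F_i / F_j], whose differential vanishes; the identity is
    the quotient rule. *)
Lemma cotangent_proportional (A : idomainType) (N : nat) (f : proj_endo N A) i j l :
  cotangent_map_zero f -> tnth f j != 0 ->
  (tnth f i)^`M(l) * tnth f j = tnth f i * (tnth f j)^`M(l).
Proof.
move=> hdf fj0; pose m : 'I_N.+1 := ord0.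
have X0 s : ('X_s : {mpoly A[N.+1]}) != 0 by rewrite -msupp_eq0 msuppX.
have g0 : 'X_m * tnth f j != 0 by rewrite mulf_neq0.
have hc : ('X_i : {mpoly A[N.+1]})%:F / ('X_j)%:F \in hloc_pred (target_homog A j).
  apply/asboolP; exists 1%N, 'X_i; rewrite expr1; split=> //.
  by rewrite dhomogX /= mdeg1.
have hu : (tnth f i)%:F / (tnth f j)%:F \in hloc_pred (chart_homog f m j).
  (* Denominators in the chart ring are powers of [x_m F_j], so [F_i / F_j] is written as
     [x_m F_i / (x_m F_j)]. *)
  apply/asboolP; exists 1%N, ('X_m * tnth f i); rewrite mul1n expr1; split.
    by rewrite dhomogM ?pe_homog // dhomogX /= mdeg1.
  by rewrite !tofracM -mulf_div divff ?mul1r // tofrac_eq0.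
pose c : hloc (target_homog A j) :=
  exist (fun u => u \in hloc_pred (target_homog A j)) _ hc.
pose u : chart_ring f m j :=
  exist (fun u => u \in hloc_pred (chart_homog f m j)) _ hu.
have := hdf m j 1 c u; rewrite scale1r => /(_ _)/(kahler_d_eq0 g0) H.
apply: H => //; exists 1%N, 'X_i; split; rewrite ?expr1 //.
  by rewrite dhomogX /= mdeg1.
by rewrite comp_mpolyXU -tnth_nth.
Qed.

Section MonomialDivisibility.
Variables (A : idomainType) (n : nat).
Implicit Types P Q : {mpoly A[n]}.

Lemma mcoeffMX_out P (e m : 'X_{1..n}) i : (m i < e i)%N -> ('X_[e] * P)@_m = 0.
Proof.
move=> mi; apply: memN_msupp_eq0; rewrite -commr_mpolyX (perm_mem (msuppMX P e)).
apply/mapP => -[m' _ em]; move: mi; rewrite em mnmDE; lia.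
Qed.

Lemma monomial_dvd P Q i1 i2 a b : i1 != i2 ->
  'X_i2 ^+ b * P = 'X_i1 ^+ a * Q -> exists P', P = 'X_i1 ^+ a * P'.
Proof.
rewrite !mpolyXn => i12 e.
exists (\sum_(m <- msupp P) P@_m *: 'X_[m - U_(i1) *+ a]).
rewrite mulr_sumr {1}[P]mpolyE !big_seq; apply: eq_bigr => m mP.
rewrite -scalerAr -mpolyXD; congr (_ *: 'X_[_]).
rewrite addmC submK //; apply/mnm_lepP => i; rewrite mulmnE mnm1E.
case: eqP => [<-|_]; rewrite ?mul0n // mul1n leqNgt; apply/negP => lt.
move: mP; rewrite mcoeff_msupp; case/eqP.
rewrite -(mcoeffMX P (U_(i2) *+ b)) commr_mpolyX e; apply: (@mcoeffMX_out _ _ _ i1).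
by rewrite mnmDE !mulmnE !mnm1E eqxx (negPf (_ : i2 != i1)) ?mul0n ?mul1n // eq_sym.
Qed.

Lemma mpolyXn_neq0 i a : ('X_i : {mpoly A[n]}) ^+ a != 0.
Proof. by rewrite expf_neq0 // -msupp_eq0 msuppX. Qed.

Lemma msize_mderiv_lt l P : P^`M(l) != 0 -> (msize P^`M(l) < msize P)%N.
Proof.
move=> dP0; rewrite -(mlead_deg dP0); set m := mlead _.
have : (P^`M(l))@_m != 0 by rewrite mleadc_eq0.
rewrite mcoeff_deriv => nz; have /msize_mdeg_lt : (m + U_(l))%MM \in msupp P.
  by rewrite mcoeff_msupp; apply: contraNneq nz => ->; rewrite mul0rn.
by rewrite mdegD mdeg1 addn1.
Qed.

End MonomialDivisibility.

Section EndomorphismShape.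
Variables (N : nat).
Hypothesis N0 : (0 < N)%N.

Lemma other_index (i : 'I_N.+1) : exists l, l != i.
Proof.
have [i0|i0] := eqVneq i ord0; last by exists ord0; rewrite eq_sym.
by exists ord_max; rewrite i0 -val_eqE /= -lt0n.
Qed.

(** Proportionality and [x_i^M = sum_s c_s F_s] show that [F_j] divides [x_i^M dF_j] for every [i].
    Two different variables give that [F_j] divides [dF_j], which is 0 as its degree would be
    smaller. *)
Lemma mderiv_form_eq0 (A : idomainType) (f : proj_endo N A) j l :
  cotangent_map_zero f -> (tnth f j)^`M(l) = 0.
Proof.
move=> hdf; have [->|fj0] := eqVneq (tnth f j) 0; first by rewrite mderiv0.
have [i2 i21] := other_index ord0; set i1 : 'I_N.+1 := ord0 in i21.
have H i : exists M S, 'X_i ^+ M * (tnth f j)^`M(l) = tnth f j * S.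
  have [M [c hM]] := pe_generate f i; exists M, (\sum_s c s * (tnth f s)^`M(l)).
  rewrite hM mulr_suml mulr_sumr; apply: eq_bigr => s _.
  by rewrite -mulrA -(cotangent_proportional s l hdf fj0) [LHS]mulrA [LHS]mulrC.
have [a [S1 h1]] := H i1; have [b [S2 h2]] := H i2.
have e : 'X_i2 ^+ b * S1 = 'X_i1 ^+ a * S2.
  by apply: (mulfI fj0); rewrite mulrCA -h1 mulrCA h2 mulrCA.
rewrite eq_sym in i21; have [P hP] := monomial_dvd i21 e.
have {}h1 : (tnth f j)^`M(l) = tnth f j * P.
  by apply: (mulfI (mpolyXn_neq0 A i1 a)); rewrite h1 hP mulrCA.
apply/eqP; apply: contraT => d0; have := msize_mderiv_lt d0.
have P0 : P != 0 by apply: contraNneq d0 => P0; rewrite h1 P0 mulr0.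
rewrite h1 msizeM // ltnNge; case/negP.
have : (0 < msize P)%N by rewrite lt0n msize_poly_eq0.
lia.
Qed.

Lemma form_pth_power_vars (A : idomainType) n p (P : {mpoly A[n]}) :
  p \in [pchar A] -> (forall l, P^`M(l) = 0) ->
  exists G, P = G \mPo power_vars A p n.
Proof.
move=> hp dP; have hm m l : m \in msupp P -> (p %| m l)%N.
  rewrite mcoeff_msupp => mP; case e: (m l) => [|c]; first exact: dvdn0.
  have lm : (U_(l) <= m)%MM by rewrite lep1mP e.
  have := mcoeff_deriv l (m - U_(l)) P; rewrite dP mcoeff0 submK //.
  rewrite mnmBE mnm1E eqxx e subSS subn0 => /esym/eqP.
  by rewrite -mulr_natr mulf_eq0 (negPf mP) /= (dvdn_pcharf hp).
exists (\sum_(m <- msupp P) P@_m *: 'X_[[multinom (m i %/ p)%N | i < n]]).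
rewrite rmorph_sum {1}[P]mpolyE !big_seq; apply: eq_bigr => m mP /=.
rewrite comp_mpolyZ comp_mpolyX mpolyXE_id; congr (_ *: _).
by apply: eq_bigr => i _; rewrite tnth_mktuple -exprM mnmE mulnC divnK // hm.
Qed.

(** From [F_i x_l^q = F_l x_i^q] one gets [F_i = x_i^q p0] with a common factor [p0]. It divides
    powers of two different variables, hence is constant. *)
Lemma frobenius_form (k : fieldType) (f : proj_endo N k) q :
  proj_endo_eq f (frobenius N k q) ->
  exists2 c : k, c != 0 & forall i, tnth f i = c *: 'X_i ^+ q.
Proof.
move=> hf; have {}hf i l : tnth f i * 'X_l ^+ q = tnth f l * 'X_i ^+ q.
  by have := hf i l; rewrite /= !tnth_mktuple.
have /choice[P hP] i : exists P, tnth f i = 'X_i ^+ q * P.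
  have [l li] := other_index i; rewrite eq_sym in li.
  by apply: (monomial_dvd (b := q) (Q := tnth f l) li); rewrite mulrC hf mulrC.
have PE i l : P i = P l.
  apply: (mulfI (mpolyXn_neq0 k i q)); apply: (mulfI (mpolyXn_neq0 k l q)).
  by rewrite -hP mulrC hf hP mulrC mulrCA.
pose p0 := P ord0; have fE i : tnth f i = 'X_i ^+ q * p0 by rewrite hP (PE i ord0).
have H i : exists M S, 'X_i ^+ M = p0 * S.
  have [M [c hM]] := pe_generate f i; exists M, (\sum_s c s * 'X_s ^+ q).
  by rewrite hM mulr_sumr; apply: eq_bigr => s _; rewrite fE [LHS]mulrA [LHS]mulrC.
have [i2 i21] := other_index ord0; set i1 : 'I_N.+1 := ord0 in i21.
have [a [S1 h1]] := H i1; have [b [S2 h2]] := H i2.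
have p00 : p0 != 0.
  by apply: contraTneq (mpolyXn_neq0 k i1 a) => p00; rewrite h1 p00 mul0r eqxx.
rewrite eq_sym in i21.
have [|S' hS'] := @monomial_dvd k _ S1 S2 i1 i2 a b i21.
  by apply: (mulfI p00); rewrite mulrCA -h1 mulrCA -h2 mulrC.
have e1 : p0 * S' = 1.
  by apply: (mulfI (mpolyXn_neq0 k i1 a)); rewrite mulrCA -hS' -h1 mulr1.
have S'0 : S' != 0.
  by apply: contra_eqN e1 => /eqP->; rewrite mulr0 eq_sym oner_eq0.
have : msize p0 == 1%N.
  have h : msize (p0 * S') = 1%N by rewrite e1 msize1.
  have h1' : (0 < msize p0)%N by rewrite lt0n msize_poly_eq0.
  have h2' : (0 < msize S')%N by rewrite lt0n msize_poly_eq0.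
  have aux a' b' : (0 < a')%N -> (0 < b')%N -> (a' + b').-1 = 1%N -> a' = 1%N by lia.
  by rewrite msizeM // in h; apply/eqP; apply: aux h1' h2' h.
case/msize_poly1P => c c0 pc; exists c => // i.
by rewrite fE pc mulrC mul_mpolyC.
Qed.

End EndomorphismShape.

Lemma frobenius_iterate (k : fieldType) (s : seq k) (p e n : nat) (c : k)
    (T : n.-tuple {mpoly k[n]}) :
  (forall a, a \in s) -> p \in [pchar k] -> c != 0 ->
  (forall i, tnth T i = c *: 'X_i ^+ (p ^ e)) ->
  exists2 r, (0 < r)%N & exists m, forall P, P \mPo tuple_iter T r = P ^+ (p ^ m).
Proof.
move=> hs hp c0 hT; set q := (p ^ e)%N.
have q0 : (0 < q)%N by apply: pX_gt0 hp _.
(* The first component follows the constant of the iterates of [T], the second the [q]-power map of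
   [k]. When an iterate of [phi] is the identity, the constant is 1 and all coefficients are
   fixed. *)
pose phi (x : k * k) := (c * x.1 ^+ q, x.2 ^+ q).
have inj_q (x y : k) : x ^+ q = y ^+ q -> x = y.
  move=> exy; apply/eqP; rewrite -subr_eq0.
  have := exprD_pchar e (x - y) y hp; rewrite subrK exy => /eqP.
  by rewrite -subr_eq subrr eq_sym expf_eq0 => /andP[].
have inj : injective phi.
  by move=> [a b] [a' b'] [/(mulfI c0)/inj_q -> /inj_q ->].
have hss (x : k * k) : x \in [seq (a, b) | a <- s, b <- s].
  by case: x => a b; apply/allpairsP; exists (a, b).
have [r r0 hr] := injective_iter_id hss inj; exists r => //.
have iterE m x : iter m phi x = (((iter m phi (1, 0)).1) * x.1 ^+ (q ^ m), x.2 ^+ (q ^ m)).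
  elim: m => [|m IH]; first by rewrite /= mul1r !expn0 !expr1; case: x.
  rewrite iterS IH [in RHS]iterS; case: (iter m phi (1, 0)) => a b /=.
  by rewrite /phi /= exprMn -!exprM -!expnSr mulrA.
have iterT m i : tnth (tuple_iter T m) i = (iter m phi (1, 0)).1 *: 'X_i ^+ (q ^ m).
  elim: m i => [|m IH] i; first by rewrite tnth_mktuple /= scale1r expn0 expr1.
  rewrite tnth_mktuple hT comp_mpolyZ rmorphXn /= comp_mpolyXU -tnth_nth IH.
  by rewrite exprZn scalerA -exprM -expnSr.
have cr : (iter r phi (1, 0)).1 = 1 by rewrite hr.
have xr (x : k) : x ^+ (q ^ r) = x by have := hr (0, x); rewrite iterE => -[_].
exists (e * r)%N => P; rewrite expnM.
apply: etrans (_ : \sum_(m <- msupp P) P@_m *: 'X_[m] ^+ (q ^ r) = _).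
  rewrite comp_mpolyEX; apply: eq_bigr => m _; rewrite comp_mpolyX mpolyXE_id -prodrXl.
  congr (_ *: _); apply: eq_bigr => i _.
  by rewrite iterT cr scale1r exprAC.
rewrite [in RHS](mpolyE P) /q -expnM.
have -> := expr_sum_pchar (e * r) (msupp P) xpredT (fun m => P@_m *: 'X_[m]) (pchar_mpoly n hp).
by apply: eq_bigr => m _; rewrite exprZn expnM xr.
Qed.

(** * Finite subalgebras *)

Section FiniteSpan.
Variables (K E : fieldType) (iota : {rmorphism K -> E}).

Definition span_over (T : finType) (c : T -> E) (z : E) :=
  exists a : T -> K, z = \sum_i iota (a i) * c i.

Definition algebra_span (T : finType) (c : T -> E) :=
  span_over c 1 /\ forall i l, span_over c (c i * c l).

Section Span.
Variables (T : finType) (c : T -> E).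

Lemma span_overD x y : span_over c x -> span_over c y -> span_over c (x + y).
Proof.
move=> [a ->] [b ->]; exists (fun i => a i + b i); rewrite -big_split.
by apply: eq_bigr => i _; rewrite rmorphD mulrDl.
Qed.

Lemma span_overZ a x : span_over c x -> span_over c (iota a * x).
Proof.
move=> [b ->]; exists (fun i => a * b i); rewrite mulr_sumr.
by apply: eq_bigr => i _; rewrite rmorphM mulrA.
Qed.

Lemma span_over0 : span_over c 0.
Proof. by exists (fun=> 0); rewrite big1 // => i _; rewrite rmorph0 mul0r. Qed.

Lemma span_over_sum (I : Type) (r : seq I) (P : pred I) (F : I -> E) :
  (forall i, P i -> span_over c (F i)) -> span_over c (\sum_(i <- r | P i) F i).
Proof.
by move=> h; apply: (big_ind (span_over c)) => //; [exact: span_over0|exact: span_overD].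
Qed.

Lemma span_over_mem i : span_over c (c i).
Proof.
exists (fun l => (l == i)%:R); rewrite (bigD1 i) //= eqxx rmorph1 mul1r big1 ?addr0 //.
by move=> l /negPf->; rewrite rmorph0 mul0r.
Qed.

Lemma span_over_trans (T' : finType) (c' : T' -> E) z :
  (forall i, span_over c (c' i)) -> span_over c' z -> span_over c z.
Proof.
by move=> h [a ->]; apply: span_over_sum => i _; apply: span_overZ.
Qed.

Hypothesis hc : algebra_span c.

Lemma algebra_spanM x y : span_over c x -> span_over c y -> span_over c (x * y).
Proof.
move=> [a ->] [b ->]; rewrite mulr_suml; apply: span_over_sum => i _.
rewrite mulr_sumr; apply: span_over_sum => l _.
by rewrite mulrACA -rmorphM; apply: span_overZ; apply: hc.2.
Qed.

Lemma algebra_span_cst a : span_over c (iota a).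
Proof. by rewrite -[iota a]mulr1; apply: span_overZ; apply: hc.1. Qed.

End Span.

(** The products [c_i z^e] with [e < deg q] span, since higher powers of [z] are reduced modulo
    [q]. *)
Lemma algebra_span_adjoin (T : finType) (c : T -> E) z : algebra_span c ->
  algebraicOver iota z -> exists (T' : finType) (c' : T' -> E),
    [/\ algebra_span c', span_over c' z & forall x, span_over c x -> span_over c' x].
Proof.
move=> hc [q q0 qz]; pose d := (size q).-1.
pose c' (x : T * 'I_d) := c x.1 * z ^+ x.2.
have sq : (1 < size (map_poly iota q))%N.
  by apply: root_size_gt1 qz; rewrite map_poly_eq0.
have szq : d.+1 = size q by rewrite /d prednK // -(size_map_poly iota) ltnW.
have zX e : span_over (fun i : 'I_d => z ^+ i) (z ^+ e).
  have : z ^+ e = (map_poly iota ('X^e %% q)).[z].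
    have /(congr1 (map_poly iota)) := divp_eq 'X^e q.
    rewrite rmorphD rmorphM /= map_polyXn => /(congr1 (horner^~ z)).
    by rewrite hornerXn hornerD hornerM (eqP qz) mulr0 add0r.
  have sz : (size (map_poly iota ('X^e %% q)) <= d)%N.
    by rewrite size_map_poly -ltnS szq ltn_modp.
  rewrite (horner_coef_wide _ sz) => ->.
  by exists (fun i : 'I_d => ('X^e %% q)`_i); apply: eq_bigr => i _; rewrite coef_map.
have mulc x e : span_over c x -> span_over c' (x * z ^+ e).
  move=> [a ->]; have [b ->] := zX e; rewrite mulr_suml; apply: span_over_sum => i _.
  rewrite mulr_sumr; apply: span_over_sum => l _.
  by rewrite mulrACA -rmorphM; apply: span_overZ; apply: (span_over_mem c' (i, l)).
exists (T * 'I_d)%type, c'; split.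
- split; first by rewrite -[1]mulr1 -{2}(expr0 z); apply: mulc; apply: hc.1.
  move=> [i e] [l e']; rewrite /c' mulrACA -exprD; apply: mulc; exact: hc.2.
- by rewrite -[z]mul1r -[X in 1 * X]expr1; apply: mulc; apply: hc.1.
- by move=> x hx; rewrite -[x]mulr1 -(expr0 z); apply: mulc.
Qed.

Lemma finite_subalgebra (s : seq E) : (forall z, z \in s -> algebraicOver iota z) ->
  exists (r : nat) (c : 'I_r -> E),
    algebra_span c /\ forall z, z \in s -> span_over c z.
Proof.
move=> hs; have [T [c [hc sc]]] : exists (T : finType) (c : T -> E),
    algebra_span c /\ forall z, z \in s -> span_over c z.
  elim: s hs => [|z s IH] hs.
    exists unit, (fun=> 1); split=> //; split=> [|[] []]; last rewrite mulr1.
      exact: (span_over_mem (fun=> 1) tt).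
    exact: (span_over_mem (fun=> 1) tt).
  have [T [c [hc sc]]] := IH (fun x xs => hs x (mem_behead (s := z :: s) xs)).
  have [T' [c' [hc' c'z cc']]] := algebra_span_adjoin hc (hs z (mem_head _ _)).
  by exists T', c'; split=> // x; rewrite inE => /predU1P[->//|/sc/cc'].
exists #|T|, (fun i => c (enum_val i)).
have sub z : span_over c z -> span_over (fun i : 'I_#|T| => c (enum_val i)) z.
  apply: span_over_trans => x.
  by have := span_over_mem (fun i : 'I_#|T| => c (enum_val i)) (enum_rank x); rewrite enum_rankK.
split; last by move=> z /sc/sub.
by split=> [|i l]; apply: sub; [apply: hc.1|apply: hc.2].
Qed.

Section PthPowers.
Variable p : nat.
Hypothesis hp : p \in [pchar E].

Lemma span_over_Xp (T : finType) (c : T -> E) z :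
  span_over c z -> span_over (fun i => c i ^+ p) (z ^+ p).
Proof.
move=> [a ->]; have := expr_sum_pchar 1 (index_enum T) xpredT (fun i => iota (a i) * c i) hp.
rewrite expn1 => ->; exists (fun i => a i ^+ p); apply: eq_bigr => i _.
by rewrite exprMn rmorphXn.
Qed.

(* A basis with as few elements as possible stays a basis after raising to the
   [p]-th power: this is where the purely inseparable part is removed. *)
Lemma separable_subalgebra n (x : 'I_n -> E) : (forall i, algebraicOver iota (x i)) ->
  exists (u r : nat) (c : 'I_r -> E), [/\ algebra_span c,
    forall i, span_over c (x i ^+ (p ^ u)) &
    forall a : 'I_r -> K, \sum_i iota (a i) * c i ^+ p = 0 -> forall i, a i = 0].
Proof.
move=> hx; pose good r := `[< exists u (c : 'I_r -> E), algebra_span c /\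
  forall i, span_over c (x i ^+ (p ^ u)) >].
have [r0 [c0 [hc0 sc0]]] : exists r (c : 'I_r -> E), algebra_span c /\
    forall z, z \in [seq x i | i <- enum 'I_n] -> span_over c z.
  by apply: finite_subalgebra => z /mapP[i _ ->].
have ex : exists r, good r.
  exists r0; apply/asboolP; exists 0%N, c0; split=> // i.
  by rewrite expn0 expr1; apply/sc0/map_f; rewrite mem_enum.
case: (ex_minnP ex) => r /asboolP[u [c [hc cx]]] min; exists u, r, c; split=> // a e0 i0.
apply/eqP; apply: contraT => ai0; move: c hc cx min a e0 i0 ai0.
case: r => [|r] c hc cx min a e0 i0 ai0; first by case: (i0).
suff : good r by move/min; rewrite ltnn.
(* A relation with [a i0 != 0] makes [c i0 ^+ p] redundant. The [p]-th powers of the others still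
   span an algebra, which contains the [p^(u+1)]-th powers of the [x i]. *)
pose c' (l : 'I_r) := c (fintype.lift i0 l) ^+ p.
have cc' i : span_over c' (c i ^+ p).
  case: (unliftP i0 i) => [l ->|->]; first exact: (span_over_mem c').
  exists (fun l => - (a i0)^-1 * a (fintype.lift i0 l)).
  rewrite (bigD1_ord i0) //= in e0.
  have ia0 : iota (a i0) != 0 by rewrite fmorph_eq0.
  apply: (mulfI ia0); rewrite mulr_sumr; move/eqP: e0; rewrite addr_eq0 => /eqP->.
  rewrite -sumrN; apply: eq_bigr => l _; rewrite rmorphM rmorphN fmorphV !mulrA.
  by rewrite mulrN divff // mulN1r mulNr.
have sub z : span_over (fun i => c i ^+ p) z -> span_over c' z by apply: span_over_trans.
apply/asboolP; exists u.+1, c'; split; last first.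
  by move=> i; rewrite expnSr exprM; apply/sub/span_over_Xp.
split; first by rewrite -(expr1n _ p); apply/sub/span_over_Xp/hc.1.
by move=> l m; rewrite -exprMn; apply/sub/span_over_Xp/hc.2.
Qed.

End PthPowers.

End FiniteSpan.

Lemma mmap_closed n (R S : comNzRingType) (f : {rmorphism R -> S}) (h : 'I_n -> S)
    (A : S -> Prop) (P : {mpoly R[n]}) : A 0 -> A 1 ->
  (forall a b, A a -> A b -> A (a + b)) -> (forall a b, A a -> A b -> A (a * b)) ->
  (forall m, A (f P@_m)) -> (forall i, A (h i)) -> A (mmap f h P).
Proof.
move=> A0 A1 AD AM Af Ah; rewrite /mmap; apply: (big_ind A) => // m _.
apply: (AM) => //; apply: (big_ind A) => // i _.
by elim: (m i) => [|d IH]; rewrite ?expr0 // exprS; apply: (AM).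
Qed.

(** * Return times *)

(** The tails of the unbounded set [S] generate a proper filter, which is extended to an
    ultrafilter. *)
Lemma ultrafilter_exists (S : nat -> Prop) :
  (forall m, exists2 i, (m <= i)%N & S i) -> exists U, ultrafilter U /\ U S.
Proof.
move=> hS; pose F (A : nat -> Prop) := exists m, forall i, (m <= i)%N -> S i -> A i.
have FF : filter.ProperFilter F.
  split; first by move=> [m hm]; have [i mi Si] := hS m; apply: (hm i).
  split; first by exists 0%N.
    move=> A B [a ha] [b hb]; exists (maxn a b) => i; rewrite geq_max => /andP[ai bi] Si.
    by split; [apply: ha|apply: hb].
  by move=> A B AB [a ha]; exists a => i ai Si; apply/AB/ha.
have [U [UU FU]] := filter.ultraFilterLemma FF.
have UF := filter.filter_filter (F := U); exists U; split; last by apply: FU; exists 0%N.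
split=> [A B|A B AB|m|A B hAB|].
- exact: filter.filterI.
- exact: filter.filterS.
- by apply: FU; exists m.
- have [hA|hA] := filter.in_ultra_setVsetC A UU; [by left|right].
  by apply: filter.filterS (filter.filterI hA hAB) => i [nA [/nA|]].
- exact: filter.filter_not_empty.
Qed.

Lemma finite_union_of_AP_by_classes (S : nat -> Prop) R : (0 < R)%N ->
  (forall c, (c < R)%N ->
     (forall m, exists2 i, (m <= i)%N & S i /\ (i %% R)%N = c) ->
     exists2 n0, (n0 %% R)%N = c & forall k, S (n0 + R * k)%N) ->
  finite_union_of_AP S.
Proof.
move=> R0 hS; have H c : exists s : seq (nat * nat),
    (forall ml, ml \in s -> forall k, S (ml.1 * k + ml.2)%N) /\
    ((c < R)%N -> forall i, S i -> (i %% R)%N = c ->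
      exists2 ml, ml \in s & exists k, i = (ml.1 * k + ml.2)%N).
  (* A single point [i] is encoded as the progression with step 0. *)
  pose pts M := [seq (0%N, i) | i <- iota 0 M & `[< S i >]].
  have ptsS M ml : ml \in pts M -> forall k, S (ml.1 * k + ml.2)%N.
    by case/mapP=> i; rewrite mem_filter => /andP[/asboolP Si _] -> k; rewrite mul0n.
  have mem_pts M i : S i -> (i < M)%N -> (0%N, i) \in pts M.
    move=> Si iM; apply/mapP; exists i => //; rewrite mem_filter mem_iota /= iM andbT.
    exact/asboolP.
  have [cR|cR] := ltnP c R; last by exists [::]; split=> //; rewrite ltnNge cR.
  have [inf|/existsNP[M fin]] :=
      pselect (forall m, exists2 i, (m <= i)%N & S i /\ (i %% R)%N = c).
    have [n0 n0c hn0] := hS c cR inf; exists ((R, n0) :: pts n0); split.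
      move=> ml; rewrite inE => /predU1P[-> k|/ptsS//].
      by rewrite addnC; apply: hn0.
    move=> _ i Si ic; have [lt|le] := ltnP i n0.
      exists (0%N, i); last by exists 0%N; rewrite mul0n.
      by rewrite inE mem_pts ?orbT.
    exists (R, n0); first exact: mem_head.
    have /dvdnP[k hk] : (R %| i - n0)%N by rewrite -eqn_mod_dvd // ic n0c.
    by exists k => /=; rewrite mulnC -hk subnK.
  exists (pts M); split=> [ml|_ i Si ic]; first exact: ptsS.
  exists (0%N, i); last by exists 0%N; rewrite mul0n.
  apply: mem_pts => //; rewrite ltnNge; apply/negP => Mi.
  by apply: fin; exists i.
have [l hl] := choice H; exists (flatten [seq l c | c <- iota 0 R]) => i; split.
  move=> Si; have cR : (i %% R < R)%N by rewrite ltn_mod.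
  have [ml mll hml] := (hl (i %% R)%N).2 cR i Si erefl; exists ml => //.
  by apply/flattenP; exists (l (i %% R)%N) => //; apply: map_f; rewrite mem_iota.
case=> ml /flattenP[_ /mapP[c _ ->] mll] [k ->].
exact: (hl c).1 mll k.
Qed.

(** Over the fraction field of [R / P], [d + 1] vectors of length [d] are dependent; the proof is
    fraction-free Gaussian elimination. *)
Lemma prime_left_kernel (R : comNzRingType) (P : R -> Prop) d
    (V : 'I_d.+1 -> 'I_d -> R) :
  ideal_like P -> (forall x y, P (x * y) -> P x \/ P y) -> ~ P 1 ->
  exists c : 'I_d.+1 -> R, (exists s, ~ P (c s)) /\
    forall i, P (\sum_s c s * V s i).
Proof.
move=> hP prP P1; elim: d V => [|d IH] V.
  by exists (fun=> 1); split=> [|[]//]; exists ord0.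
have [h|/existsNP[s0 nw]] := pselect (forall s, P (V s ord_max)).
  have [c [[s hs] hc]] := IH (fun s i => V (fintype.lift ord0 s) (fintype.lift ord_max i)).
  exists (fun s => if unlift ord0 s is Some s' then c s' else 0); split.
    by exists (fintype.lift ord0 s) => /=; rewrite fintype.liftK.
  move=> i; rewrite (bigD1_ord ord0) //= unlift_none mul0r add0r.
  under eq_bigr do rewrite fintype.liftK.
  case: (unliftP ord_max i) => [l ->|->]; first exact: hc.
  by apply: ideal_sum => // x _; apply: idealMl.
(* The pivot [w] clears the last column from the other rows; in the resulting relation the
   coefficient of row [s0] is chosen so that the last column cancels. *)
set w := V s0 ord_max in nw.
have [c [[s hs] hc]] := IH (fun s i => w * V (fintype.lift s0 s) (fintype.lift ord_max i) -
  V (fintype.lift s0 s) ord_max * V s0 (fintype.lift ord_max i)).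
exists (fun s => if unlift s0 s is Some s' then w * c s'
  else - \sum_x c x * V (fintype.lift s0 x) ord_max); split.
  by exists (fintype.lift s0 s) => /=; rewrite fintype.liftK => /prP[].
move=> i; rewrite (bigD1_ord s0) //= unlift_none.
under [X in _ + X]eq_bigr do rewrite fintype.liftK.
rewrite mulNr mulr_suml -sumrN -big_split /=.
case: (unliftP ord_max i) => [l ->|->].
  rewrite (eq_bigr (fun x => c x * (w * V (fintype.lift s0 x) (fintype.lift ord_max l) -
    V (fintype.lift s0 x) ord_max * V s0 (fintype.lift ord_max l)))); first exact: hc.
  by move=> x _; rewrite mulrBr addrC mulrCA !mulrA.
rewrite big1 => [|x _]; first exact: ideal0.
by rewrite -/w -[w * _ * _]mulrA [w * _]mulrC addNr.
Qed.

Section PrimesOverPrime.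
Variables (K E : fieldType) (iota : {rmorphism K -> E}) (n d : nat) (b : 'I_d -> E).
Hypothesis hb : algebra_span iota b.

Definition mpoly_span (H : {mpoly E[n]}) := forall m, span_over iota b H@_m.

Lemma mpoly_spanD H H' : mpoly_span H -> mpoly_span H' -> mpoly_span (H + H').
Proof. by move=> h h' m; rewrite mcoeffD; apply: span_overD. Qed.

Lemma mpoly_spanM H H' : mpoly_span H -> mpoly_span H' -> mpoly_span (H * H').
Proof.
move=> h h' m; rewrite mcoeffM; apply: span_over_sum => i _.
exact: algebra_spanM.
Qed.

Lemma mpoly_span0 : mpoly_span 0.
Proof. by move=> m; rewrite mcoeff0; apply: span_over0. Qed.

Lemma mpoly_spanC c : span_over iota b c -> mpoly_span c%:MP.
Proof.
move=> hc m; rewrite mcoeffC; case: (m == 0%MM); rewrite ?mulr1 // mulr0.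
exact: span_over0.
Qed.

Lemma mpoly_span1 : mpoly_span 1.
Proof. by apply: mpoly_spanC; apply: hb.1. Qed.

Lemma mpoly_spanE H : mpoly_span H -> exists Hs : 'I_d -> {mpoly K[n]},
  H = \sum_i (b i)%:MP * map_mpoly iota (Hs i).
Proof.
move=> /choice[a ha].
exists (fun i => \sum_(m <- msupp H) a m i *: 'X_[m]).
under eq_bigr do rewrite rmorph_sum mulr_sumr.
rewrite exchange_big {1}[H]mpolyE; apply: eq_bigr => m _ /=.
rewrite (ha m) scaler_suml; apply: eq_bigr => i _.
by rewrite map_mpolyZ map_mpolyX mul_mpolyC scalerA mulrC.
Qed.

Variable J : nat -> {mpoly E[n]} -> Prop.
Hypothesis hJ : forall a, ideal_like (J a).
Hypothesis primeJ : forall a P Q, J a (P * Q) -> J a P \/ J a Q.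
Hypothesis J1 : forall a, ~ J a 1.
Hypothesis J_lies_over : forall a, (a <= d)%N -> forall P : {mpoly K[n]},
  J a (map_mpoly iota P) <-> J 0 (map_mpoly iota P).

(* A ring of rank [d] over its base has at most [d] primes above a given one. *)
Lemma primes_over_prime : exists a s, [/\ (a < s)%N, (s <= d)%N &
  forall H, mpoly_span H -> J a H -> J s H].
Proof.
apply: contrapT => hn.
have /choice[h hh] : forall x : nat * nat, exists H, (x.1 < x.2)%N -> (x.2 <= d)%N ->
    [/\ mpoly_span H, J x.1 H & ~ J x.2 H].
  move=> [a s] /=; apply: contrapT => /forallNP hx; apply: hn.
  have /not_implyP[as_ /not_implyP[sd _]] := hx 0.
  exists a, s; split=> // H sH JH; apply: contrapT => nJ.
  by apply: (hx H).
(* [u s] lies in [J a] for all [a < s], but not in the prime [J s]. *)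
pose u (s : 'I_d.+1) := \prod_(a < s) h (a : nat, s : nat).
have sd (s : 'I_d.+1) : (s <= d)%N by rewrite -ltnS.
have su s : mpoly_span (u s).
  apply: (big_ind mpoly_span) => [||a _]; [exact: mpoly_span1|exact: mpoly_spanM|].
  by have [] := hh (a : nat, s : nat) (ltn_ord a) (sd s).
have uJ (s : 'I_d.+1) a : (a < s)%N -> J a (u s).
  move=> lt; rewrite /u (bigD1 (Ordinal lt)) //=; apply: idealMr => //.
  by have [] := hh (a, s : nat) lt (sd s).
have unJ (s : 'I_d.+1) : ~ J s (u s).
  apply: (big_ind (fun H => ~ J s H)) => [||a _].
  - exact: J1.
  - by move=> x y nx ny /primeJ[].
  - by have [] := hh (a : nat, s : nat) (ltn_ord a) (sd s).
have /choice[V hV] := fun s => mpoly_spanE (su s).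
pose P (Q : {mpoly K[n]}) := J 0 (map_mpoly iota Q).
have hP : ideal_like P.
  split=> [|x y|a x]; rewrite /P ?rmorph0 ?rmorphD ?rmorphM.
  - exact: ideal0.
  - exact: idealD.
  - exact: idealMl.
have [||c [[s0 ncs] hc]] := prime_left_kernel V hP.
- by move=> x y; rewrite /P rmorphM; apply: primeJ.
- by rewrite /P rmorph1; apply: J1.
(* The relation modulo the common prime [P] below puts [sum_s c_s u_s] into every [J a]. *)
have key a : (a <= d)%N -> J a (\sum_s map_mpoly iota (c s) * u s).
  move=> ad; have -> : \sum_s map_mpoly iota (c s) * u s =
      \sum_i (b i)%:MP * map_mpoly iota (\sum_s c s * V s i).
    under eq_bigr do rewrite hV mulr_sumr.
    rewrite exchange_big; apply: eq_bigr => i _ /=.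
    rewrite rmorph_sum mulr_sumr; apply: eq_bigr => s _ /=.
    by rewrite rmorphM mulrCA.
  by apply: ideal_sum => // i _; apply: idealMl => //; apply/J_lies_over/hc.
(* Modulo [J s] the terms of index below [s] vanish by induction, and those above because their
   [u i] lies in [J s]. So all [c s] lie in [P], a contradiction. *)
suff H m : forall s : 'I_d.+1, (s < m)%N -> P (c s) by apply: ncs; apply: (H s0.+1).
elim: m => // m IH s; rewrite ltnS leq_eqVlt => /predU1P[sm|]; last exact: IH.
have := key s (sd s); rewrite (bigD1 s) //= => hs.
have : J s (map_mpoly iota (c s) * u s).
  rewrite -[X in J s X](addrK (\sum_(i < d.+1 | i != s) map_mpoly iota (c i) * u i)).
  apply: idealB => //; apply: ideal_sum => // i is_.
  have [lt|le] := ltnP i s.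
    by apply: idealMr => //; apply/J_lies_over => //; apply: IH; rewrite -sm.
  by apply: idealMl => //; apply: uJ; rewrite ltn_neqAle le andbT eq_sym.
by case/primeJ => [/J_lies_over|/unJ//]; apply.
Qed.

End PrimesOverPrime.

Section ReturnTimes.
Variables (K E : fieldType) (iota : {rmorphism K -> E}) (n D r : nat).
Hypothesis hE : forall z, algebraicOver iota z.
Hypothesis r0 : (0 < r)%N.
Variables (F : n.-tuple {mpoly K[n]}) (y : nat -> 'I_n -> E).
Let FE := [tuple map_mpoly iota (tnth F i) | i < n].
Hypothesis homF : forall i, tnth FE i \is D.-homog.
Hypothesis yS : forall m i, y m.+1 i = (tnth FE i).@[y m].
Hypothesis hvan : forall U, ultrafilter U -> exists a0, forall a, (a0 <= a)%N ->
  forall P, vanishing D iota y U (r * a) P <-> vanishing D iota y U (r * a0) P.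

Local Notation cone_eval m := (mmap polyC (cone D y m)).

Lemma cone_eval_homog m d P : P \is d.-homog ->
  cone_eval m P = P.@[y m] *: 'X^(d * D ^ m).
Proof. exact: (mmap_homog idfun). Qed.

Lemma cone_eval_eq0 m d P : P \is d.-homog -> cone_eval m P = 0 <-> P.@[y m] = 0.
Proof.
move=> /(cone_eval_homog m) ->; split=> [/eqP|->]; last by rewrite scale0r.
by rewrite scaler_eq0 expf_eq0 polyX_eq0 andbF orbF => /eqP.
Qed.

Lemma cone_eval_comp m k P :
  cone_eval m (P \mPo tuple_iter FE k) = cone_eval (m + k) P.
Proof.
elim: k P => [|k IH] P.
  have -> : P \mPo tuple_iter FE 0 = P by apply: comp_mpoly_id.
  by rewrite addn0.
rewrite comp_tuple_iterS IH mmap_comp_mpoly addnS.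
apply: eq_bigr => w _; congr (_ * _); apply: mmap1_eq => i.
by rewrite (cone_eval_homog _ (homF i)) /cone yS expnS.
Qed.

Lemma mpoly_span_comp d (b : 'I_d -> E) k P : algebra_span iota b ->
  mpoly_span iota b P -> mpoly_span iota b (P \mPo tuple_iter FE k).
Proof.
move=> hb; elim: k P => [|k IH] P hP.
  by have -> : P \mPo tuple_iter FE 0 = P by apply: comp_mpoly_id.
rewrite comp_tuple_iterS; apply: IH; apply: (mmap_closed (A := mpoly_span iota b)).
- exact: mpoly_span0.
- exact: mpoly_span1.
- exact: mpoly_spanD.
- exact: mpoly_spanM.
- by move=> m; apply: mpoly_spanC.
- move=> i m; rewrite tnth_mktuple mcoeff_map_mpoly.
  exact: algebra_span_cst.
Qed.

Lemma cone_eval_ideal m : ideal_like (fun P => cone_eval m P = 0).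
Proof.
split=> [|P Q hP hQ|P Q hQ]; first exact: rmorph0.
  by rewrite rmorphD /= hP hQ addr0.
by rewrite rmorphM /= hQ mulr0.
Qed.

Lemma ultra_cone_ideal U (g : nat -> nat) : ultrafilter U ->
  ideal_like (fun P => U (fun i => cone_eval (g i) P = 0)).
Proof.
move=> hU; split=> [|P Q hP hQ|P Q hQ].
- by apply: ultra_sub (ultra_tail hU 0) => // i _; rewrite rmorph0.
- apply: ultra_sub (ultra_and hU hP hQ) => // i [].
  exact: (idealD (cone_eval_ideal (g i))).
- by apply: ultra_sub hQ => // i; apply: (idealMl (cone_eval_ideal (g i))).
Qed.

(** Among [d + 1] ideals of forms vanishing at shifted orbit points, one is contained in a later
    one. This inclusion is compatible with [F] and can be iterated along a progression. *)
Lemma return_times_shift d (b : 'I_d -> E) (T0 : seq {mpoly E[n]}) U :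
  algebra_span iota b -> ultrafilter U ->
  (forall H, H \in T0 -> mpoly_span iota b H) ->
  (forall H, H \in T0 -> U (fun i => cone_eval i H = 0)) ->
  exists r', [/\ (0 < r')%N, (r' %| r * d`!)%N &
    forall H k, H \in T0 -> U (fun i => cone_eval (i + r' * k) H = 0)].
Proof.
move=> hb hU T0b T0U; have [a0 ha0] := hvan hU.
(* The offset [B] reverses the numbering: [J a] belongs to [y_(i - r (a0 + d - a))]. For [a <= d]
   these backward shifts are at least [r a0], so the ideals agree over [K]. *)
pose B := (r * (a0 + d))%N.
pose J a P := U (fun i => cone_eval (i - B + r * a) P = 0).
have hJ a : ideal_like (J a) by apply: ultra_cone_ideal.
have Jvan a (P : {mpoly K[n]}) : (a <= d)%N ->
    J a (map_mpoly iota P) <-> vanishing D iota y U (r * (a0 + d - a)) P.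
  move=> ad; have e i : (B <= i)%N -> (i - B + r * a = i - r * (a0 + d - a))%N.
    rewrite mulnBr -/B => Bi;
    have : (r * a <= B)%N by rewrite leq_mul2l (leq_trans ad) ?leq_addl ?orbT.
    lia.
  split=> h; apply: ultra_sub (ultra_and hU (ultra_tail hU B) h) => // i [/e ei].
    by rewrite ei mmap_map_mpoly.
  by rewrite ei mmap_map_mpoly.
have Jle a : (a <= d)%N -> forall P, J a (map_mpoly iota P) <-> J 0 (map_mpoly iota P).
  move=> ad P; rewrite !Jvan //.
  have h a' : (a' <= d)%N -> (a0 <= a0 + d - a')%N by lia.
  by rewrite (ha0 _ (h a ad)) (ha0 _ (h 0%N isT)).
have primeJ a P Q : J a (P * Q) -> J a P \/ J a Q.
  move=> h; apply: (ultra_or hU); apply: ultra_sub h => // i.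
  by rewrite rmorphM => /eqP; rewrite mulf_eq0 => /orP[]/eqP; [left|right].
have J1 a : ~ J a 1.
  move=> h; apply: (ultra_proper hU); apply: ultra_sub h => // i.
  by rewrite rmorph1 => /eqP; rewrite oner_eq0.
have [a [s [as_ sd Jas]]] := primes_over_prime hb hJ primeJ J1 Jle.
exists (r * (s - a))%N; split.
- by rewrite muln_gt0 r0 subn_gt0.
- rewrite dvdn_mul // dvdn_fact // subn_gt0 as_ /=.
  by apply: leq_trans sd; apply: leq_subr.
move=> H k HT; have ad : (a <= d)%N by apply: leq_trans sd; apply: ltnW.
have raB : (r * a <= B)%N by rewrite leq_mul2l (leq_trans ad) ?leq_addl ?orbT.
(* This says that [H] vanishes at [y_(i + r (s - a) k)] for almost all [i]; passing from [J a] to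
   [J s] raises [k] by 1. *)
have : J a (H \mPo tuple_iter FE (B - r * a + r * (s - a) * k)).
  elim: k => [|k IH].
    rewrite muln0 addn0.
    apply: ultra_sub (ultra_and hU (ultra_tail hU B) (T0U H HT)) => // i [Bi h].
    by rewrite cone_eval_comp -addnA subnKC // subnK.
  have /(Jas _) h := IH; have := h (mpoly_span_comp _ hb (T0b H HT)).
  apply: ultra_sub => // i; rewrite !cone_eval_comp mulnSr => <-.
  congr (mmap polyC (cone D y _) H); rewrite mulnBr.
  have : (r * a <= r * s)%N by rewrite leq_mul2l ltnW ?orbT.
  by lia.
move=> h; apply: ultra_sub (ultra_and hU (ultra_tail hU B) h) => // i [Bi].
by rewrite cone_eval_comp addnA -[(i - B + _ + _)%N]addnA subnKC // subnK.
Qed.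

Lemma return_times_finite_union_of_AP (T : {mpoly E[n]} -> Prop) :
  (forall P, T P -> exists d, P \is d.-homog) ->
  finite_union_of_AP (fun m => forall P, T P -> P.@[y m] = 0).
Proof.
move=> homT; have [T0 [T0T TT0]] := mpoly_finite_generators T.
have [d [b [hb hT0]]] := finite_subalgebra
  (s := flatten [seq [seq H@_m | m <- msupp H] | H <- T0]) (fun z _ => hE z).
have T0b H : H \in T0 -> mpoly_span iota b H.
  move=> HT m; have [mH|mH] := boolP (m \in msupp H); last first.
    by rewrite memN_msupp_eq0 //; apply: span_over0.
  apply: hT0; apply/flattenP; exists [seq H@_m | m <- msupp H]; exact: map_f.
have vT m : (forall H, H \in T0 -> cone_eval m H = 0) -> forall P, T P -> P.@[y m] = 0.
  move=> h P TP; have [e hP] := homT P TP; apply/(cone_eval_eq0 m hP).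
  apply: (combination_sub (cone_eval_ideal m)) (TT0 P TP) => i ilt.
  exact/h/mem_nth.
apply: (@finite_union_of_AP_by_classes _ (r * d`!)).
  by rewrite muln_gt0 r0 fact_gt0.
move=> c cR /ultrafilter_exists[U [hU US]].
have [|r' [r'0 r'R hr']] := return_times_shift hb hU T0b.
  move=> H HT; have [e hH] := homT H (T0T H HT).
  by apply: ultra_sub US => // i [h _]; apply/(cone_eval_eq0 i hH)/h/T0T.
(* For each [k] the vanishing holds for almost all [i], with an exceptional set depending on [k].
   Since finitely many generators suffice, a single [i] serves all [k]. *)
pose T' Q := exists H k, H \in T0 /\ Q = H \mPo tuple_iter FE (r' * k).
have [s' [s'T' T's']] := mpoly_finite_generators T'.
have hs' : U (fun i => forall l, (l < size s')%N -> cone_eval i (nth 0 s' l) = 0).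
  apply: (ultra_all (A := fun l i => cone_eval i (nth 0 s' l) = 0)) => // l ls.
  have [H [k [HT ->]]] := s'T' _ (mem_nth 0 ls).
  by apply: ultra_sub (hr' H k HT) => // i; rewrite cone_eval_comp.
have [i [[Si ic] hi]] : exists i, ((forall P, T P -> P.@[y i] = 0) /\ (i %% (r * d`!))%N = c) /\
    forall l, (l < size s')%N -> cone_eval i (nth 0 s' l) = 0.
  apply: contrapT => /forallNP nh; apply: (ultra_proper hU).
  exact: ultra_sub (ultra_and hU US hs').
exists i => // k; have /dvdnP[q ->] := r'R.
apply: vT => H HT; rewrite mulnAC [((q * k) * r')%N]mulnC -cone_eval_comp.
by apply: (combination_sub (cone_eval_ideal i)) (T's' _ _) => //; exists H, (q * k)%N.
Qed.

End ReturnTimes.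

(** * Coordinates of the orbit and conclusion *)

Lemma span_pth_powers_independent (K E : fieldType) (iota : {rmorphism K -> E})
    p r (c : 'I_r -> E) (t : K) :
  p \in [pchar E] ->
  (forall a, \sum_i iota (a i) * c i ^+ p = 0 -> forall i, a i = 0) ->
  (forall a : 'I_p -> K, \sum_(l < p) t ^+ l * a l ^+ p = 0 -> forall l, a l = 0) ->
  forall a : 'I_p -> E, (forall l, span_over iota c (a l)) ->
  \sum_(l < p) iota t ^+ l * a l ^+ p = 0 -> forall l, a l = 0.
Proof.
move=> hp hc ht a /choice[b hb] h0 l; rewrite hb big1 // => i _.
suff -> : b l i = 0 by rewrite rmorph0 mul0r.
(* Independence of the [c_i^p] over [K] splits the relation into one relation [sum_l t^l b_li^p = 0]
   in [K] for each [i]. *)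
move: l; apply: ht; move: i; apply: hc; rewrite -[RHS]h0.
under [RHS]eq_bigr => l _.
  rewrite hb; have := expr_sum_pchar 1 (index_enum 'I_r) xpredT
    (fun i => iota (b l i) * c i) hp.
  rewrite expn1 => ->; rewrite mulr_sumr; over.
rewrite exchange_big; apply: eq_bigr => i _ /=.
rewrite rmorph_sum mulr_suml; apply: eq_bigr => l _ /=.
by rewrite rmorphM !rmorphXn exprMn mulrA.
Qed.

(** The coordinates of [y_m] are polynomials over [K] in the [p^m]-th powers of those of [y_0]; the
    induction replaces [S] by the set of [z] with [z^p] in [S]. *)
Lemma orbit_in_pth_powers (K E : fieldType) (iota : {rmorphism K -> E}) p n
    (G : 'I_n -> {mpoly K[n]}) (y : nat -> 'I_n -> E) : p \in [pchar E] ->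
  (forall m i, y m.+1 i = mmap iota (fun l => y m l ^+ p) (G i)) ->
  forall m (S : E -> Prop), (forall a, S (iota a)) ->
  (forall a b, S a -> S b -> S (a + b)) -> (forall a b, S a -> S b -> S (a * b)) ->
  (forall i, S (y 0%N i ^+ (p ^ m))) -> forall i, S (y m i).
Proof.
move=> hp yG; elim=> [|m IH] S SK SD SM hS i.
  by have := hS i; rewrite expn0 expr1.
rewrite yG; apply: (mmap_closed (A := S)) => //.
- by rewrite -(rmorph0 iota).
- by rewrite -(rmorph1 iota).
apply: (IH (fun z => S (z ^+ p))) => [a|a b ha hb|a b ha hb|l].
- by rewrite -rmorphXn.
- by have := exprD_pchar 1 a b hp; rewrite expn1 => ->; apply: SD.
- by rewrite exprMn; apply: SM.
- by rewrite -exprM -expnSr.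
Qed.

Lemma orbit_eventually_in_span (K E : fieldType) (iota : {rmorphism K -> E}) p n r
    (G : 'I_n -> {mpoly K[n]}) (y : nat -> 'I_n -> E) u (c : 'I_r -> E) :
  p \in [pchar E] ->
  (forall m i, y m.+1 i = mmap iota (fun l => y m l ^+ p) (G i)) ->
  algebra_span iota c -> (forall i, span_over iota c (y 0%N i ^+ (p ^ u))) ->
  forall m, (u <= m)%N -> forall i, span_over iota c (y m i).
Proof.
move=> hp yG hc hu m um; apply: (orbit_in_pth_powers hp yG).
- exact: algebra_span_cst.
- exact: span_overD.
- exact: algebra_spanM.
move=> i; rewrite -(subnKC um) expnD exprM; move: (hu i).
elim: (p ^ (m - u))%N => [|k IH] h; first by rewrite expr0; apply: hc.1.
by rewrite exprS; apply: algebra_spanM => //; apply: IH.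
Qed.

Lemma pe_eval_neq0 (E : fieldType) N (f : proj_endo N E) (x : 'rV[E]_N.+1) :
  x != 0 -> pe_eval f x != 0.
Proof.
case/rV0Pn=> j xj; apply: contraNneq xj => fx.
have [M [c /(congr1 (meval (fun l => x 0 l)))]] := pe_generate f j.
rewrite rmorphXn rmorph_sum /= mevalXU big1 => [/eqP|i _].
  by rewrite expf_eq0 => /andP[].
by rewrite rmorphM /=; have /rowP/(_ i) := fx; rewrite !mxE => ->; rewrite mulr0.
Qed.

Lemma homog_meval1_eq0 (E : fieldType) d (P : {mpoly E[1]}) (v : 'I_1 -> E) :
  P \is d.-homog -> v ord0 != 0 -> P.@[v] = 0 <-> P = 0.
Proof.
move=> hP v0; have PE : P = P@_(U_(ord0) *+ d) *: 'X_ord0 ^+ d.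
  apply/mpolyP => m; rewrite mcoeffZ mpolyXn mcoeffX.
  case: eqVneq => [<-|md]; first by rewrite mulr1.
  rewrite mulr0; apply: memN_msupp_eq0; apply: contra md => mP.
  apply/eqP/mnmP => i; rewrite (ord1 i) mulmnE mnm1E eqxx mul1n.
  by rewrite -(dhomog_mf hP mP) /= mdegE big_ord1.
split=> [|->]; last by rewrite meval0.
rewrite {1}PE mevalZ rmorphXn /= mevalXU => /eqP.
rewrite mulf_eq0 expf_eq0 (negPf v0) andbF orbF => /eqP c0.
by rewrite PE c0 scale0r.
Qed.

(** In one variable a form vanishes at a nonzero vector only if it is zero, so every time is a
    return time or none is. *)
Lemma DML_point (E : fieldType) (f : proj_endo 0 E) : DML f.
Proof.
move=> x x0 T homT; pose y m := iter m (pe_eval f) x.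
have y0 m : y m 0 ord0 != 0.
  have /rV0Pn[i] : y m != 0 by elim: m => // m IH; apply: pe_eval_neq0.
  by rewrite (ord1 i).
have e m : zero_locus T (y m) <-> forall P, T P -> P = 0.
  by split=> h P TP; have [d hP] := homT P TP; apply/(homog_meval1_eq0 hP (y0 m))/h.
have [h|h] := pselect (forall P, T P -> P = 0).
  exists [:: (1%N, 0%N)] => m; split=> _; last exact/e.
  by exists (1%N, 0%N); rewrite ?mem_head //; exists m; rewrite mul1n addn0.
by exists [::] => m; split=> [/e|[]].
Qed.

Lemma frobenius_deg N (k : fieldType) (f : proj_endo N k) q : (0 < N)%N ->
  proj_endo_eq f (frobenius N k q) -> pe_deg f = q.
Proof.
move=> N0 /(frobenius_form N0)[c c0 hc].
have h1 := pe_homog f ord0; rewrite hc in h1.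
have h2 : c *: ('X_ord0 : {mpoly k[N.+1]}) ^+ q \is q.-homog.
  apply: rpredZ; have := @dhomogMn _ _ mdeg 1 ('X_ord0 : {mpoly k[N.+1]}) q.
  by rewrite mul1n; apply; rewrite dhomogX /= mdeg1.
apply: (dhomog_uniq _ h1 h2).
by rewrite scaler_eq0 (negPf c0) mpolyXn_neq0.
Qed.

Theorem theorem1p0p3
  (K : fieldType) (v : discrete_valuation K)
  (hK : is_local_field v) (hchar : exists p0 : nat, p0 \in [pchar K])
  (Kbar : closedFieldType) (iota : {rmorphism K -> Kbar})
  (hKbar : forall z : Kbar, algebraicOver iota z)
  (N : nat) (f : proj_endo N (valring v))
  (hdf : cotangent_map_zero f)
  (p e : nat) (hp : p \in [pchar (residue_field v)])
  (hf0 : proj_endo_eq (base_change (reduction (v := v)) f)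
           (frobenius N (residue_field v) (p ^ e)%N)) :
  DML (base_change (iota \o (val : valring v -> K)) f).
Proof.
(* The shape of the forms is found by comparing two different variables, so [N = 0] is treated
   apart. *)
case: N f hdf hf0 => [|N'] f hdf hf0; first exact: DML_point.
set N := N'.+1 in f hdf hf0 *; have N0 : (0 < N)%N by [].
have [compl [s hs]] := hK.
have hpK : p \in [pchar K].
  have [p0 hp0] := hchar; suff <- : p0 = p by [].
  have p0O : p0%:R = 0 :> valring v.
    by apply: val_inj; rewrite rmorph_nat rmorph0 (pcharf0 hp0).
  have : p0 \in [pchar (residue_field v)].
    rewrite inE /= (pcharf_prime hp0).
    by rewrite -(rmorph_nat (reduction (v := v))) p0O rmorph0 eqxx.
  by rewrite (pcharf_eq hp) inE => /eqP.
have hpO : p \in [pchar valring v].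
  rewrite inE (pcharf_prime hp); apply/eqP/val_inj.
  by rewrite rmorph_nat rmorph0 (pcharf0 hpK).
have hpE : p \in [pchar Kbar] by rewrite (fmorph_pchar iota).
have [t [t0 vt]] : exists t : valring v, val t != 0 /\ v (val t) = 1.
  have [t t0 vt] := dval_uniformizer v.
  have [|t' ht'] := @valring_lift K v t; first by right; rewrite vt.
  by exists t'; rewrite ht'.
have [tau tauK] := teichmuller_morphism compl hs hp hpO t0 vt.
have dvr := valring_equal_char_dvr compl hs hp hpO t0 vt tauK.
have [G hG] : exists G : N.+1.-tuple {mpoly (valring v)[N.+1]},
    forall i, tnth f i = tnth G i \mPo power_vars (valring v) p N.+1.
  have /choice[g hg] : forall i, exists g, tnth f i = g \mPo power_vars (valring v) p N.+1.
    by move=> i; apply: form_pth_power_vars => // l; apply: mderiv_form_eq0.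
  by exists [tuple g i | i < N.+1] => i; rewrite tnth_mktuple.
(* The reduced forms are [p^e]-th powers of the variables up to a common constant, so some iterate
   reduces to a power of the absolute Frobenius. *)
have [c c0 hc] := frobenius_form N0 hf0.
have De : pe_deg f = (p ^ e)%N := frobenius_deg N0 hf0.
have D0 : (0 < pe_deg f)%N by rewrite De; apply: pX_gt0 hp _.
have [r r0 [m0 hr]] := frobenius_iterate hs hp c0 hc.
have redF : exists m, forall P : {mpoly (valring v)[N.+1]},
    map_mpoly (reduction (v := v)) (P \mPo tuple_iter f r) =
    map_mpoly (reduction (v := v)) P ^+ (p ^ m).
  by exists m0 => P; rewrite map_comp_mpoly map_tuple_iter hr.
move=> x x0 T homT; set fE := base_change _ f.
pose y m i := iter m (pe_eval fE) x 0 i.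
pose FK := [tuple map_mpoly (val : valring v -> K) (tnth f i) | i < N.+1].
have FE : [tuple map_mpoly iota (tnth FK i) | i < N.+1] = fE.
  apply: eq_from_tnth => i; rewrite !tnth_mktuple.
  by rewrite [LHS]mmap_map_mpoly.
have yS m i : y m.+1 i = mmap (iota \o (val : valring v -> K)) (y m) (tnth f i).
  by rewrite /y iterS mxE tnth_mktuple [LHS]mmap_map_mpoly.
have y_neq0 m : exists i, y m i != 0.
  by apply/rV0Pn; elim: m => // m IH; apply: pe_eval_neq0.
have yG m i : y m.+1 i = mmap iota (fun l => y m l ^+ p)
    (map_mpoly (val : valring v -> K) (tnth G i)).
  rewrite yS hG mmap_comp_mpoly mmap_map_mpoly; apply: eq_bigr => w _.
  congr (_ * _); apply: mmap1_eq => l; rewrite tnth_mktuple rmorphXn.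
  by congr (_ ^+ p); rewrite [LHS]mmapX mmap1U.
(* The finite algebra spanned by [b] contains the coordinates of all [y_m] with [m >= u], and the
   [p]-th powers of [b] are independent over [K]; it serves as [L]. *)
have [u [r' [b [hb hu bp]]]] := separable_subalgebra hpE (fun i => hKbar (y 0%N i)).
have hvan U : ultrafilter U -> exists a0, forall a, (a0 <= a)%N -> forall P,
    vanishing (pe_deg f) iota y U (r * a) P <-> vanishing (pe_deg f) iota y U (r * a0) P.
  apply: (vanishing_eventually_constant dvr D0 (pe_homog f) hG r0 redF yS y_neq0
    (L := span_over iota b)).
  - exact: algebra_span_cst.
  - exact: span_overD.
  - exact: algebra_spanM.
  - by exists u => m um; apply: (orbit_eventually_in_span hpE yG hb hu um).
  - apply: (span_pth_powers_independent hpE bp) => a.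
    exact: (pth_powers_independent dvr).
have := return_times_finite_union_of_AP hKbar r0 (F := FK) (D := pe_deg f) _ _ hvan homT.
rewrite FE; apply.
  exact: pe_homog.
by move=> m i; rewrite /y iterS mxE.
Qed.
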